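(* Let $(G,H)=(\mathrm U(p,q),\mathrm U(p_1,q_1)\times\mathrm U(p-p_1,q-q_1))$ with $0<p_1<p$, $0<q_1<q$, $0\le r\le\min\{p,q\}$, and let $S\in\mathcal O(r_U,r_W,a,b_U,b_W)\subseteq\mathrm{Gr}_G(r)$, with stabilizer $H_S=\{h\in H:h(S)=S\}$. Then $$\dim\mathcal O(r_U,r_W,a,b_U,b_W)=(p_1+q_1)^2+(p-p_1+q-q_1)^2-\dim H_S$$ and $$\begin{aligned}\dim H_S=\;&(p_1+q_1+r_W)^2+(p-p_1+q-q_1+r_U)^2-2(p+q)r+2r^2\\&-4r_Ur_W+2a^2+(b_U+b_W)(2a+b_U+b_W),\end{aligned}$$ where $r=r_U+r_W+a+b_U+b_W$.
   Context: $V=\mathbb C^{p+q}$ has a nondegenerate Hermitian form $B$ of signature $(p,q)$; $V=U\oplus W$ with $U\perp W$, $B|_U$ of signature $(p_1,q_1)$ and $B|_W$ of signature $(p-p_1,q-q_1)$. $G$ is the isometry group of $V$ and $H$ the product of the isometry groups of $U$ and $W$. $\mathrm{Gr}_G(r)$ is the variety of $r$-dimensional complex subspaces $S$ of $V$ with $S\perp S$. Dimensions of subspaces of $V$ and their quotients are complex dimensions; dimensions of groups and orbits are real dimensions. For a subspace $X$, $\mathrm{Rad}(X)=X\cap X^\perp$; $\mathbf P_US=(S+W)\cap U$, $\mathbf P_WS=(S+U)\cap W$. For $S\in\mathrm{Gr}_G(r)$: $r_U(S)=\dim(S\cap U)$, $r_W(S)=\dim(S\cap W)$, $a(S)=\dim\frac{\mathrm{Rad}(\mathbf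 P_US)}{S\cap U}=\dim\frac{\mathrm{Rad}(\mathbf P_WS)}{S\cap W}$, and $b_U(S)$ (resp. $b_W(S)$) is the dimension of a maximal positive definite (resp. negative definite) subspace of $\mathbf P_US$. The 5-tuple $(r_U(S),r_W(S),a(S),b_U(S),b_W(S))$ determines the $H$-orbit of $S$; $\mathcal O(r_U,r_W,a,b_U,b_W)$ denotes the $H$-orbit with this 5-tuple. *)

(* Defs.v *)
From HB Require Import structures.
From mathcomp Require Import all_boot all_order all_algebra.
From mathcomp Require Import complex.
From mathcomp Require Import all_classical all_reals all_analysis.

Set Implicit Arguments.
Unset Strict Implicit.
Unset Printing Implicit Defensive.

Import Order.TTheory GRing.Theory Num.Theory.
Import numFieldNormedType.Exports.

Local Open Scope classical_set_scope.
Local Open Scope ring_scope.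

Section Smooth.
Variable R : realType.

(* Only used between finite-dimensional spaces, where continuity of all the
   maps x |-> 'D_v f x is the same as continuity of x |-> 'd f x.             *)
Fixpoint Ck_on (E F : normedModType R) (k : nat) (A : set E) (f : E -> F) :
    Prop :=
  if k is k'.+1 then
    (forall x, A x -> differentiable f x) /\
    (forall v, Ck_on k' A (fun x => 'D_v f x))
  else forall x, A x -> {for x, continuous f}.

Definition smooth_on (E F : normedModType R) (A : set E) (f : E -> F) : Prop :=
  forall k, Ck_on k A f.

(* M is a smoothly embedded submanifold of E of real dimension d: each point
   has a neighbourhood in M diffeomorphic to an open subset V of R^d, where
   the chart psi is the restriction of a smooth map on an open subset of E.   *)
Definition submanifold (E : normedModType R) (d : nat) (M : set E) : Prop :=
  forall x, M x ->
  exists (Om : set E) (V : set 'rV[R]_d)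
         (phi : 'rV[R]_d -> E) (psi : E -> 'rV[R]_d),
    [/\ open Om, Om x & open V] /\
    [/\ smooth_on V phi, smooth_on Om psi,
        phi @` V = M `&` Om & forall v, V v -> psi (phi v) = v].

(* 'M[R[i]]_(m, n) is only a normed module over R[i] in the library; real
   dimensions are taken after splitting into real and imaginary parts.        *)
Definition realify (m n : nat) (A : set 'M[R[i]]_(m, n)) :
    set ('M[R]_(m, n) * 'M[R]_(m, n))%type :=
  [set (map_mx (@complex.Re R) Z, map_mx (@complex.Im R) Z) | Z in A].

End Smooth.

Section Grassmannian.
Variables (R : realType) (n : nat).

Definition colspan (r : nat) (A : 'M[R[i]]_(n, r)) : {vspace 'cV[R[i]]_n} :=
  limg (linfun (mulmx A : 'cV[R[i]]_r -> 'cV[R[i]]_n)).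

(* Submanifolds of the Grassmannian of r-dimensional subspaces of C^n, through
   its standard atlas: for a basis of C^n given by the columns of A and C, the
   chart Z |-> colspan (A + C *m Z) is a bijection from the (n - r) x r complex
   matrices onto the set of complements of colspan C.                         *)
Definition Gr_submanifold (r d : nat) (O : set {vspace 'cV[R[i]]_n}) : Prop :=
  (forall X, O X -> \dim X = r) /\
  (forall (A : 'M[R[i]]_(n, r)) (C : 'M[R[i]]_(n, n - r)),
     \rank (row_mx A C) = n ->
     submanifold d (realify [set Z | O (colspan (A + C *m Z))])).

End Grassmannian.

Section HermitianSpace.
Variables (R : realType) (n : nat).
Variable B : {hermitian_sym 'cV[R[i]]_n for Num.conj}.
Implicit Types X Y S U W : {vspace 'cV[R[i]]_n}.
Implicit Type h : 'M[R[i]]_n.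

Definition pos_def X : Prop := forall x, x \in X -> x != 0 -> 0 < B x x.
Definition neg_def X : Prop := forall x, x \in X -> x != 0 -> B x x < 0.

Definition pos_index X : nat :=
  \max_(k < (\dim X).+1 |
      `[< exists Y, [/\ (Y <= X)%VS, \dim Y = k & pos_def Y] >]) k.
Definition neg_index X : nat :=
  \max_(k < (\dim X).+1 |
      `[< exists Y, [/\ (Y <= X)%VS, \dim Y = k & neg_def Y] >]) k.

Definition Rad X : {vspace 'cV[R[i]]_n} := (X :&: orthov B X)%VS.

Definition nondegenerate_of_signature X (s t : nat) : Prop :=
  [/\ Rad X = 0%VS, pos_index X = s & neg_index X = t].

Definition Gr_G (r : nat) : set {vspace 'cV[R[i]]_n} :=
  [set S | \dim S = r /\ (S <= orthov B S)%VS].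

Section Invariants.
Variables U W : {vspace 'cV[R[i]]_n}.

Definition P_U S : {vspace 'cV[R[i]]_n} := ((S + W) :&: U)%VS.

Definition r_U S : nat := \dim (S :&: U).
Definition r_W S : nat := \dim (S :&: W).
Definition a_inv S : nat := (\dim (Rad (P_U S)) - \dim (S :&: U))%N.
Definition b_U S : nat := pos_index (P_U S).
Definition b_W S : nat := neg_index (P_U S).

Definition act h X : {vspace 'cV[R[i]]_n} :=
  (linfun (mulmx h : 'cV[R[i]]_n -> 'cV[R[i]]_n) @: X)%VS.

Definition isometry_of X h : Prop :=
  act h X = X /\
  (forall x y, x \in X -> y \in X -> B (h *m x) (h *m y) = B x y).

(* When V is the direct sum of U and W, an element of the product of the two
   isometry groups is the block-diagonal h restricting to isometries of both. *)
Definition H_group : set 'M[R[i]]_n :=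
  [set h | isometry_of U h /\ isometry_of W h].

Definition H_orbit S : set {vspace 'cV[R[i]]_n} := [set act h S | h in H_group].

Definition H_stab S : set 'M[R[i]]_n := [set h | H_group h /\ act h S = S].

End Invariants.
End HermitianSpace.

(* Main.v *)
(* Write h and X for matrices commuting with the projection pU onto U along W, and
   let G be the Gram matrix of the form: H is given by h^* G h = G and its Lie
   algebra by G X skew-Hermitian. The Cayley transform c(X) = (1 - X)(1 + X)^-1 is
   a rational involution exchanging the Lie algebra and the group near 1, for H as
   for H_S, and yields the charts of H_S. On a complement of Lie(H_S) in Lie(H),
   X |-> c(X) S is an immersion into the Grassmannian. That it covers a
   neighbourhood of S in the orbit comes from equations satisfied on the orbit:
   for a frame M, the space is isotropic and the ranks of pU M, pW M and
   beta = M^* G pU M are constant. By an infinitesimal form of Witt's theorem, the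
   linearized equations force a tangent vector to come from Lie(H).

   The dimension of Lie(H_S) is computed from its action nu on S in the frame M.
   The elements killing S are pairs of skew-Hermitian forms on U and W killing
   pU S and pW S. By Witt again, nu is any matrix preserving S :&: W and S :&: U,
   the kernels of pU and pW on S, with beta nu skew-Hermitian. By Sylvester's law
   of inertia the rank of beta is b_U + b_W. *)

(* The obstacle is that an orbit must be shown to be embedded, not merely immersed. No closedness of
   the orbit is invoked, and the equations are only asked to hold on it, not to cut it out. Two
   orbit points near S with the same image under a linear left inverse of the differential have a
   difference almost annihilated by an injective linear map, hence coincide. Both points move, so
   this takes strict differentiability, not differentiability at S. Using field operations only
   makes every map smooth and strictly differentiable by induction on its construction.

   The terms of the formula come from a count, with u and w the dimensions of pU S and pW S, and b =
   b_U + b_W. The elements killing S give (dim U - u)^2 + (dim W - w)^2. The action on S gives b^2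
   for the skew-Hermitian forms on S modulo the kernel of beta, 2 r_U^2 + 2 r_W^2 for the
   endomorphisms of S :&: U and S :&: W, and 2 (r - b)(r - r_U - r_W) for the maps from S modulo the
   sum of these two into the kernel of beta. Then u = b + r_U + a and w = b + r_W + a. *)
Require Import Defs.
From HB Require Import structures.
From mathcomp Require Import all_boot all_order all_algebra.
From mathcomp Require Import complex.
From mathcomp Require Import all_classical all_reals all_analysis.
From mathcomp Require Import ring lra zify.

Import Order.TTheory GRing.Theory Num.Theory.
Import numFieldNormedType.Exports.

Local Open Scope classical_set_scope.
Local Open Scope ring_scope.

(** * Rational maps *)

Section RationalMaps.
Set Implicit Arguments.
Unset Strict Implicit.
Variable R : realType.

(** The epsilon form is what the estimates on a local inverse produce in [local_inverse]. *)
Lemma is_diffP (E F : normedModType R) (f : E -> F) (x : E)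
    (l : {linear E -> F}) : continuous l ->
  is_diff x f l <-> forall e : R, 0 < e ->
    \forall y \near x, `|f y - f x - l (y - x)| <= e * `|y - x|.
Proof.
move=> cl; split.
  move=> [] /diff_locallyP[_ +] dfl; rewrite dfl => /eqaddoP fo e e0.
  have := fo e e0; rewrite -[0]/(0 : E) => fo'.
  rewrite (near_shift 0) /=; near=> y.
  have : `|(f \o shift x - (cst (f x) + l)) y| <= e * `|y| by near: y; exact: fo'.
  by rewrite !fctE /= !opprD !addrA subr0 addrK.
move=> fo.
have fE : f \o shift x = cst (f x) + l +o_ (0 : E) id.
  apply/eqaddoP => e e0; have := fo e e0; rewrite (near_shift 0) /= => fo'.
  near=> y.
  have : `|f (y + (x - 0)) - f x - l (y + (x - 0) - x)| <= e * `|y + (x - 0) - x|.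
    by near: y; exact: fo'.
  by rewrite !fctE /= !opprD !addrA subr0 addrK.
have dE := diff_unique cl fE.
split=> //; apply/diff_locallyP; split; first by rewrite dE.
by rewrite dE.
Unshelve. all: by end_near. Qed.

Lemma near_eq_is_diff (E F : normedModType R) (f g : E -> F) (x : E) l :
  (\forall y \near x, f y = g y) -> is_diff x f l -> is_diff x g l.
Proof.
move=> fg fl; have fx := nbhs_singleton fg.
have [df dfl] := fl; have cl := diff_continuous df; rewrite -dfl.
apply/is_diffP => // e e0; have := (is_diffP _ _ cl).1 (differentiableP df) e e0.
move=> fo; near=> y; rewrite -fx -(near fg y); last by [].
by near: y.
Unshelve. all: by end_near. Qed.

Section CkOn.
Variables (E F : normedModType R) (A : set E).
Hypothesis oA : open A.

(** A derivative depends only on a germ; openness of [A] turns equality on [A] into equality of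
    germs, so the induction passes to derivatives. *)
Lemma eq_Ck_on k (f g : E -> F) :
  (forall x, A x -> f x = g x) -> Ck_on k A f -> Ck_on k A g.
Proof.
elim: k f g => [|k IH] f g fg /=.
  move=> cf x Ax; have fgx : \forall y \near x, f y = g y.
    by apply: filterS (open_nbhs_nbhs (conj oA Ax)) => y; exact: fg.
  rewrite /prop_for /continuous_at -fg //.
  apply: cvg_trans (cf x Ax); apply: near_eq_cvg.
  by apply: filterS fgx.
move=> [df dDf]; have fgx x : A x -> \forall y \near x, f y = g y.
  by move=> Ax; apply: filterS (open_nbhs_nbhs (conj oA Ax)) => y; exact: fg.
have dfg x (Ax : A x) := near_eq_is_diff (fgx x Ax) (differentiableP (df x Ax)).
split=> [x Ax|v]; first by have [] := dfg x Ax.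
apply: IH (dDf v) => x Ax; have [dg dgE] := dfg x Ax.
by rewrite (deriveE _ dg) dgE (deriveE _ (df x Ax)).
Qed.

Lemma Ck_on_sub k (B : set E) (f : E -> F) : B `<=` A -> Ck_on k A f -> Ck_on k B f.
Proof.
move=> BA; elim: k f => [|k IH] f /=; first by move=> cf x /BA; exact: cf.
by move=> [df dDf]; split=> [x /BA|v]; [exact: df|exact/IH/dDf].
Qed.

End CkOn.

Section Rational.
Variable E : normedModType R.
Implicit Types (A : set E) (f g : E -> R).

(** Stability under directional derivatives yields smoothness of all orders by one induction. The
    inverse is the total one of the field, so nonvanishing is only asked on [A]. *)
Inductive rational_on (A : set E) : (E -> R) -> Prop :=
| rational_cst c : rational_on A (fun=> c)
| rational_lin (l : {linear E -> R}) : continuous l -> rational_on A l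
| rational_add f g : rational_on A f -> rational_on A g ->
    rational_on A (fun x => f x + g x)
| rational_mul f g : rational_on A f -> rational_on A g ->
    rational_on A (fun x => f x * g x)
| rational_inv f : rational_on A f -> (forall x, A x -> f x != 0) ->
    rational_on A (fun x => (f x)^-1).

Lemma rational_sub A B f : B `<=` A -> rational_on A f -> rational_on B f.
Proof.
move=> BA; elim=> {f} [c|l cl|f g _ rf _ rg|f g _ rf _ rg|f _ rf f0].
- exact: rational_cst.
- exact: rational_lin.
- exact: rational_add.
- exact: rational_mul.
- by apply: rational_inv => // x /BA; exact: f0.
Qed.

Lemma rational_opp A f : rational_on A f -> rational_on A (fun x => - f x).
Proof.
move=> rf; have := rational_mul (rational_cst A (-1)) rf.
by congr rational_on; apply/funext => x; rewrite mulN1r.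
Qed.

Lemma rational_sum A (I : Type) (s : seq I) (P : pred I) (F : I -> E -> R) :
  (forall i, P i -> rational_on A (F i)) ->
  rational_on A (fun x => \sum_(i <- s | P i) F i x).
Proof.
move=> rF; elim: s => [|i s IH].
  have := rational_cst A 0; congr rational_on.
  by apply/funext => x; rewrite big_nil.
have [Pi|nPi] := boolP (P i).
  have := rational_add (rF i Pi) IH; congr rational_on.
  by apply/funext => x; rewrite big_cons Pi.
have := IH; congr rational_on.
by apply/funext => x; rewrite big_cons (negbTE nPi).
Qed.

(** The derivative is identified only on [A], since an inverted function may vanish elsewhere;
    [eq_Ck_on] absorbs the difference when [A] is open. *)
Lemma rational_derive A f : rational_on A f ->
  (forall x, A x -> differentiable f x) /\
  forall v, exists2 g, rational_on A g & forall x, A x -> 'D_v f x = g x.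
Proof.
elim=> {f} [c|l cl|f g rf [df Df] rg [dg Dg]|f g rf [df Df] rg [dg Dg]
           |f rf [df Df] f0].
- split=> // v; exists (fun=> 0); first exact: rational_cst.
  by move=> x _; rewrite derive_cst.
- have dl x : differentiable l x by exact: linear_differentiable.
  split=> // v; exists (fun=> l v); first exact: rational_cst.
  by move=> x _; rewrite deriveE // diff_lin.
- split=> [x Ax|v]; first by apply: differentiableD; [exact: df|exact: dg].
  have [f' rf' f'E] := Df v; have [g' rg' g'E] := Dg v.
  exists (fun x => f' x + g' x) => [|x Ax]; first exact: rational_add.
  by rewrite deriveD ?f'E ?g'E //; apply: diff_derivable; [exact: df|exact: dg].
- split=> [x Ax|v]; first by apply: differentiableM; [exact: df|exact: dg].
  have [f' rf' f'E] := Df v; have [g' rg' g'E] := Dg v.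
  exists (fun x => f x * g' x + g x * f' x) => [|x Ax].
    by apply: rational_add; apply: rational_mul.
  by rewrite deriveM ?f'E ?g'E //; apply: diff_derivable; [exact: df|exact: dg].
- split=> [x Ax|v]; first by apply: differentiableV; [exact: df|exact: f0].
  have [f' rf' f'E] := Df v.
  exists (fun x => - ((f x)^-1 * (f x)^-1 * f' x)) => [|x Ax].
    by apply/rational_opp/rational_mul => //; apply: rational_mul;
       apply: rational_inv.
  rewrite deriveV ?f'E //; [|exact: f0|exact/diff_derivable/df].
  by rewrite -exprVn expr2 scaleNr.
Qed.

Lemma rational_Ck A f k : open A -> rational_on A f -> Ck_on k A f.
Proof.
move=> oA; elim: k f => [|k IH] f rf /=; have [df Df] := rational_derive rf.
  by move=> x Ax; exact/differentiable_continuous/df.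
split=> // v; have [g rg gE] := Df v.
by apply: (eq_Ck_on oA _ (IH g rg)) => x Ax; rewrite gE.
Qed.

Lemma rational_continuous A f x : A x -> rational_on A f -> {for x, continuous f}.
Proof. by move=> Ax /rational_derive[df _]; exact/differentiable_continuous/df. Qed.

End Rational.
End RationalMaps.

Section VectorValued.
Set Implicit Arguments.
Unset Strict Implicit.
Variables (R : realType) (E F : normedModType R) (A : set E).
Hypothesis oA : open A.

Lemma Ck_on_add k (f g : E -> F) :
  Ck_on k A f -> Ck_on k A g -> Ck_on k A (fun x => f x + g x).
Proof.
elim: k f g => [|k IH] f g /=.
  by move=> cf cg x Ax; apply: cvgD; [exact: cf|exact: cg].
move=> [df Df] [dg Dg]; split=> [x Ax|v].
  by apply: differentiableD; [exact: df|exact: dg].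
apply: (eq_Ck_on oA _ (IH _ _ (Df v) (Dg v))) => x Ax.
by rewrite deriveD //; apply: diff_derivable; [exact: df|exact: dg].
Qed.

Lemma Ck_on_scale k (c : E -> R) (e : F) :
  Ck_on k A c -> Ck_on k A (fun x => c x *: e).
Proof.
elim: k c => [|k IH] c /=.
  by move=> cc x Ax; apply: cvgZr_tmp; exact: cc.
move=> [dc Dc]; split=> [x Ax|v].
  by apply: differentiableZl; exact: dc.
apply: (eq_Ck_on oA _ (IH _ (Dc v))) => x Ax.
have dcx := dc x Ax; rewrite (deriveE _ dcx).
by rewrite (deriveE _ (differentiableZl e dcx)) (diffZl e dcx).
Qed.

Lemma Ck_on_cst k (e : F) : Ck_on k A (fun=> e).
Proof.
elim: k e => [|k IH] e /=; first by move=> x _; exact: cvg_cst.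
split=> [x _|v]; first exact: differentiable_cst.
by apply: (eq_Ck_on oA _ (IH 0)) => x Ax; rewrite derive_cst.
Qed.

Lemma Ck_on_sum k (I : Type) (s : seq I) (c : I -> E -> R) (e : I -> F) :
  (forall i, Ck_on k A (c i)) -> Ck_on k A (fun x => \sum_(i <- s) c i x *: e i).
Proof.
move=> cc; elim: s => [|i s IH].
  by apply: (eq_Ck_on oA _ (Ck_on_cst k 0)) => x _; rewrite big_nil.
have := Ck_on_add (Ck_on_scale (e i) (cc i)) IH.
by apply: (eq_Ck_on oA) => x _; rewrite big_cons.
Qed.

End VectorValued.

Section MatrixValued.
Set Implicit Arguments.
Unset Strict Implicit.
Variables (R : realType) (E : normedModType R) (A : set E).
Hypothesis oA : open A.

Lemma Ck_on_mx k m n (f : E -> 'M[R]_(m, n)) :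
  (forall i j, Ck_on k A (fun x => f x i j)) -> Ck_on k A f.
Proof.
move=> cf; have := @Ck_on_sum _ _ _ A oA k _ (index_enum ('I_m * 'I_n)%type)
   (fun ij x => f x ij.1 ij.2) (fun ij => delta_mx ij.1 ij.2)
   (fun ij => cf ij.1 ij.2).
apply: (eq_Ck_on oA) => x _; rewrite [RHS]matrix_sum_delta.
by rewrite pair_bigA.
Qed.

Lemma Ck_on_mx_pair k m n (f : E -> ('M[R]_(m, n) * 'M[R]_(m, n))%type) :
  (forall i j, Ck_on k A (fun x => (f x).1 i j)) ->
  (forall i j, Ck_on k A (fun x => (f x).2 i j)) -> Ck_on k A f.
Proof.
move=> cf1 cf2.
have c1 := @Ck_on_sum _ _ ('M[R]_(m, n) * 'M[R]_(m, n))%type A oA k _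
   (index_enum ('I_m * 'I_n)%type)
   (fun ij x => (f x).1 ij.1 ij.2) (fun ij => (delta_mx ij.1 ij.2, 0))
   (fun ij => cf1 ij.1 ij.2).
have c2 := @Ck_on_sum _ _ ('M[R]_(m, n) * 'M[R]_(m, n))%type A oA k _
   (index_enum ('I_m * 'I_n)%type)
   (fun ij x => (f x).2 ij.1 ij.2) (fun ij => (0, delta_mx ij.1 ij.2))
   (fun ij => cf2 ij.1 ij.2).
apply: (eq_Ck_on oA _ (Ck_on_add oA c1 c2)) => x _.
have E1 (I : Type) (s : seq I) (h : I -> ('M[R]_(m, n) * 'M[R]_(m, n))%type) :
    \sum_(i <- s) h i = (\sum_(i <- s) (h i).1, \sum_(i <- s) (h i).2).
  elim: s => [|i s IH]; first by rewrite !big_nil.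
  by rewrite !big_cons IH; case: (h i).
rewrite [f x]surjective_pairing !E1 /=; congr pair => /=.
  rewrite [X in _ + X]big1 ?addr0; last by move=> i _; rewrite scaler0.
  by rewrite [RHS]matrix_sum_delta pair_bigA.
rewrite [X in X + _]big1 ?add0r; last by move=> i _; rewrite scaler0.
by rewrite [RHS]matrix_sum_delta pair_bigA.
Qed.

End MatrixValued.

(** * Strict differentiability of rational functions *)

Section StrictDifferentiability.
Set Implicit Arguments.
Unset Strict Implicit.
Variables (R : realType) (E : normedModType R).
Implicit Types (f g : E -> R) (x : E).

(* Strict differentiability. *)
Definition sdiff f x (l : E -> R) := is_diff x f l /\ forall e : R, 0 < e ->
  \forall z \near (x, x), `|f z.1 - f z.2 - l (z.1 - z.2)| <= e * `|z.1 - z.2|.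

Lemma is_diff_bound f x l : is_diff x f l ->
  exists2 C : R, 0 < C & forall v, `|l v| <= C * `|v|.
Proof.
move=> [df <-]; have := linear_lipschitz (diff_continuous df).
by move=> [C C0 hC]; exists C.
Qed.

Lemma near_pair f x (P : R -> Prop) : {for x, continuous f} ->
  (\forall t \near f x, P t) -> \forall z \near (x, x), P (f z.1) /\ P (f z.2).
Proof.
move=> cf Pf; have Px := cf _ Pf.
by exists ([set y | P (f y)], [set y | P (f y)]) => // z [].
Qed.

Lemma near_dist f x (e : R) : {for x, continuous f} -> 0 < e ->
  \forall z \near (x, x), `|f z.1 - f x| <= e /\ `|f z.2 - f x| <= e.
Proof.
move=> cf e0; apply: (near_pair (P := fun t => `|t - f x| <= e)) cf _.
apply/nbhs_ballP; exists e => //= t; rewrite /ball /= distrC.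
exact: ltW.
Qed.

Lemma near_bound f x : {for x, continuous f} ->
  \forall z \near (x, x), `|f z.1| <= `|f x| + 1 /\ `|f z.2| <= `|f x| + 1.
Proof.
move=> cf; have := near_dist cf ltr01; apply: filterS => z [h1 h2]; split.
  by rewrite -lerBlDl; apply: le_trans h1; exact: lerB_dist.
by rewrite -lerBlDl; apply: le_trans h2; exact: lerB_dist.
Qed.

Lemma sdiff_cst x (c : R) : sdiff (fun=> c) x (fun=> 0).
Proof.
split; first exact: is_diff_cst.
by move=> e e0; near=> z; rewrite !subrr normr0 mulr_ge0 // ltW.
Unshelve. all: by end_near. Qed.

Lemma sdiff_lin x (l : {linear E -> R}) : continuous l -> sdiff l x l.
Proof.
move=> cl; split.
  by split; [exact: linear_differentiable|exact: diff_lin].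
by move=> e e0; near=> z; rewrite linearB subrr normr0 mulr_ge0 // ltW.
Unshelve. all: by end_near. Qed.

Lemma sdiff_add f g x l m : sdiff f x l -> sdiff g x m ->
  sdiff (fun x => f x + g x) x (fun v => l v + m v).
Proof.
move=> [df hf] [dg hg]; split; first exact: is_diffD.
move=> e e0; have e2 : 0 < e / 2 by rewrite divr_gt0.
near=> z.
have h1 : `|f z.1 - f z.2 - l (z.1 - z.2)| <= e / 2 * `|z.1 - z.2|.
  by near: z; exact: hf.
have h2 : `|g z.1 - g z.2 - m (z.1 - z.2)| <= e / 2 * `|z.1 - z.2|.
  by near: z; exact: hg.
have -> : f z.1 + g z.1 - (f z.2 + g z.2) - (l (z.1 - z.2) + m (z.1 - z.2)) =
  (f z.1 - f z.2 - l (z.1 - z.2)) + (g z.1 - g z.2 - m (z.1 - z.2)) by ring.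
apply: le_trans (ler_normD _ _) _; apply: le_trans (lerD h1 h2) _.
by rewrite -mulrDl -splitr.
Unshelve. all: by end_near. Qed.

Lemma sdiff_mul f g x l m : sdiff f x l -> sdiff g x m ->
  sdiff (fun x => f x * g x) x (fun v => f x * m v + g x * l v).
Proof.
move=> [df hf] [dg hg]; split; first exact: is_diffM.
move=> e e0.
have cf : {for x, continuous f} by apply: differentiable_continuous; case: df.
have cg : {for x, continuous g} by apply: differentiable_continuous; case: dg.
have [C C0 hC] := is_diff_bound df; have [D D0 hD] := is_diff_bound dg.
pose a := `|f x| + 1; pose b := `|g x| + 1.
have a0 : 0 < a by rewrite /a ltr_wpDl.
have b0 : 0 < b by rewrite /b ltr_wpDl.
have e4 : 0 < e / 4 by rewrite divr_gt0.
near=> z.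
have h1 : `|f z.1 - f z.2 - l (z.1 - z.2)| <= e / 4 / b * `|z.1 - z.2|.
  by near: z; apply: hf; rewrite divr_gt0.
have h2 : `|g z.1 - g z.2 - m (z.1 - z.2)| <= e / 4 / a * `|z.1 - z.2|.
  by near: z; apply: hg; rewrite divr_gt0.
have [h3 _] : `|f z.1 - f x| <= e / 4 / D /\ `|f z.2 - f x| <= e / 4 / D.
  by near: z; apply: near_dist => //; rewrite divr_gt0.
have [_ h4] : `|g z.1 - g x| <= e / 4 / C /\ `|g z.2 - g x| <= e / 4 / C.
  by near: z; apply: near_dist => //; rewrite divr_gt0.
have [h5 _] : `|f z.1| <= a /\ `|f z.2| <= a by near: z; apply: near_bound.
have [_ h6] : `|g z.1| <= b /\ `|g z.2| <= b by near: z; apply: near_bound.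
set h := z.1 - z.2 in h1 h2 *.
(* Each of the four terms receives a quarter of [e]: two are a strict remainder against a bound of
   the other factor, two are a small oscillation against a bound of the other differential. *)
have -> : f z.1 * g z.1 - f z.2 * g z.2 - (f x * m h + g x * l h) =
  f z.1 * (g z.1 - g z.2 - m h) + (f z.1 - f x) * m h +
  (g z.2 * (f z.1 - f z.2 - l h) + (g z.2 - g x) * l h) by ring.
have -> : e * `|h| = (a * (e / 4 / a * `|h|) + e / 4 / D * (D * `|h|)) +
    (b * (e / 4 / b * `|h|) + e / 4 / C * (C * `|h|)).
  by field; rewrite !gt_eqF.
apply: le_trans (ler_normD _ _) _; apply: lerD; apply: le_trans (ler_normD _ _) _;
  by apply: lerD; rewrite normrM; apply: ler_pM.
Unshelve. all: by end_near. Qed.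

Lemma sdiff_inv f x l : sdiff f x l -> f x != 0 ->
  exists m, sdiff (fun x => (f x)^-1) x m.
Proof.
move=> [df hf] f0; have [dfx dfl] := df.
have cf : {for x, continuous f} by apply: differentiable_continuous.
have cu : {for x, continuous (fun x => (f x)^-1)}.
  by apply: differentiable_continuous; apply: differentiableV.
have dV := diffV dfx f0.
exists (fun v => - (f x)^-1 ^+ 2 * l v); split.
  split; first exact: differentiableV.
  by rewrite dV; apply/funext => v /=; rewrite dfl exprVn.
have [C C0 hC] := is_diff_bound df.
move=> e e0; pose u0 := (f x)^-1; pose b := `|u0| + 1.
have b0 : 0 < b by rewrite /b ltr_wpDl.
have e2 : 0 < e / 2 by rewrite divr_gt0.
near=> z.
have [n1 n2] : f z.1 != 0 /\ f z.2 != 0.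
  near: z; apply: (near_pair (P := fun t => t != 0)) cf _.
  apply/nbhs_ballP; exists `|f x| => /=; first by rewrite normr_gt0.
  move=> t; rewrite /ball /= => ht; apply: contraTneq ht => ->.
  by rewrite subr0 ltxx.
have h1 : `|f z.1 - f z.2 - l (z.1 - z.2)| <= e / 2 / (b * b) * `|z.1 - z.2|.
  by near: z; apply: hf; rewrite divr_gt0 // mulr_gt0.
have [h3 h4] : `|(f z.1)^-1 - u0| <= e / 2 / C / (b + b) /\
             `|(f z.2)^-1 - u0| <= e / 2 / C / (b + b).
  near: z; apply: (near_dist cu); rewrite !divr_gt0 //.
  by rewrite addr_gt0.
have [h5 h6] : `|(f z.1)^-1| <= b /\ `|(f z.2)^-1| <= b.
  by near: z; apply: (near_bound cu).
have ub : `|u0| <= b by rewrite lerDl.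
set h := z.1 - z.2 in h1 *.
(* The remainder of [f] appears between two inverses bounded by [b]; the coefficient of [l h] is
   small by continuity of the inverse. *)
have -> : (f z.1)^-1 - (f z.2)^-1 - (- u0 ^+ 2 * l h) =
  - ((f z.1)^-1 * (f z.2)^-1 * (f z.1 - f z.2 - l h)) -
   ((f z.1)^-1 * ((f z.2)^-1 - u0) + u0 * ((f z.1)^-1 - u0)) * l h.
  by field; rewrite n1 n2.
have -> : e * `|h| = b * b * (e / 2 / (b * b) * `|h|) +
    (b * (e / 2 / C / (b + b)) + b * (e / 2 / C / (b + b))) * (C * `|h|).
  by field; rewrite !gt_eqF // addr_gt0.
apply: le_trans (ler_normB _ _) _; apply: lerD.
  by rewrite normrN !normrM ler_pM // ?ler_pM // mulr_ge0.
rewrite normrM ler_pM // (le_trans (ler_normD _ _)) // lerD // normrM ler_pM //.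
Unshelve. all: by end_near. Qed.

(** The strict derivative stays unnamed: in its uses it ends up multiplied by a factor vanishing at
    the base point. *)
Lemma rational_sdiff (A : set E) f x : A x -> rational_on A f ->
  exists l, sdiff f x l.
Proof.
move=> Ax; elim=> {f} [c|l cl|f g _ [l hl] _ [m hm]|f g _ [l hl] _ [m hm]
                      |f _ [l hl] f0].
- by exists (fun=> 0); exact: sdiff_cst.
- by exists l; exact: sdiff_lin.
- by eexists; exact: sdiff_add hl hm.
- by eexists; exact: sdiff_mul hl hm.
- exact: sdiff_inv hl (f0 x Ax).
Qed.

End StrictDifferentiability.

(** * Matrix operations inside a class of functions closed under field operations *)

Section FieldClosure.
Set Implicit Arguments.
Unset Strict Implicit.
Variables (T : Type) (K : fieldType) (A : set T) (P : (T -> K) -> Prop).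
Hypothesis Pc : forall c, P (fun=> c).
Hypothesis Pa : forall f g, P f -> P g -> P (fun x => f x + g x).
Hypothesis Pm : forall f g, P f -> P g -> P (fun x => f x * g x).
Hypothesis Pi : forall f, P f -> (forall x, A x -> f x != 0) ->
  P (fun x => (f x)^-1).

(** [P] is [rational_on A] for real Jacobians and [crational A] for complex matrices, so the
    determinant and cofactor formulas are treated once. *)
Definition closed_mx m n (M : T -> 'M[K]_(m, n)) :=
  forall i j, P (fun x => M x i j).

Lemma closed_sum (I : Type) (s : seq I) (Q : pred I) (F : I -> T -> K) :
  (forall i, P (F i)) -> P (fun x => \sum_(i <- s | Q i) F i x).
Proof.
move=> PF; elim: s => [|i s IH].
  by have := Pc 0; congr P; apply/funext => x; rewrite big_nil.
have [Qi|nQi] := boolP (Q i).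
  by have := Pa (PF i) IH; congr P; apply/funext => x; rewrite big_cons Qi.
by have := IH; congr P; apply/funext => x; rewrite big_cons (negbTE nQi).
Qed.

Lemma closed_prod (I : Type) (s : seq I) (F : I -> T -> K) :
  (forall i, P (F i)) -> P (fun x => \prod_(i <- s) F i x).
Proof.
move=> PF; elim: s => [|i s IH].
  by have := Pc 1; congr P; apply/funext => x; rewrite big_nil.
by have := Pm (PF i) IH; congr P; apply/funext => x; rewrite big_cons.
Qed.

Lemma closed_addmx m n (M N : T -> 'M[K]_(m, n)) :
  closed_mx M -> closed_mx N -> closed_mx (fun x => M x + N x).
Proof.
move=> PM PN i j; have := Pa (PM i j) (PN i j).
by congr P; apply/funext => x; rewrite mxE.
Qed.

Lemma closed_oppmx m n (M : T -> 'M[K]_(m, n)) :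
  closed_mx M -> closed_mx (fun x => - M x).
Proof.
move=> PM i j; have := Pm (Pc (-1)) (PM i j).
by congr P; apply/funext => x; rewrite mxE mulN1r.
Qed.

Lemma closed_mulmx m n p (M : T -> 'M[K]_(m, n)) (N : T -> 'M[K]_(n, p)) :
  closed_mx M -> closed_mx N -> closed_mx (fun x => M x *m N x).
Proof.
move=> PM PN i j.
have : P (fun x => \sum_k M x i k * N x k j).
  by apply: closed_sum => k; exact: Pm.
by congr P; apply/funext => x; rewrite mxE.
Qed.

Lemma closed_det n (M : T -> 'M[K]_n) : closed_mx M -> P (fun x => \det (M x)).
Proof.
move=> PM; apply: closed_sum => s; apply: Pm => //.
by apply: closed_prod => i; exact: PM.
Qed.

Lemma closed_adj n (M : T -> 'M[K]_n) : closed_mx M ->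
  closed_mx (fun x => \adj (M x)).
Proof.
move=> PM i j.
have : P (fun x => (-1) ^+ (j + i) * \det (row' j (col' i (M x)))).
  apply: Pm => //; apply: closed_det => a b.
  by have := PM (lift j a) (lift i b); congr P; apply/funext => x; rewrite !mxE.
by congr P; apply/funext => x; rewrite !mxE.
Qed.

(* Unlike invmx, this inverse is given by one formula for all matrices. *)
Definition detinv n (M : 'M[K]_n) := (\det M)^-1 *: \adj M.

Lemma closed_detinv n (M : T -> 'M[K]_n) : closed_mx M ->
  (forall x, A x -> \det (M x) != 0) -> closed_mx (fun x => detinv (M x)).
Proof.
move=> PM d0 i j; have := Pm (Pi (closed_det PM) d0) (closed_adj PM i j).
by congr P; apply/funext => x; rewrite /detinv [RHS]mxE.
Qed.

End FieldClosure.

Section Detinv.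
Set Implicit Arguments.
Unset Strict Implicit.
Variables (K : fieldType) (n : nat).
Implicit Type M : 'M[K]_n.

Lemma detinvE M : \det M != 0 -> detinv M = invmx M.
Proof. by move=> d0; rewrite /detinv /invmx unitmxE unitfE d0. Qed.

Lemma mulmxdV M : \det M != 0 -> M *m detinv M = 1%:M.
Proof. by move=> d0; rewrite detinvE // mulmxV // unitmxE unitfE. Qed.

Lemma muldVmx M : \det M != 0 -> detinv M *m M = 1%:M.
Proof. by move=> d0; rewrite detinvE // mulVmx // unitmxE unitfE. Qed.

End Detinv.

(** * Local inversion *)

(** [banach_fixed_point], applied below to row vectors, asks for a complete normed module. *)
HB.instance Definition _ (R : realType) n := Complete.on 'rV[R]_n.

Section InverseFunction.
Set Implicit Arguments.
Unset Strict Implicit.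
Variable R : realType.

Lemma rV_norm_le n (v : 'rV[R]_n) (c : R) : 0 <= c ->
  (forall j, `|v 0 j| <= c) -> `|v| <= c.
Proof.
move=> c0 vc; rewrite /Num.norm /= mx_normrE; apply: bigmax_le => //= -[i j] _.
by rewrite /= ord1.
Qed.

Lemma rV_norm_ge n (v : 'rV[R]_n) j : `|v 0 j| <= `|v|.
Proof.
rewrite [leRHS]/Num.norm /= mx_normrE.
exact: (le_bigmax _ (fun ij : 'I_1 * 'I_n => `|v ij.1 ij.2|) (0, j)).
Qed.

Lemma near_neq0 (T : topologicalType) (f : T -> R) (x : T) :
  {for x, continuous f} -> f x != 0 -> \forall y \near x, f y != 0.
Proof.
move=> cf f0; apply: (cf [set t | t != 0]).
apply/nbhs_ballP; exists `|f x| => /=; first by rewrite normr_gt0.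
move=> t; rewrite /ball /= => ht; apply: contraTneq ht => ->.
by rewrite subr0 ltxx.
Qed.

Lemma mulmxr_lipschitz n m (M : 'M[R]_(n, m)) :
  exists2 C : R, 0 < C & forall v : 'rV_n, `|v *m M| <= C * `|v|.
Proof.
(* The added 1 keeps the constant positive even for [M = 0], so that it can be divided by. *)
pose C := 1 + \sum_j \sum_i `|M i j|; exists C.
  by rewrite ltr_wpDr // sumr_ge0 // => j _; rewrite sumr_ge0.
move=> v; apply: rV_norm_le => [|j].
  rewrite mulr_ge0 // addr_ge0 // sumr_ge0 // => j _.
  by rewrite sumr_ge0.
rewrite mxE; apply: le_trans (ler_norm_sum _ _ _) _.
apply: (@le_trans _ _ (\sum_i `|M i j| * `|v|)).
  apply: ler_sum => i _; rewrite normrM mulrC ler_wpM2l //.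
  exact: rV_norm_ge.
rewrite -mulr_suml ler_wpM2r // /C (bigD1 j) //= addrCA lerDl addr_ge0 //.
by apply: sumr_ge0 => k _; rewrite sumr_ge0.
Qed.

Lemma mulmxr_continuous n m (M : 'M[R]_(n, m)) : continuous (mulmxr M : 'rV_n -> 'rV_m).
Proof.
have [C C0 hC] := mulmxr_lipschitz M.
apply: bounded_linear_continuous; apply/linear_boundedP.
exists C; split; first exact: gtr0_real.
by move=> x /ltW xC v; apply: le_trans (hC v) _; rewrite ler_wpM2r.
Qed.

Lemma coord_linear_continuous m n (i : 'I_m) (j : 'I_n) :
  exists2 l : {linear 'M[R]_(m, n) -> R}, continuous l &
    forall M, l M = M i j.
Proof.
have lin : linear (fun M : 'M[R]_(m, n) => M i j : R) by move=> a u v; rewrite !mxE.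
pose lM := GRing.isLinear.Build _ _ _ _ _ lin.
pose l : {linear _ -> _} := HB.pack (fun M : 'M[R]_(m, n) => M i j : R) lM.
by exists l => //; exact: coord_continuous.
Qed.

Lemma rational_coord m n (A : set 'M[R]_(m, n)) i j :
  rational_on A (fun M => M i j).
Proof.
have [l cl lE] := coord_linear_continuous i j.
by have := rational_lin A cl; congr rational_on; apply/funext => M; rewrite lE.
Qed.

Lemma rational_map_continuous (E : normedModType R) n (A : set E)
    (g : E -> 'rV[R]_n) (x : E) : A x -> 
  (forall j, rational_on A (fun x => g x 0 j)) -> {for x, continuous g}.
Proof.
move=> Ax rg; apply/cvg_ballP => e e0; near=> y.
have gy : forall k, ball (g x 0 k) e (g y 0 k).
  near: y; apply: filter_forall => k.
  by have := rational_continuous Ax (rg k); move/cvg_ballP; exact.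
by split=> // i j; rewrite ord1.
Unshelve. all: by end_near. Qed.

Lemma diff_rV n (f : 'rV[R]_n -> R) x v : differentiable f x ->
  'd f x v = \sum_i v 0 i * 'D_(delta_mx 0 i) f x.
Proof.
move=> df; rewrite [in LHS](row_sum_delta v) linear_sum /=.
by apply: eq_bigr => i _; rewrite linearZ /= deriveE.
Qed.

Section LocalInverse.
Variables (d : nat) (A : set 'rV[R]_d) (g : 'rV[R]_d -> 'rV[R]_d).
Variable x0 : 'rV[R]_d.
Hypotheses (oA : open A) (Ax0 : A x0).
Hypothesis rg : forall j, rational_on A (fun x => g x 0 j).
Hypothesis dg0 : forall j, sdiff (fun x => g x 0 j) x0 (fun v => v 0 j).

Lemma near_identity : exists2 r : R, 0 < r &
  forall x y, `|x - x0| <= r -> `|y - x0| <= r ->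
    `|g x - g y - (x - y)| <= 2^-1 * `|x - y|.
Proof.
have : \forall z \near (x0, x0), `|g z.1 - g z.2 - (z.1 - z.2)| <= 2^-1 * `|z.1 - z.2|.
  have h j := (dg0 j).2 2^-1 ltac:(by rewrite invr_gt0).
  near=> z.
  apply: rV_norm_le => [|j]; first by rewrite mulr_ge0.
  rewrite !mxE.
  have : forall j : 'I_d, `|g z.1 0 j - g z.2 0 j - (z.1 - z.2) 0 j| <= 2^-1 * `|z.1 - z.2|.
    by near: z; apply: filter_forall.
  by move/(_ j); rewrite !mxE.
move=> /nbhs_ballP[e /= e0 he]; exists (e / 2); first by rewrite divr_gt0.
move=> x y xr yr; apply: (he (x, y)).
have e2 : e / 2 < e by rewrite ltr_pdivrMr // ltr_pMr // ltr1n.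
by split; rewrite -ball_normE /ball_ /= distrC; apply: le_lt_trans e2.
Unshelve. all: by end_near. Qed.

Definition jac (x : 'rV[R]_d) : 'M[R]_d :=
  \matrix_(i, j) 'D_(delta_mx 0 i) (fun x => g x 0 j) x.

Lemma rational_jac : exists2 J : 'rV[R]_d -> 'M[R]_d,
  forall i j, rational_on A (fun x => J x i j) & forall x, A x -> jac x = J x.
Proof.
have h i j := (rational_derive (rg j)).2 (delta_mx 0 i).
pose J (x : 'rV[R]_d) := \matrix_(i, j) s2val (cid2 (h i j)) x.
exists J => [i j|x Ax].
  have := s2valP (cid2 (h i j)); congr rational_on.
  by apply/funext => x; rewrite mxE.
by apply/matrixP => i j; rewrite !mxE; exact: (s2valP' (cid2 (h i j))).
Qed.

Lemma jac0 : jac x0 = 1%:M.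
Proof.
apply/matrixP => i j; rewrite !mxE; have [[df dE] _] := dg0 j.
by rewrite (deriveE _ df) dE mxE eqxx /= eq_sym.
Qed.

(** Solving [g x = y] means finding a fixed point of [x - g x + y], a contraction of ratio 1/2 on
    the closed ball because [g] is close to the identity there. It sends the closed ball into the
    open one, whence the strict inequality. *)
Lemma local_surjectivity (r : R) (y : 'rV[R]_d) : 0 < r ->
  (forall x y, `|x - x0| <= r -> `|y - x0| <= r ->
    `|g x - g y - (x - y)| <= 2^-1 * `|x - y|) ->
  `|y - g x0| < r / 2 -> exists2 x, `|x - x0| < r & g x = y.
Proof.
move=> r0 hr hy; pose U : set 'rV[R]_d := closed_ball_ Num.norm x0 r.
have UE x : U x <-> `|x - x0| <= r by rewrite /U /closed_ball_ /= distrC.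
pose T x := x - g x + y.
have T0 x : `|x - x0| <= r -> `|T x - x0| < r.
  move=> xr; rewrite [ltRHS]splitr.
  have -> : T x - x0 = - (g x - g x0 - (x - x0)) + (y - g x0).
    rewrite /T; move: (g x) (g x0) => a b.
    by rewrite !opprD !opprK !addrA; apply/rowP => i; rewrite !mxE; ring.
  apply: le_lt_trans (ler_normD _ _) _; apply: ler_ltD => //.
  rewrite normrN; apply: le_trans (hr _ _ xr _) _.
    by rewrite subrr normr0 ltW.
  by rewrite mulrC ler_wpM2r.
have TU : set_fun U U T.
  by move=> x /UE xr; apply/UE; exact/ltW/T0.
have half1 : 0 <= 2^-1 :> R by [].
have ctr : is_contraction (mkfun_fun TU).
  exists (NngNum half1); split=> /=; first by rewrite invf_lt1 // ltr1n.
  move=> [x z] [/= /UE xr /UE zr]; have := hr _ _ xr zr.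
  rewrite -normrN; congr (`|_| <= _).
  rewrite /mkfun /T; move: (g x) (g z) => a b.
  by apply/rowP => i; rewrite !mxE; ring.
have [|p /UE pr] := banach_fixed_point ctr (@closed_closed_ball_ R 'rV[R]_d x0 r).
  by exists x0; apply/UE; rewrite subrr normr0 ltW.
rewrite /= /mkfun => pE; exists p; first by rewrite [X in X - x0]pE; exact: T0.
move: pE; rewrite /T; move: (g p) => a /rowP pE.
by apply/rowP => i; have := pE i; rewrite !mxE; lra.
Qed.

Lemma is_diff_jac x : A x -> is_diff x g (mulmxr (jac x)).
Proof.
move=> Ax; apply/is_diffP; first exact: mulmxr_continuous.
move=> e e0; near=> y.
have h : forall j : 'I_d, `|g y 0 j - g x 0 j - 'd (fun z => g z 0 j) x (y - x)| <=
    e * `|y - x|.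
  near: y; apply: filter_forall => j.
  have dgj := (rational_derive (rg j)).1 x Ax.
  have cdj := diff_continuous dgj.
  exact: ((is_diffP _ _ cdj).1 (differentiableP dgj) e e0).
apply: rV_norm_le => [|j]; first by rewrite mulr_ge0 // ltW.
apply: le_trans (h j); rewrite le_eqVlt; apply/orP; left; apply/eqP; congr `|_|.
have dgj := (rational_derive (rg j)).1 x Ax.
rewrite (diff_rV _ dgj) !mxE; congr (_ - _).
by apply: eq_bigr => i _; rewrite !mxE.
Unshelve. all: by end_near. Qed.

(** Regularity of [psi] is stated for its composites with all rational [rho] so that induction on
    [k] applies: the derivative of [rho \o psi] is [rho' \o psi], where [rho'] is again rational
    because the inverse Jacobian is. *)
Theorem local_inverse : exists (V W : set 'rV[R]_d) (psi : 'rV[R]_d -> 'rV[R]_d),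
  [/\ open V, V x0, V `<=` A & open W] /\
  [/\ forall x, V x -> W (g x) /\ psi (g x) = x,
      forall y, W y -> V (psi y) /\ g (psi y) = y &
      forall k rho, rational_on V rho -> Ck_on k W (rho \o psi)].
Proof.
have [r1 r10 hr1] := near_identity.
have [J rJ JE] := rational_jac.
have rdet : rational_on A (fun x => \det (J x)).
  exact: (closed_det (@rational_cst _ _ A) (@rational_add _ _ A) (@rational_mul _ _ A) rJ).
have det0 : \det (J x0) != 0 by rewrite -JE // jac0 det1 oner_eq0.
have [r /andP[r0 rr1] hr] : exists2 r : R, 0 < r <= r1 &
    forall x, `|x - x0| <= r -> A x /\ \det (J x) != 0.
  have : \forall x \near x0, A x /\ \det (J x) != 0.
    apply: filterI; first exact: open_nbhs_nbhs.
    exact: near_neq0 (rational_continuous Ax0 rdet) det0.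
  move=> /nbhs_ballP[e /= e0 he]; exists (Num.min (e / 2) r1).
    by rewrite lt_min divr_gt0 //= r10 ge_min lexx orbT.
  move=> x; rewrite le_min => /andP[xe _]; apply: he.
  rewrite -ball_normE /ball_ /= distrC; apply: le_lt_trans xe _.
  by rewrite ltr_pdivrMr // ltr_pMr // ltr1n.
have {r10 rr1}hg x y : `|x - x0| <= r -> `|y - x0| <= r ->
    `|g x - g y - (x - y)| <= 2^-1 * `|x - y|.
  by move=> xr yr; apply: hr1; [apply: le_trans xr _|apply: le_trans yr _].
pose W : set 'rV[R]_d := ball (g x0) (r / 2).
have WE y : W y <-> `|y - g x0| < r / 2.
  by rewrite /W -ball_normE /ball_ /= distrC.
(* Intersecting with the preimage of [W] makes [g] a bijection from [V] onto [W]; the image of the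
   ball itself is only known to contain [W]. *)
pose V : set 'rV[R]_d := [set x | `|x - x0| < r /\ W (g x)].
(* [g] shrinks distances at most by a factor 2. This gives injectivity, and later the control of
   [psi] that makes it differentiable. *)
have lip x y : `|x - x0| <= r -> `|y - x0| <= r -> `|x - y| <= 2 * `|g x - g y|.
  move=> xr yr; have := hg _ _ xr yr; have := ler_normB (g x - g y) (g x - g y - (x - y)).
  by rewrite opprB addrC subrK; lra.
have inj x y : `|x - x0| <= r -> `|y - x0| <= r -> g x = g y -> x = y.
  move=> xr yr gxy; have := lip _ _ xr yr; rewrite gxy subrr normr0 mulr0.
  by rewrite normr_le0 subr_eq0 => /eqP.
have surj y : W y -> exists x, `|x - x0| < r /\ g x = y.
  by move=> /WE yr; have [x xr gx] := local_surjectivity r0 hg yr; exists x.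
pose psi y := xget x0 [set x | `|x - x0| < r /\ g x = y].
have psiP y : W y -> `|psi y - x0| < r /\ g (psi y) = y.
  by move=> /surj[x hx]; rewrite /psi; case: xgetP => [z _ //|/(_ x)].
have VA : V `<=` A by move=> x [xr _]; have [] := hr x (ltW xr).
have Vx0 : V x0.
  split; first by rewrite subrr normr0.
  by apply/WE; rewrite subrr normr0 divr_gt0.
have oV : open V.
  rewrite openE => x [xr Wgx].
  have Ax : A x by have [] := hr x (ltW xr).
  have xball : nbhs x (ball x0 r).
    by apply: open_nbhs_nbhs; split; [exact: ball_open|rewrite -ball_normE /ball_ /= distrC].
  have nW : nbhs (g x) W by apply: open_nbhs_nbhs; split=> //; exact: ball_open.
  have cg := rational_map_continuous Ax rg.
  apply: filterS2 xball (cg _ nW) => y.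
  by rewrite -ball_normE /ball_ /= distrC => yr Wy; split.
exists V, W, psi; split; first by split=> //; exact: ball_open.
have VW x : V x -> W (g x) /\ psi (g x) = x.
  move=> [xr Wx]; split=> //; have [pr pE] := psiP _ Wx.
  by apply: inj (ltW pr) (ltW xr) pE.
have WV y : W y -> V (psi y) /\ g (psi y) = y.
  by move=> Wy; have [pr pE] := psiP _ Wy; split=> //; split=> //; rewrite pE.
split=> // k rho.
have dpsi y : W y -> is_diff y psi (mulmxr (detinv (J (psi y)))).
  move=> Wy; have [Vp gp] := WV y Wy; set x := psi y in Vp gp *.
  have [xr _] := Vp; have [Ax dJ] := hr x (ltW xr).
  apply/is_diffP; first exact: mulmxr_continuous.
  move=> e e0; have [C C0 hC] := mulmxr_lipschitz (detinv (J x)).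
  (* [C] bounds the inverse Jacobian and 2 is the Lipschitz constant of [psi]; together they restore
     [e]. *)
  have e1 : 0 < e / C / 2 by rewrite !divr_gt0.
  have dgx := (is_diffP _ _ (@mulmxr_continuous _ _ (jac x))).1 (is_diff_jac Ax) _ e1.
  have [del /= del0 hdel] := (nbhs_ballP _ _).1 dgx.
  have nW : nbhs y W by apply: open_nbhs_nbhs; split=> //; exact: ball_open.
  have nb : nbhs y (ball y (del / 2)) by apply: nbhsx_ballx; rewrite divr_gt0.
  apply: filterS2 nW nb => z Wz; rewrite -ball_normE /ball_ /= => yz.
  have [[pr _] pE] := WV z Wz; set x' := psi z in pr pE *.
  have xx' : `|x' - x| <= 2 * `|z - y|.
    by rewrite -pE -gp; apply: lip; exact: ltW.
  have := hdel x'; rewrite -ball_normE /ball_ /= distrC => /(_ _).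
  rewrite distrC in yz.
  have xd : `|x' - x| < del.
    by apply: le_lt_trans xx' _; rewrite mulrC -ltr_pdivlMr.
  move=> /(_ xd); rewrite pE gp JE // => hz.
  have -> : x' - x - (z - y) *m detinv (J x) =
     - ((z - y - (x' - x) *m J x) *m detinv (J x)).
    by rewrite [in RHS]mulmxBl -[in RHS]mulmxA mulmxdV // mulmx1 opprB.
  rewrite normrN; apply: le_trans (hC _) _.
  apply: (@le_trans _ _ (C * (e / C / 2 * `|x' - x|))).
    by rewrite ler_wpM2l // ltW.
  have -> : e * `|z - y| = C * (e / C / 2 * (2 * `|z - y|)).
    by field; rewrite gt_eqF.
  by rewrite !ler_wpM2l // ?ltW.
have cpsi y : W y -> {for y, continuous psi}.
  by move=> /dpsi[dy _]; exact: differentiable_continuous.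
elim: k rho => [|k IH] rho rrho /=.
  move=> y Wy; have [Vp _] := WV y Wy.
  apply: continuous_comp; first exact: cpsi.
  exact: rational_continuous Vp rrho.
have [drho Drho] := rational_derive rrho.
split=> [y Wy|v].
  have [dy _] := dpsi y Wy; have [Vp _] := WV y Wy.
  by apply: differentiable_comp => //; exact: drho.
have rV := fun i => s2valP (cid2 (Drho (delta_mx 0 i))).
have rVE := fun i => s2valP' (cid2 (Drho (delta_mx 0 i))).
(* The chain rule for row vectors: [v] is moved by the inverse Jacobian on the right and paired with
   the gradient of [rho]. *)
pose rho' x := \sum_i (v *m detinv (J x)) 0 i * s2val (cid2 (Drho (delta_mx 0 i))) x.
have rrho' : rational_on V rho'.
  apply: rational_sum => i _; apply: rational_mul; last exact: rV.
  have := @closed_mulmx _ _ (rational_on V) (@rational_cst _ _ V)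
    (@rational_add _ _ V) (@rational_mul _ _ V) _ _ _ (fun=> v) (fun x => detinv (J x)).
  apply; first by move=> a b; exact: rational_cst.
  apply: (closed_detinv (A := V) (@rational_cst _ _ V) (@rational_add _ _ V) (@rational_mul _ _ V)
    (@rational_inv _ _ V)).
    by move=> a b; apply: rational_sub VA (rJ a b).
  by move=> x [xr _]; have [] := hr x (ltW xr).
have oW : open W by exact: ball_open.
apply: (eq_Ck_on oW _ (IH rho' rrho')) => y Wy.
have [dy dyE] := dpsi y Wy; have [Vp _] := WV y Wy.
have drp := drho _ Vp.
have dcomp : differentiable (rho \o psi) y by exact: differentiable_comp.
rewrite (deriveE _ dcomp) (diff_comp dy drp) /= dyE /= (diff_rV _ drp).
by apply: eq_bigr => i _; rewrite rVE.
Qed.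

End LocalInverse.
End InverseFunction.

(** * Charts of embedded submanifolds *)

Section Charts.
Set Implicit Arguments.
Unset Strict Implicit.
Variable R : realType.

(** This is the body of [submanifold] at one point, isolated because each point of an orbit gets its
    chart from its own frame. *)
Definition chart_at (E : normedModType R) (d : nat) (M : set E) (x : E) : Prop :=
  exists (Om : set E) (V : set 'rV[R]_d) (phi : 'rV[R]_d -> E) (psi : E -> 'rV[R]_d),
    [/\ open Om, Om x & open V] /\
    [/\ smooth_on V phi, smooth_on Om psi,
        phi @` V = M `&` Om & forall v, V v -> psi (phi v) = v].

Lemma Ck_on_comp_linear (E F G : normedModType R) k (W : set F) (f : F -> G)
    (l : {linear E -> F}) : continuous l -> open W ->
  Ck_on k W f -> Ck_on k (l @^-1` W) (f \o l).
Proof.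
move=> cl oW; have olW : open (l @^-1` W) by apply: open_comp => // x _; exact: cl.
elim: k f => [|k IH] f /=.
  by move=> cf x Wx; apply: continuous_comp; [exact: cl|exact: cf].
move=> [df Df]; have dl x : differentiable l x by exact: linear_differentiable.
have dfl x : (l @^-1` W) x -> differentiable (f \o l) x.
  by move=> Wx; apply: differentiable_comp; [exact: dl|exact: df].
split=> // v; apply: (eq_Ck_on olW _ (IH _ (Df (l v)))) => x Wx.
rewrite /= (deriveE _ (df _ Wx)) (deriveE _ (dfl x Wx)).
by rewrite (diff_comp (dl x) (df _ Wx)) /= (diff_lin x cl).
Qed.

Section TangentBound.
Variable E : normedModType R.
Implicit Types (M : set E) (x : E).

(* Finitely many equations, valid on M near x, whose linearizations at x
   imply Q. *)
Definition tangent_bound M x (Q : E -> Prop) : Prop :=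
  exists (I : finType) (f l : I -> E -> R),
  [/\ forall i, sdiff (f i) x (l i),
      \forall y \near x, M y -> forall i, f i y = 0 &
      forall z, (forall i, l i z = 0) -> Q z].

Lemma tangent_bound_and M x Q1 Q2 : tangent_bound M x Q1 -> tangent_bound M x Q2 ->
  tangent_bound M x (fun z => Q1 z /\ Q2 z).
Proof.
move=> [I1 [f1 [l1 [h1 n1 q1]]]] [I2 [f2 [l2 [h2 n2 q2]]]].
exists (I1 + I2)%type,
  (fun i => match i with inl i => f1 i | inr i => f2 i end),
  (fun i => match i with inl i => l1 i | inr i => l2 i end).
split=> [[i|i]|| z lz] //.
  by apply: filterS2 n1 n2 => y y1 y2 My [i|i]; [exact: y1|exact: y2].
by split; [apply: q1 => i; exact: (lz (inl i))|apply: q2 => i; exact: (lz (inr i))].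
Qed.

Lemma tangent_bound_sub M x (Q1 Q2 : E -> Prop) : (forall z, Q1 z -> Q2 z) ->
  tangent_bound M x Q1 -> tangent_bound M x Q2.
Proof. by move=> Q12 [I [f [l [h n q]]]]; exists I, f, l; split=> // z /q /Q12. Qed.

End TangentBound.

Section OrbitChart.
Variables (m n : nat).
Notation E := ('M[R]_(m, n) * 'M[R]_(m, n))%type.

(** A linear left inverse, expanded on the finite basis of row vectors, is bounded. *)
Lemma linear_injective_bound k (T : {linear E -> 'rV[R]_k}) :
  (forall z, T z = 0 -> z = 0) ->
  exists2 C : R, 0 < C & forall z : E, `|z| <= C * `|T z|.
Proof.
move=> injT; pose S := ((linfun T)^-1)%VF.
have ST z : S (T z) = z.
  have k0 : lker (linfun T) == 0%VS.
    by apply/lker0P => a b; rewrite !lfunE /= => ab; apply/subr0_eq/injT; rewrite linearB /= ab subrr.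
  by have := lker0_lfunK k0 z; rewrite lfunE.
exists (1 + \sum_i `|S (delta_mx 0 i)|); first by rewrite ltr_pwDl // sumr_ge0.
move=> z; rewrite -{1}[z]ST [in S _](row_sum_delta (T z)) linear_sum /=.
apply: le_trans (ler_norm_sum _ _ _) _.
apply: (@le_trans _ _ (\sum_i `|S (delta_mx 0 i)| * `|T z|)).
  apply: ler_sum => i _; rewrite linearZ /= normrZ mulrC ler_wpM2l //.
  exact: rV_norm_ge.
by rewrite -mulr_suml ler_wpM2r // lerDr.
Qed.

Variables (d : nat) (M : set E) (x0 : E).

(** Joining [p] to the linearized equations gives an injective linear map [T], bounded below by
    [C^-1]. On the difference of two points of [M] with equal [p], strict differentiability bounds
    [T] by half of that, so the difference is zero. *)
Lemma tangent_bound_separation (p : {linear E -> 'rV[R]_d}) (Q : E -> Prop) :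
  tangent_bound M x0 Q -> (forall z, Q z -> p z = 0 -> z = 0) ->
  \forall z \near (x0, x0), M z.1 -> M z.2 -> p z.1 = p z.2 -> z.1 = z.2.
Proof.
move=> [I [f [l [hl nM hQ]]]] Qp.
have lin i : linear (l i) by have [[_ <-] _] := hl i; exact: linearP.
have linT : linear (fun z => row_mx (p z) (\row_(j < #|I|) l (enum_val j) z)).
  move=> a u v /=; have -> : p (a *: u + v) = a *: p u + p v by exact: linearP.
  rewrite (_ : \row__ _ = a *: (\row_(j < #|I|) l (enum_val j) u)
    + \row_(j < #|I|) l (enum_val j) v) ?scale_row_mx ?add_row_mx //.
  by apply/rowP => j; rewrite !mxE lin.
pose lM := GRing.isLinear.Build _ _ _ _ _ linT.
pose T : {linear E -> 'rV[R]_(d + #|I|)} :=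
  HB.pack (fun z : E => row_mx (p z) (\row_(j < #|I|) l (enum_val j) z)) lM.
have TE z : T z = row_mx (p z) (\row_(j < #|I|) l (enum_val j) z) by [].
have [C C0 hC] : exists2 C : R, 0 < C & forall z : E, `|z| <= C * `|T z|.
  apply: linear_injective_bound => z; rewrite TE -[0](@row_mx0 R 1 d #|I|).
  move=> /eq_row_mx[pz lz]; apply: Qp pz; apply: hQ => i.
  by move/rowP/(_ (enum_rank i)): lz; rewrite !mxE enum_rankK.
have e0 : 0 < C^-1 / 2 by rewrite divr_gt0 // invr_gt0.
have sl : \forall z \near (x0, x0), forall i : I,
    `|f i z.1 - f i z.2 - l i (z.1 - z.2)| <= C^-1 / 2 * `|z.1 - z.2|.
  have h i : \forall z \near (x0, x0),
      `|f i z.1 - f i z.2 - l i (z.1 - z.2)| <= C^-1 / 2 * `|z.1 - z.2|.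
    by have [_ h] := hl i; exact: h.
  exact: filter_forall h.
have nM2 : \forall z \near (x0, x0), (M z.1 -> forall i, f i z.1 = 0) /\
    (M z.2 -> forall i, f i z.2 = 0).
  by exists ([set y | M y -> forall i, f i y = 0], [set y | M y -> forall i, f i y = 0]) => // z [].
apply: filterS2 sl nM2 => z hz [f1 f2] M1 M2 pz.
apply/eqP; rewrite -subr_eq0 -normr_le0.
have : `|T (z.1 - z.2)| <= C^-1 / 2 * `|z.1 - z.2|.
  apply: rV_norm_le => [|j]; first by rewrite mulr_ge0 // ltW.
  rewrite TE mxE; case: splitP => k _; last first.
    by rewrite mxE; have := hz (enum_val k); rewrite f1 // f2 // subrr sub0r normrN.
  by rewrite linearB /= pz subrr mxE normr0 mulr_ge0 // ltW.
move=> hT; have := le_trans (hC _) (ler_wpM2l (ltW C0) hT).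
have -> : C * (C^-1 / 2 * `|z.1 - z.2|) = `|z.1 - z.2| / 2.
  by field; rewrite gt_eqF.
lra.
Qed.

(* With p left inverse to the differential of the parametrization phi, p \o phi is
   a local diffeomorphism, while tangent_bound makes p injective on M near x0, so
   that phi covers a neighbourhood of x0 in M. *)
Lemma orbit_chart (A : set 'rV[R]_d) (phi : 'rV[R]_d -> E) 
    (p : {linear E -> 'rV[R]_d}) (Q : E -> Prop) :
  open A -> A 0 -> phi 0 = x0 -> smooth_on A phi -> continuous p ->
  (forall v, A v -> M (phi v)) ->
  (forall j, rational_on A (fun v => p (phi v) 0 j)) ->
  (forall j, sdiff (fun v => p (phi v) 0 j) 0 (fun v => v 0 j)) ->
  tangent_bound M x0 Q -> (forall z, Q z -> p z = 0 -> z = 0) ->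
  chart_at d M x0.
Proof.
move=> oA A0 phi0 sphi cp Mphi rg dg tb Qp.
have [[B1 B2] /= [nB1 nB2] sepB] := tangent_bound_separation tb Qp.
have : nbhs x0 (B1 `&` B2) by exact: filterI.
rewrite nbhsE => -[B [oB Bx0] BB].
have cphi x : A x -> {for x, continuous phi} by exact: (sphi 0).
(* Shrinking to [A'] keeps the parametrization where [p] separates the points of [M]. *)
pose A' := A `&` phi @^-1` B.
have oA' : open A'.
  rewrite openE => x [Ax Bx]; apply: filterI; first exact: open_nbhs_nbhs.
  by apply: (cphi x Ax); apply: open_nbhs_nbhs.
have A'A : A' `<=` A by move=> x [].
have A'0 : A' 0 by split=> //; rewrite /= phi0.
have rg' j := rational_sub A'A (rg j).
have [V [W [psi [[oV V0 VA' oW] [VW WV Cpsi]]]]] :=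
  local_inverse oA' A'0 rg' dg.
have opW : open (p @^-1` W) by apply: open_comp => // x _; exact: cp.
have oOm : open (B `&` p @^-1` W) by exact: openI.
exists (B `&` p @^-1` W), V, phi, (psi \o p); split.
  by split=> //; split=> //=; rewrite -phi0; have [] := VW 0 V0.
split.
- move=> k; apply: (Ck_on_sub _ (sphi k)) => x /VA'; exact: A'A.
- move=> k; apply: (@Ck_on_sub R E _ (p @^-1` W)); first by move=> x [].
  apply: Ck_on_comp_linear => //; apply: Ck_on_mx => // i j.
  rewrite ord1; apply: (Cpsi k (fun x => x 0 j)).
  exact: rational_coord.
- rewrite eqEsubset; split=> [_ [v Vv <-]|x [Mx [Bx Wx]]].
    have [Av Bv] := VA' v Vv; split; first exact: Mphi.
    by split=> //=; have [] := VW v Vv.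
  have [Vv gv] := WV _ Wx; exists (psi (p x)) => //.
  have [Av Bv] := VA' _ Vv.
  apply: (sepB (_, x)) => //=; last exact: Mphi.
  by split; [exact: (BB _ Bv).1|exact: (BB _ Bx).2].
- by move=> v Vv /=; have [] := VW v Vv.
Qed.

End OrbitChart.
End Charts.

(* Abstract interface of R[i]: over R[i] itself, conversion keeps unfolding the
   arithmetic of pairs. *)
Record complexField (R : realType) := ComplexField {
  ccarrier :> numClosedFieldType;
  re : ccarrier -> R;
  im : ccarrier -> R;
  cmk : R -> R -> ccarrier;
  re_mk : forall a b, re (cmk a b) = a;
  im_mk : forall a b, im (cmk a b) = b;
  cmk_eta : forall z, cmk (re z) (im z) = z;
  reD : forall z w, re (z + w) = re z + re w;
  imD : forall z w, im (z + w) = im z + im w;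
  reN : forall z, re (- z) = - re z;
  imN : forall z, im (- z) = - im z;
  reM : forall z w, re (z * w) = re z * re w - im z * im w;
  imM : forall z w, im (z * w) = re z * im w + im z * re w;
  reV : forall z, re z^-1 = re z / (re z ^+ 2 + im z ^+ 2);
  imV : forall z, im z^-1 = - (im z / (re z ^+ 2 + im z ^+ 2));
  reC : forall z, re (Num.conj z) = re z;
  imC : forall z, im (Num.conj z) = - im z }.
Arguments re {R c} : rename.
Arguments im {R c} : rename.
Arguments cmk {R} c a b : rename.

(** * Complex-valued rational maps and their strict derivatives *)

Section ComplexRational.
Set Implicit Arguments.
Unset Strict Implicit.
Variables (R : realType) (Cf : complexField R).
Notation C := (ccarrier Cf).

Definition toC (a : R) : C := cmk Cf a 0.

Lemma eq_complexField (z w : C) : re z = re w -> im z = im w -> z = w.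
Proof. by move=> rzw izw; rewrite -[z]cmk_eta -[w]cmk_eta rzw izw. Qed.

Lemma re0 : re (0 : C) = 0.
Proof. by apply: (addrI (re (0 : C))); rewrite -reD !addr0. Qed.

Lemma im0 : im (0 : C) = 0.
Proof. by apply: (addrI (im (0 : C))); rewrite -imD !addr0. Qed.

Lemma toC1 : toC 1 = 1.
Proof.
by rewrite -[LHS]mulr1; apply: eq_complexField; rewrite ?reM ?imM re_mk im_mk; ring.
Qed.

Lemma toCM a b : toC a * toC b = toC (a * b).
Proof. by apply: eq_complexField; rewrite ?reM ?imM !(re_mk, im_mk); ring. Qed.

Lemma toC_N2 : toC (- 2) = - 2.
Proof.
have -> : - 2 = - (toC 1 + toC 1) by rewrite toC1.
by apply: eq_complexField; rewrite ?reN ?imN ?reD ?imD !(re_mk, im_mk); ring.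
Qed.

Section Domain.
Variable E : normedModType R.
Implicit Types (A : set E) (f g : E -> C) (x : E).

Definition crational A f :=
  rational_on A (fun x => re (f x)) /\ rational_on A (fun x => im (f x)).

Definition csdiff f x (l : E -> C) :=
  sdiff (fun x => re (f x)) x (fun v => re (l v)) /\
  sdiff (fun x => im (f x)) x (fun v => im (l v)).

Lemma crational_cst A (c : C) : crational A (fun=> c).
Proof. by split; exact: rational_cst. Qed.

Lemma crational_add A f g : crational A f -> crational A g ->
  crational A (fun x => f x + g x).
Proof.
move=> [f1 f2] [g1 g2]; split.
  by have := rational_add f1 g1; congr rational_on; apply/funext => x; rewrite reD.
by have := rational_add f2 g2; congr rational_on; apply/funext => x; rewrite imD.
Qed.

Lemma crational_mul A f g : crational A f -> crational A g ->
  crational A (fun x => f x * g x).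
Proof.
move=> [f1 f2] [g1 g2]; split.
  have := rational_add (rational_mul f1 g1) (rational_opp (rational_mul f2 g2)).
  by congr rational_on; apply/funext => x; rewrite reM.
have := rational_add (rational_mul f1 g2) (rational_mul f2 g1).
by congr rational_on; apply/funext => x; rewrite imM.
Qed.

Lemma crational_inv A f : crational A f -> (forall x, A x -> f x != 0) ->
  crational A (fun x => (f x)^-1).
Proof.
move=> [f1 f2] f0.
have rn := rational_add (rational_mul f1 f1) (rational_mul f2 f2).
have rN : rational_on A (fun x => (re (f x) * re (f x) +
    im (f x) * im (f x))^-1).
  apply: rational_inv => // x Ax; have := f0 x Ax.
  apply: contraNneq; rewrite -!expr2 => /eqP.
  rewrite paddr_eq0 ?sqr_ge0 // !sqrf_eq0 => /andP[/eqP rz /eqP iz].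
  by apply/eqP/eq_complexField; rewrite ?rz ?iz ?re0 ?im0.
split.
  have := rational_mul f1 rN; congr rational_on; apply/funext => x.
  by rewrite reV !expr2.
have := rational_opp (rational_mul f2 rN); congr rational_on; apply/funext => x.
by rewrite imV !expr2.
Qed.

Lemma crational_conj A f : crational A f -> crational A (fun x => Num.conj (f x)).
Proof.
move=> [f1 f2]; split.
  by move: f1; congr rational_on; apply/funext => x; rewrite reC.
by have := rational_opp f2; congr rational_on; apply/funext => x; rewrite imC.
Qed.

Lemma sdiff_ext (f g : E -> R) x l m : f =1 g -> l =1 m -> sdiff f x l -> sdiff g x m.
Proof. by move=> /funext -> /funext ->. Qed.

Lemma sdiff_opp (f : E -> R) x l : sdiff f x l -> sdiff (fun x => - f x) x (fun v => - l v).
Proof.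
move=> fl; have := sdiff_mul (sdiff_cst x (-1)) fl.
by apply: sdiff_ext => v; rewrite ?mulN1r // mulr0 addr0.
Qed.

Lemma csdiff_add f g x l m : csdiff f x l -> csdiff g x m ->
  csdiff (fun x => f x + g x) x (fun v => l v + m v).
Proof.
move=> [f1 f2] [g1 g2]; split.
  by apply: sdiff_ext (sdiff_add f1 g1) => v; rewrite reD.
by apply: sdiff_ext (sdiff_add f2 g2) => v; rewrite imD.
Qed.

Lemma csdiff_mul f g x l m : csdiff f x l -> csdiff g x m ->
  csdiff (fun x => f x * g x) x (fun v => f x * m v + l v * g x).
Proof.
move=> [f1 f2] [g1 g2]; split.
  apply: sdiff_ext (sdiff_add (sdiff_mul f1 g1) (sdiff_opp (sdiff_mul f2 g2))) => v.
    by rewrite reM.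
  by rewrite reD !reM; ring.
apply: sdiff_ext (sdiff_add (sdiff_mul f1 g2) (sdiff_mul f2 g1)) => v.
  by rewrite imM.
by rewrite imD !imM; ring.
Qed.

Lemma csdiff_cst x (c : C) : csdiff (fun=> c) x (fun=> 0).
Proof.
by split; [apply: sdiff_ext (sdiff_cst x (re c)) => v|
           apply: sdiff_ext (sdiff_cst x (im c)) => v]; rewrite ?re0 ?im0.
Qed.

Lemma csdiff_conj f x l : csdiff f x l ->
  csdiff (fun x => Num.conj (f x)) x (fun v => Num.conj (l v)).
Proof.
move=> [f1 f2]; split.
  by apply: sdiff_ext f1 => v; rewrite reC.
by apply: sdiff_ext (sdiff_opp f2) => v; rewrite imC.
Qed.

Lemma crational_csdiff A f x : A x -> crational A f -> exists l, csdiff f x l.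
Proof.
move=> Ax [f1 f2]; have [l1 h1] := rational_sdiff Ax f1.
by have [l2 h2] := rational_sdiff Ax f2; exists (fun v => cmk Cf (l1 v) (l2 v)); split;
  [apply: sdiff_ext h1 => v|apply: sdiff_ext h2 => v]; rewrite ?re_mk ?im_mk.
Qed.

End Domain.

Section ComplexMatrices.
Variable E : normedModType R.
Implicit Types (A : set E) (x : E).

Definition mxrational A m n (F : E -> 'M[C]_(m, n)) := closed_mx (crational A) F.

Definition mxsdiff m n (F : E -> 'M[C]_(m, n)) x (L : E -> 'M[C]_(m, n)) :=
  forall i j, csdiff (fun x => F x i j) x (fun v => L v i j).

Lemma mxrational_cst A m n (M : 'M[C]_(m, n)) : mxrational A (fun=> M).
Proof. by move=> i j; exact: crational_cst. Qed.

Lemma mxrational_add A m n (F G : E -> 'M[C]_(m, n)) :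
  mxrational A F -> mxrational A G -> mxrational A (fun x => F x + G x).
Proof. exact: (closed_addmx (P := crational A) (@crational_add _ A)). Qed.

Lemma mxrational_opp A m n (F : E -> 'M[C]_(m, n)) :
  mxrational A F -> mxrational A (fun x => - F x).
Proof. exact: closed_oppmx (@crational_cst _ A) (@crational_mul _ A) _ _ _. Qed.

Lemma mxrational_mul A m n p (F : E -> 'M[C]_(m, n)) (G : E -> 'M[C]_(n, p)) :
  mxrational A F -> mxrational A G -> mxrational A (fun x => F x *m G x).
Proof.
exact: closed_mulmx (@crational_cst _ A) (@crational_add _ A) (@crational_mul _ A) _ _ _ _ _.
Qed.

Lemma crational_det A n (F : E -> 'M[C]_n) : mxrational A F ->
  crational A (fun x => \det (F x)).
Proof.
exact: closed_det (@crational_cst _ A) (@crational_add _ A) (@crational_mul _ A) _ _.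
Qed.

Lemma mxrational_inv A n (F : E -> 'M[C]_n) : mxrational A F ->
  (forall x, A x -> \det (F x) != 0) -> mxrational A (fun x => detinv (F x)).
Proof.
exact: closed_detinv (@crational_cst _ A) (@crational_add _ A) (@crational_mul _ A)
  (@crational_inv _ A) _ _.
Qed.

Lemma mxrational_ctr A m n (F : E -> 'M[C]_(m, n)) : mxrational A F ->
  mxrational A (fun x => map_mx Num.conj (F x)^T).
Proof.
move=> rF i j; have := crational_conj (rF j i).
by congr crational; apply/funext => x; rewrite !mxE.
Qed.

Lemma mxsdiff_ext m n (F G : E -> 'M[C]_(m, n)) x L K :
  F =1 G -> L =1 K -> mxsdiff F x L -> mxsdiff G x K.
Proof. by move=> /funext -> /funext ->. Qed.

Lemma mxsdiff_cst m n (M : 'M[C]_(m, n)) x : mxsdiff (fun=> M) x (fun=> 0).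
Proof.
move=> i j; have := csdiff_cst x (M i j); congr csdiff.
by apply/funext => v; rewrite mxE.
Qed.

Lemma mxsdiff_add m n (F G : E -> 'M[C]_(m, n)) x L K :
  mxsdiff F x L -> mxsdiff G x K -> mxsdiff (fun x => F x + G x) x (fun v => L v + K v).
Proof.
move=> hF hG i j; have := csdiff_add (hF i j) (hG i j).
by congr csdiff; apply/funext => v; rewrite mxE.
Qed.

Lemma csdiff_sum (I : Type) (s : seq I) (f l : I -> E -> C) x :
  (forall i, csdiff (f i) x (l i)) ->
  csdiff (fun x => \sum_(i <- s) f i x) x (fun v => \sum_(i <- s) l i v).
Proof.
move=> h; elim: s => [|i s IH].
  by have := csdiff_cst x 0; congr csdiff; apply/funext => v; rewrite big_nil.
by have := csdiff_add (h i) IH; congr csdiff; apply/funext => v; rewrite big_cons.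
Qed.

Lemma mxsdiff_mul m n p (F : E -> 'M[C]_(m, n)) (G : E -> 'M[C]_(n, p)) x L K :
  mxsdiff F x L -> mxsdiff G x K ->
  mxsdiff (fun x => F x *m G x) x (fun v => F x *m K v + L v *m G x).
Proof.
move=> hF hG i j.
have := @csdiff_sum _ (index_enum 'I_n) _ _ x (fun k => csdiff_mul (hF i k) (hG k j)).
congr csdiff; apply/funext => v; first by rewrite mxE.
by rewrite !mxE -big_split.
Qed.

Lemma mxsdiff_ctr m n (F : E -> 'M[C]_(m, n)) x L : mxsdiff F x L ->
  mxsdiff (fun x => map_mx Num.conj (F x)^T) x (fun v => map_mx Num.conj (L v)^T).
Proof.
move=> hF i j; have := csdiff_conj (hF j i).
by congr csdiff; apply/funext => v; rewrite !mxE.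
Qed.

Lemma mxrational_sdiff A m n (F : E -> 'M[C]_(m, n)) x : A x -> mxrational A F ->
  exists L, mxsdiff F x L.
Proof.
move=> Ax rF; have h i j := crational_csdiff Ax (rF i j).
exists (fun v => \matrix_(i, j) sval (cid (h i j)) v) => i j.
have := svalP (cid (h i j)); congr csdiff.
by apply/funext => v; rewrite mxE.
Qed.

Lemma tangent_bound_mx (M : set E) m n (F : E -> 'M[C]_(m, n)) x L :
  mxsdiff F x L -> (\forall y \near x, M y -> F y = 0) ->
  tangent_bound M x (fun z => L z = 0).
Proof.
move=> hF F0; exists ('I_m * 'I_n * bool)%type,
  (fun k x => if k.2 then re (F x k.1.1 k.1.2) else im (F x k.1.1 k.1.2)),
  (fun k v => if k.2 then re (L v k.1.1 k.1.2) else im (L v k.1.1 k.1.2)).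
split=> [[[i j] []] /=||z lz]; [exact: (hF i j).1|exact: (hF i j).2| |].
  by apply: filterS F0 => y Fy /Fy -> [[i j] []] /=; rewrite mxE ?re0 ?im0.
apply/matrixP => i j; rewrite [RHS]mxE.
have := lz ((i, j), true); have := lz ((i, j), false).
by move=> /= iz rz; apply: eq_complexField; rewrite ?re0 ?im0.
Qed.

End ComplexMatrices.

Section Cplx.
Variables (m n : nat).
Notation E := ('M[R]_(m, n) * 'M[R]_(m, n))%type.

(** [rcplx] is the map underlying [realify] and [cplx] its inverse, so that [realify A] becomes a
    preimage under [cplx]. *)
Definition cplx (z : E) : 'M[C]_(m, n) := \matrix_(i, j) cmk Cf (z.1 i j) (z.2 i j).
Definition rcplx (Z : 'M[C]_(m, n)) : E :=
  (map_mx (@re R Cf) Z, map_mx (@im R Cf) Z).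

Lemma cplxK : cancel cplx rcplx.
Proof. by case=> a b; congr pair; apply/matrixP => i j; rewrite !mxE ?re_mk ?im_mk. Qed.

Lemma rcplxK : cancel rcplx cplx.
Proof. by move=> Z; apply/matrixP => i j; rewrite !mxE cmk_eta. Qed.

Lemma fst_coord_linear i j : exists2 l : {linear E -> R}, continuous l & forall z, l z = z.1 i j.
Proof.
have lin : linear (fun z : E => z.1 i j : R) by move=> a u v; rewrite !mxE.
pose lM := GRing.isLinear.Build _ _ _ _ _ lin.
pose l : {linear _ -> _} := HB.pack (fun z : E => z.1 i j : R) lM.
exists l => // z; apply: (@continuous_comp _ _ _ fst (fun M : 'M[R]_(m, n) => M i j)).
  exact: cvg_fst.
exact: coord_continuous.
Qed.

Lemma snd_coord_linear i j : exists2 l : {linear E -> R}, continuous l & forall z, l z = z.2 i j.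
Proof.
have lin : linear (fun z : E => z.2 i j : R) by move=> a u v; rewrite !mxE.
pose lM := GRing.isLinear.Build _ _ _ _ _ lin.
pose l : {linear _ -> _} := HB.pack (fun z : E => z.2 i j : R) lM.
exists l => // z; apply: (@continuous_comp _ _ _ snd (fun M : 'M[R]_(m, n) => M i j)).
  exact: cvg_snd.
exact: coord_continuous.
Qed.

Lemma mxrational_cplx (A : set E) : mxrational A cplx.
Proof.
move=> i j; have [l cl lE] := fst_coord_linear i j; have [k ck kE] := snd_coord_linear i j.
split; [have := rational_lin A cl|have := rational_lin A ck]; congr rational_on;
  by apply/funext => z; rewrite mxE ?re_mk ?im_mk ?lE ?kE.
Qed.

Lemma mxsdiff_cplx z : mxsdiff cplx z cplx.
Proof.
move=> i j; have [l cl lE] := fst_coord_linear i j; have [k ck kE] := snd_coord_linear i j.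
split; [have := sdiff_lin z cl|have := sdiff_lin z ck]; apply: sdiff_ext => y;
  by rewrite mxE ?re_mk ?im_mk ?lE ?kE.
Qed.

Lemma mxrational_smooth (F : normedModType R) (A : set F) (f : F -> 'M[C]_(m, n)) :
  open A -> mxrational A f -> smooth_on A (fun x => rcplx (f x)).
Proof.
move=> oA rf k; apply: Ck_on_mx_pair => // i j; apply: rational_Ck => //.
  by have [+ _] := rf i j; congr rational_on; apply/funext => x /=; rewrite mxE.
by have [_ +] := rf i j; congr rational_on; apply/funext => x /=; rewrite mxE.
Qed.

End Cplx.

Notation E m n := ('M[R]_(m, n) * 'M[R]_(m, n))%type.

Lemma cplxP m n (a : R) (z w : E m n) : cplx (a *: z + w) = toC a *: cplx z + cplx w.
Proof.
by apply/matrixP => i j; rewrite !mxE; apply: eq_complexField;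
  rewrite ?reD ?imD ?reM ?imM ?re_mk ?im_mk; ring.
Qed.

Lemma cplx0 m n : cplx (0 : E m n) = 0.
Proof. by apply/matrixP => i j; apply: eq_complexField; rewrite !mxE ?re_mk ?im_mk ?re0 ?im0. Qed.

Lemma cplxB m n (z w : E m n) : cplx (z - w) = cplx z - cplx w.
Proof.
apply/matrixP => i j; rewrite !mxE; apply: eq_complexField.
  by rewrite reD reN !re_mk.
by rewrite imD imN !im_mk.
Qed.

Lemma rcplxP m n (a : R) (Z W : 'M[C]_(m, n)) :
  rcplx (toC a *: Z + W) = a *: rcplx Z + rcplx W.
Proof. by apply: (can_inj (@cplxK m n)); rewrite cplxP !rcplxK. Qed.

Lemma conj_real (a : R) : Num.conj (toC a) = toC a :> C.
Proof. by apply: eq_complexField; rewrite ?reC ?imC ?re_mk ?im_mk ?oppr0. Qed.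

End ComplexRational.
Arguments toC {R Cf} a.
Arguments cplx {R Cf m n} z.
Arguments mxsdiff_cplx {R Cf m n} z.

(** * Hermitian linear algebra *)

Notation "A ^H" := (map_mx Num.conj A^T) (at level 2, format "A ^H") : ring_scope.

Section HermitianAlgebra.
Set Implicit Arguments.
Unset Strict Implicit.
Variable C : numClosedFieldType.

Lemma ctrK m n (A : 'M[C]_(m, n)) : A^H^H = A.
Proof. by apply/matrixP => i j; rewrite !mxE conjCK. Qed.

Lemma ctrM m n p (A : 'M[C]_(m, n)) (B : 'M[C]_(n, p)) : (A *m B)^H = B^H *m A^H.
Proof. by rewrite trmx_mul map_mxM. Qed.

Lemma ctrD m n (A B : 'M[C]_(m, n)) : (A + B)^H = A^H + B^H.
Proof. by rewrite linearD map_mxD. Qed.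

Lemma ctrN m n (A : 'M[C]_(m, n)) : (- A)^H = - A^H.
Proof. by rewrite linearN map_mxN. Qed.

Lemma ctrB m n (A B : 'M[C]_(m, n)) : (A - B)^H = A^H - B^H.
Proof. by rewrite ctrD ctrN. Qed.

Lemma ctr1 n : (1%:M : 'M[C]_n)^H = 1%:M.
Proof. by rewrite trmx1 map_mx1. Qed.

Lemma ctr0 m n : (0 : 'M[C]_(m, n))^H = 0.
Proof. by rewrite trmx0 map_mx0. Qed.

Lemma ctrZ m n (a : C) (A : 'M[C]_(m, n)) : (a *: A)^H = Num.conj a *: A^H.
Proof. by apply/matrixP => i j; rewrite !mxE rmorphM. Qed.

(** [pinvmx] is used only through [D J D = D]; sandwiching makes the inverse reflexive, [J D J = J],
    which the rank equation requires. *)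
Definition ginv m n (D : 'M[C]_(m, n)) := pinvmx D *m D *m pinvmx D.

Lemma mulmx_ginvK m n (D : 'M[C]_(m, n)) : D *m ginv D *m D = D.
Proof.
have h : D *m pinvmx D *m D = D by rewrite mulmxKpV.
by rewrite /ginv; move: (pinvmx D) h => J h; rewrite !mulmxA !h.
Qed.

Lemma ginv_mulmxK m n (D : 'M[C]_(m, n)) : ginv D *m D *m ginv D = ginv D.
Proof.
have h : D *m pinvmx D *m D = D by rewrite mulmxKpV.
rewrite /ginv; move: (pinvmx D) h => J h.
have h2 k (A : 'M[C]_(k, m)) : A *m D *m J *m D = A *m D.
  by rewrite -!mulmxA [D *m _]mulmxA h.
by rewrite !mulmxA !h2.
Qed.

(* Turns the condition \rank D' = \rank D, for D' near D, into an equation; its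
   linearization at D is (1 - D J) (D' - D) (1 - J D) = 0. *)
Lemma schur_complement_eq0 m n (D D' : 'M[C]_(m, n)) (J : 'M[C]_(n, m)) :
  D *m J *m D = D -> J *m D *m J = J -> \det (1%:M + J *m (D' - D)) != 0 ->
  \rank D' = \rank D ->
  D' *m (detinv (1%:M + J *m (D' - D)) *m (1%:M - J *m D)) = 0.
Proof.
move=> DJD JDJ d0 rk; set f := 1%:M - J *m D; set P := 1%:M + _ in d0 *.
set c := detinv P *m f.
have fJ : f *m J = 0 by rewrite mulmxBl mul1mx JDJ subrr.
have fP : f *m P = f by rewrite /P mulmxDr mulmx1 mulmxA fJ mul0mx addr0.
have fPV : f *m detinv P = f by rewrite -[in LHS]fP -mulmxA mulmxdV // mulmx1.
have JD' : J *m D' = P - f.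
  rewrite /P /f mulmxBr; move: (J *m D') (J *m D) => x y.
  by rewrite opprB addrC addrA subrK addrCA subrr addr0.
have JD'c : J *m D' *m c = 0.
  rewrite JD' mulmxBl /c mulmxA mulmxdV // mul1mx mulmxA fPV.
  by rewrite -[X in X - _]mulmx1 -mulmxBr opprB addrCA subrr addr0 mulmxA fJ mul0mx.
(* Up to the invertible [P], [J *m D'] is [J *m D], of the same rank as [D]. Hence [D'] factors
   through [J *m D'], and what the latter kills, such as [c], is killed by [D']. *)
have rkJ : (\rank D' <= \rank (J *m D'))%N.
  have <- : \rank (J *m D' *m detinv P) = \rank (J *m D').
    by rewrite mxrankMfree // row_free_unit detinvE // unitmx_inv unitmxE unitfE.
  rewrite JD' mulmxBl mulmxdV // fPV opprB addrCA subrr addr0 rk.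
  by rewrite -[in leqLHS]DJD -mulmxA mxrankM_maxr.
have /submxP[Y YE] : (D' <= J *m D')%MS.
  by rewrite -(geq_leqif (mxrank_leqif_sup (submxMl J D'))).
by rewrite YE -mulmxA JD'c mulmx0.
Qed.

(* Linear form of Witt's theorem: a partially defined skew-Hermitian operator
   extends to a skew-Hermitian one. *)
Lemma skew_extension m n (D T : 'M[C]_(m, n)) (Y : 'M[C]_m) :
  T = Y *m D -> D^H *m T + T^H *m D = 0 ->
  exists2 K : 'M[C]_m, K^H = - K & K *m D = T.
Proof.
move=> TE skew; have := mulmx_ginvK D; move: (ginv D) => J DJD.
(* [a] solves the equation on the columns of [D]. Skewness dictates the opposite block, so [a^H] is
   subtracted through the projector [1%:M - D *m J], which kills [D]. *)
have [a aE] : exists a, a = Y *m (D *m J) by eexists.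
exists (a - a^H *m (1%:M - D *m J)); last first.
  rewrite mulmxBl -mulmxA mulmxBl mul1mx DJD subrr mulmx0 subr0.
  by rewrite aE -mulmxA DJD -TE.
have key : a^H *m (D *m J) + (D *m J)^H *m a = 0.
  have -> : a = T *m J by rewrite TE aE !mulmxA.
  rewrite !ctrM.
  have -> : J^H *m T^H *m (D *m J) + J^H *m D^H *m (T *m J) =
     J^H *m (D^H *m T + T^H *m D) *m J.
    by rewrite mulmxDr mulmxDl !mulmxA addrC.
  by rewrite skew mulmx0 mul0mx.
rewrite ctrB ctrM ctrK ctrB ctr1 mulmxBl mul1mx mulmxBr mulmx1.
move: key; move: (a^H *m _) (_ *m a) => x y /eqP; rewrite addr_eq0 => /eqP ->.
move: (a^H) => z; apply/matrixP => i j; rewrite !mxE; ring.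
Qed.

End HermitianAlgebra.

(** * Orthogonal decompositions and the infinitesimal Witt theorem *)

Section Splitting.
Set Implicit Arguments.
Unset Strict Implicit.
Variables (C : numClosedFieldType) (n : nat) (G pU pW : 'M[C]_n).

(* G is the Gram matrix of a nondegenerate Hermitian form, pU and pW are the
   projections of an orthogonal decomposition. *)
Definition ortho_split := [/\ G^H = G, G \in unitmx, pU + pW = 1%:M,
  pU *m pU = pU & pU^H *m G *m pW = 0].

Hypothesis sp : ortho_split.

Let GH : G^H = G. Proof. by case: sp. Qed.
Let Gu : G \in unitmx. Proof. by case: sp. Qed.
Let pUW : pU + pW = 1%:M. Proof. by case: sp. Qed.
Let pUU : pU *m pU = pU. Proof. by case: sp. Qed.
Let UGW : pU^H *m G *m pW = 0. Proof. by case: sp. Qed.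

Let pWE : pW = 1%:M - pU. Proof. by rewrite -pUW addrAC subrr add0r. Qed.

Lemma split_UW0 : pU *m pW = 0.
Proof. by rewrite pWE mulmxBr mulmx1 pUU subrr. Qed.

Lemma split_WU0 : pW *m pU = 0.
Proof. by rewrite pWE mulmxBl mul1mx pUU subrr. Qed.

Lemma split_WW : pW *m pW = pW.
Proof. by rewrite {1}pWE mulmxBl mul1mx split_UW0 subr0. Qed.

(** The projection is self-adjoint for the form because both cross terms between U and W vanish. *)
Lemma split_GU : G *m pU = pU^H *m G.
Proof.
have WGU : pW^H *m G *m pU = 0.
  by have := congr1 (fun A : 'M[C]_n => A^H) UGW; rewrite !ctrM ctrK GH ctr0 mulmxA.
rewrite -[LHS]mul1mx -ctr1 -pUW ctrD mulmxDl !mulmxA WGU addr0.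
by rewrite -[RHS]mulmx1 -pUW mulmxDr UGW addr0.
Qed.

Lemma split_GW : G *m pW = pW^H *m G.
Proof. by rewrite pWE mulmxBr mulmx1 split_GU ctrB ctr1 mulmxBl mul1mx. Qed.

Lemma ortho_split_sym : [/\ G^H = G, G \in unitmx, pW + pU = 1%:M,
  pW *m pW = pW & pW^H *m G *m pU = 0].
Proof.
split=> //; [by rewrite addrC|exact: split_WW|].
by rewrite -split_GW -mulmxA split_WU0 mulmx0.
Qed.

Definition lieH (X : 'M[C]_n) := X *m pU = pU *m X /\ (G *m X)^H = - (G *m X).

Variable r : nat.
Variable M : 'M[C]_(n, r).

(** For a frame [M] of S, [fU] and [fW] are projectors onto the coordinates of S :&: W and S :&: U
    respectively, and [beta] is the form of pU S pulled back to coordinates. *)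
Variables (DU DW : 'M[C]_(n, r)) (JU JW : 'M[C]_(r, n)) (fU fW beta : 'M[C]_r).
Hypotheses (DUE : DU = pU *m M) (DWE : DW = pW *m M).
Hypotheses (DUJ : DU *m JU *m DU = DU) (DWJ : DW *m JW *m DW = DW).
Hypotheses (fUE : fU = 1%:M - JU *m DU) (fWE : fW = 1%:M - JW *m DW).
Hypothesis betaE : beta = M^H *m G *m pU *m M.

(** The vanishing on [fU] and [fW] makes the prescribed values factor through pU S and pW S.
    [skew_extension] is then applied on each side, and the two skew forms are glued into [K], with
    [X] equal to [invmx G *m K]. *)
Lemma lieH_extension (Z : 'M[C]_(n, r)) :
  pU *m Z *m fU = 0 -> pW *m Z *m fW = 0 ->
  M^H *m G *m pU *m Z + Z^H *m G *m pU *m M = 0 ->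
  M^H *m G *m pW *m Z + Z^H *m G *m pW *m M = 0 ->
  exists2 X, lieH X & X *m M = Z.
Proof.
have half (p : 'M[C]_n) D J (f : 'M[C]_r) (GpE : G *m p = p^H *m G)
    (pp : p *m p = p) : D = p *m M -> f = 1%:M - J *m D -> p *m Z *m f = 0 ->
    M^H *m G *m p *m Z + Z^H *m G *m p *m M = 0 ->
    exists2 K : 'M[C]_n, K^H = - K & K *m D = G *m p *m Z.
  move=> DE fE Zf skew; apply: (@skew_extension _ _ _ _ _ (G *m p *m Z *m J)).
    have : G *m (p *m Z *m f) = 0 by rewrite Zf mulmx0.
    by rewrite fE !mulmxBr mulmx1 !mulmxA => /eqP; rewrite subr_eq0 => /eqP.
  rewrite DE !ctrM GH; move: skew.
  have -> : M^H *m p^H *m (G *m p *m Z) = M^H *m G *m p *m Z.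
    by rewrite !mulmxA -(mulmxA M^H) -GpE !mulmxA -(mulmxA _ p p) pp.
  suff -> : Z^H *m (p^H *m G) *m (p *m M) = Z^H *m G *m p *m M by [].
  by rewrite -GpE !mulmxA -(mulmxA _ p p) pp.
move=> ZU ZW skU skW.
have [KU KUs KUE] := half pU _ _ _ split_GU pUU DUE fUE ZU skU.
have [KW KWs KWE] := half pW _ _ _ split_GW split_WW DWE fWE ZW skW.
pose K := pU^H *m KU *m pU + pW^H *m KW *m pW.
have KM : K *m M = G *m Z.
  rewrite mulmxDl -!mulmxA -DUE -DWE KUE KWE !mulmxA -split_GU -split_GW.
  rewrite -(mulmxA G pU pU) -(mulmxA G pW pW) pUU split_WW.
  by rewrite -!mulmxA -mulmxDr -mulmxDl pUW mul1mx.
exists (invmx G *m K); last by rewrite -mulmxA KM mulKmx.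
split; last first.
  rewrite mulKVmx // /K ctrD !ctrM !ctrK KUs KWs.
  by rewrite !mulNmx !mulmxN !mulmxA opprD.
have KU' : K *m pU = pU^H *m K.
  rewrite /K mulmxDl mulmxDr !mulmxA -!(mulmxA _ _ pU) pUU split_WU0 mulmx0 addr0.
  rewrite -!ctrM pUU split_WU0 ctr0 !mul0mx addr0 !mulmxA.
  by [].
rewrite -mulmxA KU'; apply: (canLR (mulKmx Gu)).
by rewrite !mulmxA split_GU -!mulmxA mulKVmx.
Qed.

Hypothesis Mfree : forall k (X : 'M[C]_(r, k)), M *m X = 0 -> X = 0.
Hypothesis Miso : M^H *m G *m M = 0.

Lemma betaH : beta^H = beta.
Proof. by rewrite betaE !ctrM ctrK GH !mulmxA -(mulmxA _ pU^H) -split_GU !mulmxA. Qed.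

(** Isotropy makes the forms induced by the two projections opposite, so [beta] controls both
    sides. *)
Lemma betaW : M^H *m G *m pW *m M = - beta.
Proof.
apply/eqP; rewrite -addr_eq0 betaE -mulmxDl -mulmxDr addrC pUW mulmx1.
by rewrite Miso.
Qed.

Lemma DUfU : DU *m fU = 0.
Proof. by rewrite fUE mulmxBr mulmx1 mulmxA DUJ subrr. Qed.

Lemma DWfW : DW *m fW = 0.
Proof. by rewrite fWE mulmxBr mulmx1 mulmxA DWJ subrr. Qed.

Lemma beta_fU : beta *m fU = 0.
Proof. by rewrite betaE -!mulmxA [pU *m _]mulmxA -DUE DUfU !mulmx0. Qed.

Lemma beta_fW : beta *m fW = 0.
Proof.
apply/eqP; rewrite -oppr_eq0 -mulNmx -betaW -!mulmxA [pW *m _]mulmxA.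
by rewrite -DWE DWfW !mulmx0.
Qed.

(** The images of [fU] and [fW] meet only in 0, since [M] is injective and a vector killed by both
    projections is 0. So one matrix can be prescribed independently on them; the criterion used is
    that relations between rows are read off a cokernel. *)
Lemma common_correction (A B : 'M[C]_r) :
  exists2 N : 'M[C]_r, N *m fU = A *m fU & N *m fW = B *m fW.
Proof.
have : (row_mx (A *m fU) (B *m fW) <= row_mx fU fW)%MS.
  rewrite submxE; set c := cokermx _.
  have := mulmx_coker (row_mx fU fW); rewrite -/c -[c]vsubmxK !mul_row_col.
  move: (usubmx c) (dsubmx c) => x y xy.
  have xE : fU *m x = 0.
    apply: Mfree; rewrite -[M]mul1mx -pUW mulmxDl -DUE -DWE mulmxDl.
    rewrite mulmxA DUfU mul0mx add0r.
    by move/eqP: xy; rewrite addr_eq0 => /eqP ->; rewrite mulmxN mulmxA DWfW mul0mx oppr0.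
  move: xy; rewrite xE add0r => yE.
  by rewrite -!mulmxA xE yE !mulmx0 addr0.
by move=> /submxP[N]; rewrite mul_mx_row => /eq_row_mx[]; exists N.
Qed.

Variable J : 'M[C]_r.
Hypotheses (JH : J^H = J) (bJb : beta *m J *m beta = beta).

(** A tangent vector of the Grassmannian is [Z] up to [M *m N]. This freedom is spent twice: [N1]
    makes [Z] compatible with the kernels of the projections, and [N2] cancels the Hermitian defect
    [gm] left on U. By isotropy the defect on W is the opposite one, so it disappears as well. *)
Lemma lieH_tangent (Z : 'M[C]_(n, r)) :
  M^H *m G *m Z + Z^H *m G *m M = 0 ->
  (1%:M - DU *m JU) *m (pU *m Z) *m fU = 0 ->
  (1%:M - DW *m JW) *m (pW *m Z) *m fW = 0 ->
  (1%:M - beta *m J) *m (M^H *m G *m pU *m Z + Z^H *m G *m pU *m M) *m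
     (1%:M - J *m beta) = 0 ->
  exists2 X, lieH X & exists N, X *m M = Z + M *m N.
Proof.
move=> Za Zb Zc Zd.
have [N1 N1U N1W] := common_correction (- JU *m (pU *m Z)) (- JW *m (pW *m Z)).
pose Z1 := Z + M *m N1.
have Z1U : pU *m Z1 *m fU = 0.
  rewrite mulmxDr mulmxA -DUE mulmxDl -mulmxA -(mulmxA DU) N1U.
  by move: Zb; rewrite mulmxBl mul1mx mulmxBl !mulNmx mulmxN !mulmxA.
have Z1W : pW *m Z1 *m fW = 0.
  rewrite mulmxDr mulmxA -DWE mulmxDl -mulmxA -(mulmxA DW) N1W.
  by move: Zc; rewrite mulmxBl mul1mx mulmxBl !mulNmx mulmxN !mulmxA.
pose gam (p : 'M[C]_n) (Y : 'M[C]_(n, r)) := M^H *m G *m p *m Y + Y^H *m G *m p *m M.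
have gamUD Y N : gam pU (Y + M *m N) = gam pU Y + (beta *m N + N^H *m beta).
  rewrite /gam mulmxDr ctrD ctrM !mulmxDl betaE !mulmxA.
  by rewrite addrACA.
have gamWD Y N : gam pW (Y + M *m N) = gam pW Y - (beta *m N + N^H *m beta).
  rewrite /gam mulmxDr ctrD ctrM !mulmxDl [X in _ + X + _]mulmxA betaW.
  have -> : N^H *m M^H *m G *m pW *m M = N^H *m (M^H *m G *m pW *m M) by rewrite !mulmxA.
  by rewrite betaW mulmxN mulNmx addrACA opprD.
have gamW Y : M^H *m G *m Y + Y^H *m G *m M = 0 -> gam pW Y = - gam pU Y.
  move=> h; apply/eqP; rewrite -addr_eq0 -h /gam addrACA -!mulmxDl -!mulmxDr.
  by rewrite [pW + pU]addrC pUW !mulmx1.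
have Z1a : M^H *m G *m Z1 + Z1^H *m G *m M = 0.
  have e1 : M^H *m G *m (M *m N1) = 0 by rewrite mulmxA Miso mul0mx.
  have e2 : N1^H *m M^H *m G *m M = 0.
    by rewrite -!mulmxA [M^H *m _]mulmxA Miso mulmx0.
  by rewrite /Z1 mulmxDr ctrD ctrM !mulmxDl e1 e2 !addr0.
set gm := gam pU Z1.
have gmH : gm^H = gm.
  rewrite /gm /gam ctrD !ctrM !ctrK GH !mulmxA addrC; congr (_ + _).
    by rewrite -(mulmxA _ pU^H) -split_GU !mulmxA.
  by rewrite -(mulmxA _ pU^H) -split_GU !mulmxA.
have gm_fU : gm *m fU = 0.
  rewrite mulmxDl -!mulmxA [pU *m (Z1 *m _)]mulmxA Z1U [pU *m (M *m _)]mulmxA -DUE.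
  by rewrite DUfU !mulmx0 addr0.
have gm_fW : gm *m fW = 0.
  apply/eqP; rewrite -oppr_eq0 -mulNmx -gamW // mulmxDl -!mulmxA.
  rewrite [pW *m (Z1 *m _)]mulmxA Z1W [pW *m (M *m _)]mulmxA -DWE.
  by rewrite DWfW !mulmx0 addr0.
pose pi := J *m beta.
have bpi : beta *m (1%:M - pi) = 0 by rewrite mulmxBr mulmx1 mulmxA bJb subrr.
have piH : pi^H = beta *m J by rewrite ctrM betaH JH.
have gm_pi : (1%:M - pi^H) *m gm *m (1%:M - pi) = 0.
  rewrite /gm gamUD mulmxDr mulmxDl piH Zd add0r mulmxDr mulmxDl.
  rewrite -!mulmxA [beta *m (N1 *m _)]mulmxA [N1^H *m _]mulmxA -[N1^H *m _ *m _]mulmxA bpi !mulmx0 addr0.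
  have -> : 1%:M - beta *m J = (1%:M - pi)^H by rewrite ctrB ctr1 piH.
  by rewrite -betaH !mulmxA -ctrM bpi ctr0 !mul0mx.
(* This solves [beta *m N + N^H *m beta = - gm]. By [gm_pi], [gm] has no corner on the complement of
   [pi]; the factor 1/2 prevents its [pi^H]-[pi] corner from being counted twice. *)
pose N2 := - (J *m gm *m (1%:M - 2^-1 *: pi)).
have N2_ker f : beta *m f = 0 -> gm *m f = 0 -> N2 *m f = 0.
  move=> bf gf; rewrite /N2 mulNmx -!mulmxA mulmxBl mul1mx -scalemxAl -mulmxA bf.
  by rewrite mulmx0 scaler0 subr0 gf mulmx0 oppr0.
have half2 : Num.conj (2^-1 : C) = 2^-1 by rewrite rmorphV ?unitfE ?pnatr_eq0 // rmorph_nat.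
have N2b : beta *m N2 + N2^H *m beta = - gm.
  have -> : N2^H *m beta = (beta *m N2)^H by rewrite ctrM betaH.
  have -> : beta *m N2 = - (pi^H *m gm *m (1%:M - 2^-1 *: pi)).
    by rewrite piH /N2 mulmxN !mulmxA.
  rewrite ctrN (ctrM _ (1%:M - _)) (ctrM pi^H) ctrK ctrB ctr1 ctrZ half2 gmH.
  have gmE : gm = gm *m pi + pi^H *m gm - pi^H *m gm *m pi.
    apply/eqP; rewrite -subr_eq0 -[X in _ == X]gm_pi !mulmxBl !mulmxBr !mul1mx !mulmx1.
    by apply/eqP/matrixP => x y; rewrite !mxE; ring.
  rewrite [in RHS]gmE !mulmxBr !mulmxBl !mulmx1 !mul1mx -!scalemxAl -!scalemxAr !mulmxA.
  by apply/matrixP => x y; rewrite !mxE; field.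
have Z2E : exists2 X, lieH X & X *m M = Z1 + M *m N2.
  apply: lieH_extension.
  - rewrite mulmxDr mulmxDl Z1U add0r -!mulmxA N2_ker ?mulmx0 //.
    exact: beta_fU.
  - rewrite mulmxDr mulmxDl Z1W add0r -!mulmxA N2_ker ?mulmx0 //.
    exact: beta_fW.
  - by rewrite -/(gam pU _) gamUD N2b -/gm subrr.
  - by rewrite -/(gam pW _) gamWD N2b gamW // -/gm opprK addrC subrr.
have [X hX XM] := Z2E; exists X => //; exists (N1 + N2).
by rewrite XM /Z1 mulmxDr addrA.
Qed.

End Splitting.

(** * Real dimensions *)

Section RealDimension.
Set Implicit Arguments.
Unset Strict Implicit.
Variables (R : realType) (Cf : complexField R).
Notation C := (ccarrier Cf).
Notation cplx := (@cplx R Cf _ _).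
Notation E m n := ('M[R]_(m, n) * 'M[R]_(m, n))%type.

(** A subspace of maximal dimension among those contained in [P] is all of [P]: otherwise a missing
    vector would enlarge it. *)
Lemma vspace_of_closed (T : vectType R) (P : T -> Prop) : P 0 ->
  (forall a x y, P x -> P y -> P (a *: x + y)) ->
  exists V : {vspace T}, forall x, x \in V <-> P x.
Proof.
move=> P0 PD; pose Q k := `[< exists V : {vspace T}, \dim V = k /\ forall x, x \in V -> P x >].
have exQ : exists k, Q k.
  exists 0%N; apply/asboolP; exists 0%VS; split; first exact: dimv0.
  by move=> x; rewrite memv0 => /eqP ->.
have ubQ k : Q k -> (k <= \dim {:T})%N.
  by move=> /asboolP[V [<- _]]; exact: dimvS (subvf V).
case: (ex_maxnP exQ ubQ) => k /asboolP[V [dV VP]] kmax.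
exists V => x; split=> [|Px]; first exact: VP.
have sV : (V <= V + <[x]>)%VS by exact: addvSl.
have : Q (\dim (V + <[x]>)).
  apply/asboolP; exists (V + <[x]>)%VS; split=> // y.
  move=> /memv_addP[v Vv [w /vlineP[a ->] ->]].
  by rewrite addrC; apply: PD => //; exact: VP.
move=> /kmax; rewrite -dV => dle.
have /eqP -> : V == (V + <[x]>)%VS.
  by rewrite eqEsubv sV /= -(geq_leqif (dimv_leqif_sup sV)).
by rewrite (subvP (addvSr _ _)) // memv_line.
Qed.

Definition rlinear m n p q (f : 'M[C]_(m, n) -> 'M[C]_(p, q)) :=
  forall (a : R) X Y, f (toC a *: X + Y) = toC a *: f X + f Y.

Definition rclosed m n (P : 'M[C]_(m, n) -> Prop) :=
  P 0 /\ forall (a : R) X Y, P X -> P Y -> P (toC a *: X + Y).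

(** The Lie algebras are real but not complex subspaces, given by propositions; hence a relation to
    a real [vspace] of pairs of matrices. *)
Definition rdim m n (P : 'M[C]_(m, n) -> Prop) d :=
  exists2 V : {vspace E m n}, forall z, z \in V <-> P (cplx z) & \dim V = d.

Lemma rlinear0 m n p q (f : 'M[C]_(m, n) -> 'M[C]_(p, q)) : rlinear f -> f 0 = 0.
Proof. 
move=> fl; have := fl 1 0 0; rewrite scaler0 addr0 toC1 scale1r => /eqP.
by rewrite addrC -subr_eq subrr => /eqP <-.
Qed.

Arguments rdim {m n} P d%_N.

Lemma rclosed_rdim m n (P : 'M[C]_(m, n) -> Prop) : rclosed P -> exists d, rdim P d.
Proof.
move=> [P0 PD]; have [||V VE] := @vspace_of_closed _ (fun z : E m n => P (cplx z)).
- by rewrite cplx0.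
- by move=> a x y Px Py; rewrite cplxP; exact: PD.
- by exists (\dim V), V.
Qed.

Lemma eq_rdim m n (P Q : 'M[C]_(m, n) -> Prop) d : (forall X, P X <-> Q X) ->
  rdim P d -> rdim Q d.
Proof. by move=> PQ [V VE dV]; exists V => // z; rewrite VE PQ. Qed.

Lemma rdim_unique m n (P : 'M[C]_(m, n) -> Prop) d e : rdim P d -> rdim P e -> d = e.
Proof.
move=> [V VE <-] [W WE <-]; congr (\dim _); apply/vspaceP => z.
by apply/idP/idP => [/VE h|/WE h]; [apply/WE|apply/VE].
Qed.

Lemma rdim_kernel_image m n p q (P : 'M[C]_(m, n) -> Prop)
    (Q : 'M[C]_(p, q) -> Prop) (f : 'M[C]_(m, n) -> 'M[C]_(p, q)) d1 d2 :
  rclosed P -> rlinear f ->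
  rdim (fun X => P X /\ f X = 0) d1 -> rdim Q d2 ->
  (forall X, P X -> Q (f X)) -> (forall Y, Q Y -> exists2 X, P X & f X = Y) ->
  rdim P (d1 + d2)%N.
Proof.
move=> cP lf [V1 V1E <-] [V2 V2E <-] PQ QP.
have [d [V VE dV]] := rclosed_rdim cP.
exists V => //; pose phi (z : E m n) : E p q := rcplx (f (cplx z)).
have lphi : linear phi by move=> a z w; rewrite /phi cplxP lf rcplxP.
pose phiM := GRing.isLinear.Build _ _ _ _ _ lphi.
pose phiL : {linear E m n -> E p q} := HB.pack phi phiM.
have phiE z : linfun phiL z = phi z by rewrite lfunE.
rewrite -(limg_ker_dim (linfun phiL) V); congr (_ + _)%N; congr (\dim _).
  apply/vspaceP => z; rewrite memv_cap memv_ker phiE; apply/idP/idP.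
    move=> /andP[/VE Pz /eqP fz]; apply/V1E; split=> //.
    by rewrite -[f _]rcplxK -/(phi z) fz cplx0.
  move=> /V1E[Pz fz]; apply/andP; split; first exact/VE.
  by rewrite /phi fz -[0]cplx0 cplxK.
apply/vspaceP => y; apply/idP/idP.
  move=> /memv_imgP[z /VE Pz ->]; rewrite phiE; apply/V2E.
  by rewrite rcplxK; exact: PQ.
move=> /V2E /QP[X PX fX]; apply/memv_imgP; exists (rcplx X).
  by apply/VE; rewrite rcplxK.
by rewrite phiE /phi rcplxK fX cplxK.
Qed.

Lemma rdim0 m n (P : 'M[C]_(m, n) -> Prop) : (forall X, P X <-> X = 0) -> rdim P 0.
Proof.
move=> PE; exists 0%VS; last exact: dimv0.
move=> z; rewrite memv0 PE; split=> [/eqP ->|h]; first exact: cplx0.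
by apply/eqP/(can_inj (@cplxK R Cf m n)); rewrite h cplx0.
Qed.

Lemma rdim_iso m n p q (P : 'M[C]_(m, n) -> Prop) (Q : 'M[C]_(p, q) -> Prop)
    (f : 'M[C]_(m, n) -> 'M[C]_(p, q)) d :
  rclosed Q -> rlinear f -> (forall X, P X -> Q (f X)) ->
  (forall Y, Q Y -> exists2 X, P X & f X = Y) ->
  (forall X, P X -> f X = 0 -> X = 0) -> rdim P d -> rdim Q d.
Proof.
move=> cQ lf PQ QP finj rP; have [e rQ] := rclosed_rdim cQ.
have cP : rclosed P.
  have [V VE _] := rP; split; first by rewrite -cplx0; apply/VE; exact: mem0v.
  move=> a X Y PX PY; rewrite -[X]rcplxK -[Y]rcplxK -cplxP; apply/VE.
  by rewrite memvD ?memvZ //; apply/VE; rewrite rcplxK.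
have r0 : rdim (fun X => P X /\ f X = 0) 0.
  apply: rdim0 => X; split=> [[PX fX]|->]; first exact: finj.
  by split; [exact: cP.1|exact: rlinear0].
by have := rdim_kernel_image cP lf r0 rQ PQ QP; move/(rdim_unique rP) => ->.
Qed.

Lemma rdim_full m n : rdim (fun _ : 'M[C]_(m, n) => True) (2 * (m * n)).
Proof.
exists fullv => [z|]; first by rewrite memvf.
by rewrite dimvf /dim /= dim_matrix mul2n addnn.
Qed.

(** The parametrization by all real matrices [t] takes [t - t^T] as real and [t + t^T] as imaginary
    part; half the sum of the two parts recovers [t]. *)
Lemma rdim_skew n : rdim (fun K : 'M[C]_n => K^H = - K) (n * n).
Proof.
pose phi (t : 'M[R]_n) : E n n := (t - t^T, t + t^T).
have lphi : linear phi.
  by move=> a x y; congr pair; apply/matrixP => i j; rewrite !mxE; ring.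
pose phiM := GRing.isLinear.Build _ _ _ _ _ lphi.
pose phiL : {linear 'M[R]_n -> E n n} := HB.pack phi phiM.
have phiE z : linfun phiL z = phi z by rewrite lfunE.
have k0 : (lker (linfun phiL) == 0)%VS.
  apply/lker0P => s t; rewrite !phiE => -[/matrixP e1 /matrixP e2].
  by apply/matrixP => i j; have := e1 i j; have := e2 i j; rewrite !mxE; lra.
exists (limg (linfun phiL)); last by rewrite limg_dim_eq ?dimvf // (eqP k0) capv0.
move=> z; split=> [/memv_imgP[t _ ->]|/matrixP zE].
  rewrite phiE; apply/matrixP => i j; rewrite !mxE /=.
  by apply: eq_complexField; rewrite ?reC ?imC ?reN ?imN ?re_mk ?im_mk; ring.
apply/memv_imgP; exists (2^-1 *: (z.1 + z.2)) => //; first exact: memvf.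
rewrite phiE [z in LHS]surjective_pairing; congr pair; apply/matrixP => i j;
  have := zE i j; rewrite !mxE => h;
  have := congr1 (@re R Cf) h; have := congr1 (@im R Cf) h;
  rewrite !(reC, imC, reN, imN, re_mk, im_mk) => h1 h2; lra.
Qed.

Lemma rlinear_mul m n p q (A : 'M[C]_(p, m)) (B : 'M[C]_(n, q)) :
  rlinear (fun X => A *m X *m B).
Proof. by move=> a X Y; rewrite mulmxDr mulmxDl -scalemxAr -scalemxAl. Qed.

Lemma rclosed_and m n (P Q : 'M[C]_(m, n) -> Prop) : rclosed P -> rclosed Q ->
  rclosed (fun X => P X /\ Q X).
Proof.
move=> [P0 PD] [Q0 QD]; split=> // a X Y [PX QX] [PY QY].
by split; [exact: PD|exact: QD].
Qed.

Lemma rclosed_eq0 m n p q (f : 'M[C]_(m, n) -> 'M[C]_(p, q)) : rlinear f ->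
  rclosed (fun X => f X = 0).
Proof.
move=> fl; split; first exact: rlinear0.
by move=> a X Y fX fY; rewrite fl fX fY scaler0 addr0.
Qed.

Lemma rclosed_skew n : rclosed (fun K : 'M[C]_n => K^H = - K).
Proof.
split; first by rewrite ctr0 oppr0.
by move=> a X Y hX hY; rewrite ctrD ctrZ hX hY opprD scalerN conj_real.
Qed.

Lemma left_kernel_basis n m (D : 'M[C]_(n, m)) :
  exists (L : 'M[C]_(n - \rank D, n)) (L' : 'M[C]_(n, n - \rank D)),
  [/\ L *m D = 0, L *m L' = 1%:M & forall k (K : 'M[C]_(k, n)), K *m D = 0 -> K = K *m L' *m L].
Proof.
rewrite -mxrank_ker; exists (row_base (kermx D)).
have /row_freeP[L' LL'] := row_base_free (kermx D).
exists L'; split=> //.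
  by apply: sub_kermxP; rewrite eq_row_base.
move=> k K KD; have : (K <= row_base (kermx D))%MS.
  by rewrite eq_row_base; apply/sub_kermxP.
by move=> /submxP[Y ->]; rewrite -(mulmxA Y) LL' mulmx1.
Qed.

(** A skew-Hermitian form killing the columns of [D] descends to the quotient by their span; [L] is
    the quotient map in coordinates. *)
Lemma rdim_skew_kernel n m (D : 'M[C]_(n, m)) :
  rdim (fun K : 'M[C]_n => K^H = - K /\ K *m D = 0) ((n - \rank D) * (n - \rank D)).
Proof.
have [L [L' [LD LL' KE]]] := left_kernel_basis D.
apply: (rdim_iso (f := fun k => L^H *m k *m L)) (rdim_skew _).
- apply: rclosed_and (@rclosed_skew _) _; apply: (rclosed_eq0 (f := fun K => K *m D)).
  by move=> a X Y; rewrite mulmxDl -scalemxAl.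
- exact: rlinear_mul.
- move=> k kH; split=> /=; last by rewrite -mulmxA LD mulmx0.
  by rewrite !ctrM ctrK kH mulNmx mulmxN mulmxA.
- move=> K [KH KD]; have K1 := KE _ _ KD.
  have K2 : K = L^H *m L'^H *m K.
    apply: (can_inj (@ctrK _ _ _)); rewrite !ctrM !ctrK KH !mulNmx mulmxA.
    by rewrite -K1.
  exists (L'^H *m K *m L'); last by rewrite !mulmxA -K2 -K1.
  by rewrite !ctrM ctrK KH mulNmx mulmxN mulmxA.
- move=> k _ h; have := congr1 (fun A => L'^H *m A *m L') h.
  rewrite mulmx0 mul0mx !mulmxA -ctrM LL' ctr1 mul1mx -mulmxA LL' mulmx1.
  by [].
Qed.

(** These are the complex linear maps from the cokernel of [D] to the kernel of [A], and 2 passes to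
    real dimension. *)
Lemma rdim_hom n m p q (A : 'M[C]_(p, n)) (D : 'M[C]_(m, q)) :
  rdim (fun X : 'M[C]_(n, m) => A *m X = 0 /\ X *m D = 0)
    (2 * ((n - \rank A) * (m - \rank D))).
Proof.
have [L [L' [LD LL' KE]]] := left_kernel_basis D.
rewrite -(mxrank_tr A).
have [N [N' [NA NN' NE]]] := left_kernel_basis A^T.
apply: (rdim_iso (f := fun k => N^T *m k *m L)) (rdim_full _ _).
- apply: rclosed_and.
    apply: (rclosed_eq0 (f := fun K => A *m K)).
    by move=> a X Y; rewrite mulmxDr -scalemxAr.
  apply: (rclosed_eq0 (f := fun K => K *m D)).
  by move=> a X Y; rewrite mulmxDl -scalemxAl.
- exact: rlinear_mul.
- move=> k _; split=> /=; last by rewrite -mulmxA LD mulmx0.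
  have AN : A *m N^T = 0 by apply: trmx_inj; rewrite trmx_mul trmxK NA trmx0.
  by rewrite !mulmxA AN !mul0mx.
- move=> X [AX XD]; exists (N'^T *m X *m L') => //.
  have X1 := KE _ _ XD.
  have X2 : N^T *m N'^T *m X = X.
    apply: trmx_inj; rewrite !trmx_mul !trmxK mulmxA -(NE _ X^T) //.
    by rewrite -trmx_mul AX trmx0.
  by rewrite !mulmxA X2 -X1.
- move=> k _ h; have := congr1 (fun A => N'^T *m A *m L') h.
  rewrite mulmx0 mul0mx !mulmxA -trmx_mul NN' trmx1 mul1mx -mulmxA LL' mulmx1.
  by [].
Qed.

End RealDimension.
Arguments rdim {R Cf m n} P d%_N.

Section Ranks.
Set Implicit Arguments.
Unset Strict Implicit.
Variable K : fieldType.

Lemma rank_row_mx_disjoint n p q (A : 'M[K]_(n, p)) (B : 'M[K]_(n, q)) :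
  (forall k (x : 'M[K]_(p, k)) (y : 'M[K]_(q, k)), A *m x = B *m y -> A *m x = 0) ->
  \rank (row_mx A B) = (\rank A + \rank B)%N.
Proof.
move=> AB; rewrite -mxrank_tr tr_row_mx -addsmxE mxrank_disjoint_sum ?mxrank_tr //.
apply/eqP; rewrite -submx0; apply/rV_subP => v; rewrite sub_capmx.
move=> /andP[/submxP[x vx] /submxP[y vy]]; rewrite submx0.
have /AB : A *m x^T = B *m y^T.
  by apply: trmx_inj; rewrite !trmx_mul !trmxK -vx -vy.
by move=> /(congr1 trmx); rewrite trmx_mul trmxK -vx trmx0 => ->.
Qed.

Lemma rank_idempotent_compl n (e : 'M[K]_n) : e *m e = e ->
  \rank (1%:M - e) = (n - \rank e)%N.
Proof.
move=> ee; rewrite -mxrank_ker; apply: eqmx_rank; apply/andP; split.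
  by apply/sub_kermxP; rewrite mulmxBl mul1mx ee subrr.
have := mulmx_ker e => ke.
have -> : kermx e = kermx e *m (1%:M - e) by rewrite mulmxBr mulmx1 ke subr0.
exact: submxMl.
Qed.

Lemma rank_ginv n m (D : 'M[K]_(n, m)) (J : 'M[K]_(m, n)) : D *m J *m D = D ->
  \rank (J *m D) = \rank D.
Proof.
move=> DJD; apply/eqP; rewrite eqn_leq mxrankM_maxr /=.
by rewrite -[in leqLHS]DJD -mulmxA mxrankM_maxr.
Qed.

Lemma mx_left_inverse n m (M : 'M[K]_(n, m)) :
  (forall k (X : 'M[K]_(m, k)), M *m X = 0 -> X = 0) ->
  exists Ml : 'M[K]_(m, n), Ml *m M = 1%:M.
Proof.
move=> Mfree; apply/row_fullP; rewrite -cokermx_eq0; apply/eqP/Mfree.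
exact: mulmx_coker.
Qed.

End Ranks.

(** * Dimension of the Lie algebra of the stabilizer *)

Section LieDimension.
Set Implicit Arguments.
Unset Strict Implicit.

(** Column operations replace [D] by [pW *m D], whose columns are independent of those of [pU]. *)
Lemma rank_split (C : numClosedFieldType) n (G pU pW : 'M[C]_n) m (D : 'M[C]_(n, m)) :
  ortho_split G pU pW ->
  \rank (row_mx pU D) = (\rank pU + \rank (pW *m D))%N.
Proof.
move=> sp; have [_ _ pUW pU_UW _] := sp.
have <- : \rank (row_mx pU (pW *m D)) = \rank (row_mx pU D).
  apply/eqP; rewrite eqn_leq; apply/andP; split.
    have -> : row_mx pU (pW *m D) = row_mx pU D *m block_mx 1%:M (- (pU *m D)) 0 1%:M.
      rewrite mul_row_block !mulmx1 mulmx0 addr0 mulmxN mulmxA pU_UW.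
      by rewrite -[in pW *m D](addrK pU pW) [pW + pU]addrC pUW mulmxBl mul1mx addrC.
    exact: mxrankM_maxl.
  have -> : row_mx pU D = row_mx pU (pW *m D) *m block_mx 1%:M (pU *m D) 0 1%:M.
    rewrite mul_row_block !mulmx1 mulmx0 addr0 mulmxA pU_UW.
    by rewrite -mulmxDl pUW mul1mx.
  exact: mxrankM_maxl.
apply: rank_row_mx_disjoint => k x y h.
by rewrite -[in LHS]pU_UW -mulmxA h !mulmxA (split_UW0 sp) !mul0mx.
Qed.

Variables (R : realType) (Cf : complexField R) (n : nat).
Notation C := (ccarrier Cf).
Notation cplx := (@cplx R Cf _ _).
Variables (G pU pW : 'M[C]_n).
Hypothesis sp : ortho_split G pU pW.

Let Gu : G \in unitmx. Proof. by case: sp. Qed.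
Let pUW : pU + pW = 1%:M. Proof. by case: sp. Qed.

Lemma rclosed_lieH : rclosed (lieH G pU).
Proof.
split; first by split; rewrite ?mulmx0 ?mul0mx ?ctr0 ?oppr0.
move=> a X Y [Xp Xs] [Yp Ys]; split.
  by rewrite mulmxDl mulmxDr -scalemxAl -scalemxAr Xp Yp.
by rewrite mulmxDr -scalemxAr ctrD ctrZ conj_real Xs Ys opprD scalerN.
Qed.

(** A skew form killing one summand on the right kills it on the left too, hence is block
    diagonal. *)
Lemma lieH_of_skew (K : 'M[C]_n) : K^H = - K -> K *m pU = 0 \/ K *m pW = 0 ->
  lieH G pU (invmx G *m K).
Proof.
move=> Ks Kp; split; last by rewrite mulKVmx.
have KpU : K *m pU = pU^H *m K.
  have KpC (p : 'M[C]_n) : K *m p = 0 -> p^H *m K = 0.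
    move=> Kp0; apply: (can_inj (@ctrK _ _ _)).
    by rewrite ctrM ctrK Ks mulNmx Kp0 ctr0 oppr0.
  case: Kp => Kp; first by rewrite Kp KpC.
  rewrite -[LHS]addr0 -Kp -mulmxDr pUW mulmx1 -[RHS]addr0 -[X in _ + X](KpC _ Kp).
  by rewrite -mulmxDl -ctrD pUW ctr1 mul1mx.
rewrite -mulmxA KpU; apply: (canLR (mulKmx Gu)).
by rewrite !mulmxA (split_GU sp) -!mulmxA mulKVmx.
Qed.

(** Restriction to U, that is [X |-> G *m X *m pU], has as image the skew forms on U killing [D],
    and as kernel those on W. With [D] empty this is the dimension of the whole Lie algebra. *)
Lemma rdim_lieH_kernel m (D : 'M[C]_(n, m)) :
  rdim (fun X => lieH G pU X /\ X *m D = 0)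
   ((n - \rank (row_mx pU D)) * (n - \rank (row_mx pU D)) +
    (n - \rank (row_mx pW D)) * (n - \rank (row_mx pW D))).
Proof.
have cP : rclosed (fun X => lieH G pU X /\ X *m D = 0).
  apply: rclosed_and rclosed_lieH _; apply: (rclosed_eq0 (f := fun K => K *m D)).
  by move=> a X Y; rewrite mulmxDl -scalemxAl.
have rl : rlinear (fun X => G *m X *m pU) by exact: rlinear_mul.
have split0 m1 m2 m3 (K : 'M[C]_(m1, n)) (A : 'M[C]_(n, m2)) (B : 'M[C]_(n, m3)) :
    K *m row_mx A B = 0 <-> K *m A = 0 /\ K *m B = 0.
  rewrite mul_mx_row; split=> [h|[-> ->]]; last exact: row_mx0.
  by apply: eq_row_mx; rewrite h row_mx0.
have GXE X : G *m X *m pU = 0 -> X *m pU = 0.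
  by move=> h; rewrite -[X *m pU](mulKmx Gu) [G *m _]mulmxA h mulmx0.
apply: (rdim_kernel_image cP rl _ (rdim_skew_kernel (row_mx pW D))).
- apply: (rdim_iso (f := fun K => invmx G *m K)) (rdim_skew_kernel (row_mx pU D)).
  + exact: rclosed_and cP (rclosed_eq0 rl).
  + by move=> a X Y; rewrite mulmxDr -scalemxAr.
  + move=> K [Ks /split0[KU KD]]; split; [split|].
    * exact: lieH_of_skew Ks (or_introl KU).
    * by rewrite -mulmxA KD mulmx0.
    * by rewrite mulKVmx.
  + move=> X [[[Xp Xs] XD] /GXE XU]; exists (G *m X); last by rewrite mulKmx.
    by split=> //; apply/split0; split; rewrite -mulmxA ?XU ?XD mulmx0.
  + by move=> K _ h; rewrite -[K](mulKVmx Gu) h mulmx0.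
- move=> X [[Xp Xs] XD]; have GXU : G *m X *m pU = pU^H *m (G *m X).
    by rewrite -mulmxA Xp mulmxA (split_GU sp) !mulmxA.
  split; first by rewrite [in LHS]GXU ctrM ctrK Xs mulNmx.
  apply/split0; split; first by rewrite -mulmxA (split_UW0 sp) mulmx0.
  by rewrite GXU -!mulmxA XD !mulmx0.
- move=> K [Ks /split0[KW KD]]; exists (invmx G *m K).
    split; first exact: lieH_of_skew Ks (or_intror KW).
    by rewrite -mulmxA KD mulmx0.
  by rewrite mulKVmx // -[LHS]addr0 -KW -mulmxDr pUW mulmx1.
Qed.

Variables (r : nat) (M : 'M[C]_(n, r)).
Variables (DU DW : 'M[C]_(n, r)) (JU JW : 'M[C]_(r, n)) (fU fW beta J : 'M[C]_r).
Hypotheses (DUE : DU = pU *m M) (DWE : DW = pW *m M).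
Hypotheses (DUJ : DU *m JU *m DU = DU) (DWJ : DW *m JW *m DW = DW).
Hypotheses (fUE : fU = 1%:M - JU *m DU) (fWE : fW = 1%:M - JW *m DW).
Hypothesis betaE : beta = M^H *m G *m pU *m M.
Hypothesis Mfree : forall k (X : 'M[C]_(r, k)), M *m X = 0 -> X = 0.
Hypothesis Miso : M^H *m G *m M = 0.
Hypotheses (JH : J^H = J) (bJb : beta *m J *m beta = beta).

(* The matrices in the frame M of the endomorphisms of S induced by the Lie
   algebra of the stabilizer of S. *)
Definition stab_coef (nu : 'M[C]_r) :=
  [/\ DU *m nu *m fU = 0, DW *m nu *m fW = 0 & beta *m nu + nu^H *m beta = 0].

Let bfU := beta_fU DUE DUJ fUE betaE.
Let bfW := beta_fW sp DWE DWJ fWE betaE Miso.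
Let bH := betaH sp betaE.
Let DUf := DUfU DUJ fUE.
Let DWf := DWfW DWJ fWE.

Lemma beta_of_DU k (X : 'M[C]_(r, k)) : DU *m X = 0 -> beta *m X = 0.
Proof. by rewrite betaE -!mulmxA [pU *m _]mulmxA -DUE => ->; rewrite !mulmx0. Qed.

Lemma beta_of_DW k (X : 'M[C]_(r, k)) : DW *m X = 0 -> beta *m X = 0.
Proof.
move=> h; apply/eqP; rewrite -oppr_eq0 -mulNmx -(betaW sp betaE Miso) -!mulmxA.
by rewrite [pW *m _]mulmxA -DWE h !mulmx0.
Qed.

Lemma D_eq0 k (X : 'M[C]_(r, k)) : DU *m X = 0 -> DW *m X = 0 -> X = 0.
Proof.
move=> hU hW; apply: Mfree; rewrite -[M]mul1mx -pUW mulmxDl -DUE -DWE mulmxDl.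
by rewrite hU hW addr0.
Qed.

Lemma rclosed_stab_coef : rclosed stab_coef.
Proof.
split; first by split; rewrite ?mulmx0 ?mul0mx ?ctr0 ?mul0mx ?addr0.
move=> a X Y [X1 X2 X3] [Y1 Y2 Y3]; split.
- by rewrite mulmxDr mulmxDl -scalemxAr -scalemxAl X1 Y1 scaler0 addr0.
- by rewrite mulmxDr mulmxDl -scalemxAr -scalemxAl X2 Y2 scaler0 addr0.
- rewrite mulmxDr ctrD mulmxDl ctrZ conj_real -scalemxAr -scalemxAl addrACA.
  by rewrite -scalerDr X3 Y3 scaler0 addr0.
Qed.

Lemma rank_row_fUfW : \rank (row_mx fU fW) = (\rank fU + \rank fW)%N.
Proof.
apply: rank_row_mx_disjoint => k x y h; apply: D_eq0.
  by rewrite mulmxA DUf mul0mx.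
by rewrite h mulmxA DWf mul0mx.
Qed.

Lemma rank_fU : \rank fU = (r - \rank DU)%N.
Proof.
rewrite fUE rank_idempotent_compl ?(rank_ginv DUJ) //.
by rewrite mulmxA -(mulmxA JU) -(mulmxA JU) DUJ.
Qed.

Lemma rank_fW : \rank fW = (r - \rank DW)%N.
Proof.
rewrite fWE rank_idempotent_compl ?(rank_ginv DWJ) //.
by rewrite mulmxA -(mulmxA JW) -(mulmxA JW) DWJ.
Qed.

(** Projecting the correction by [1%:M - J *m beta] puts it in the kernel of [beta], and leaves its
    values on [fU] and [fW], already there, unchanged. *)
Lemma correction_in_radical (A B : 'M[C]_r) :
  beta *m (A *m fU) = 0 -> beta *m (B *m fW) = 0 ->
  exists N : 'M[C]_r, [/\ beta *m N = 0, N *m fU = A *m fU & N *m fW = B *m fW].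
Proof.
move=> hA hB; have [N NU NW] := common_correction sp DUE DWE DUJ DWJ fUE fWE Mfree A B.
exists ((1%:M - J *m beta) *m N); split.
- by rewrite mulmxA mulmxBr mulmx1 mulmxA bJb subrr mul0mx.
- by rewrite -mulmxA NU mulmxBl mul1mx -[J *m _ *m _]mulmxA hA mulmx0 subr0.
- by rewrite -mulmxA NW mulmxBl mul1mx -[J *m _ *m _]mulmxA hB mulmx0 subr0.
Qed.

(** Four layers are peeled off by rank-nullity: [beta *m nu] ranges over skew forms modulo the
    kernel of [beta]; [nu *m fU] and [nu *m fW] range over the endomorphisms of S :&: W and S :&: U;
    what remains sends S modulo their sum into the kernel of [beta]. *)
Lemma rdim_stab_coef : rdim stab_coef
  (2 * ((r - \rank beta) * (r - (r - \rank DU + (r - \rank DW)))) +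
   2 * ((r - \rank DW) * (r - \rank DW)) + 2 * ((r - \rank DU) * (r - \rank DU)) +
   \rank beta * \rank beta).
Proof.
have rlr (k : nat) (A : 'M[C]_(k, r)) : rlinear (fun nu : 'M[C]_r => A *m nu).
  by move=> a X Y; rewrite mulmxDr -scalemxAr.
have rll (k : nat) (A : 'M[C]_(r, k)) : rlinear (fun nu : 'M[C]_r => nu *m A).
  by move=> a X Y; rewrite mulmxDl -scalemxAl.
have rfb : \rank (1%:M - J *m beta) = (r - \rank beta)%N.
  rewrite rank_idempotent_compl ?(rank_ginv bJb) //.
  by rewrite mulmxA -(mulmxA J) -(mulmxA J) bJb.
have rb : (r - \rank (1%:M - J *m beta)%R)%N = \rank beta.
  by rewrite rfb subKn // rank_leq_row.
have d3 := rdim_skew_kernel (1%:M - J *m beta); rewrite rb in d3.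
apply: (rdim_kernel_image rclosed_stab_coef (rlr _ beta) _ d3); last first.
- move=> K [Ks Kf]; have KJ : K = K *m J *m beta.
    by apply/eqP; rewrite -subr_eq0 -[X in X - _]mulmx1 -mulmxA -mulmxBr Kf.
  have bJK : beta *m J *m K = K.
    apply: (can_inj (@ctrK _ _ _)); rewrite !ctrM bH JH Ks mulNmx mulmxA.
    by rewrite -KJ.
  exists (J *m K); last by rewrite mulmxA bJK.
  have KfU : K *m fU = 0 by rewrite KJ -mulmxA bfU mulmx0.
  have KfW : K *m fW = 0 by rewrite KJ -mulmxA bfW mulmx0.
  split.
  + by rewrite -!mulmxA KfU !mulmx0.
  + by rewrite -!mulmxA KfW !mulmx0.
  + have -> : (J *m K)^H *m beta = (beta *m (J *m K))^H by rewrite [in RHS]ctrM bH.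
    by rewrite mulmxA bJK Ks subrr.
- move=> nu [_ _ h]; have bs : beta *m nu = - (nu^H *m beta).
    by apply/eqP; rewrite -addr_eq0 h.
  split; first by rewrite ctrM bH bs opprK.
  by rewrite bs mulNmx -mulmxA mulmxBr mulmx1 mulmxA bJb subrr mulmx0 oppr0.
pose K1 (nu : 'M[C]_r) := (beta *m nu = 0 /\ DW *m nu *m fW = 0) /\ DU *m nu *m fU = 0.
apply: (@eq_rdim _ _ _ _ K1).
  move=> nu; split=> [[[h1 h2] h3]|[[h1 h2 h3] h4]] //; split=> //; split=> //.
  have -> : nu^H *m beta = (beta *m nu)^H by rewrite ctrM bH.
  by rewrite h1 ctr0 addr0.
have cW : rclosed (fun nu : 'M[C]_r => beta *m nu = 0 /\ DW *m nu *m fW = 0).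
  by apply: rclosed_and; apply: rclosed_eq0; [exact: rlr|exact: rlinear_mul].
have cK1 : rclosed K1 by apply: rclosed_and cW (rclosed_eq0 (rlinear_mul _ _)).
have DDf (D : 'M[C]_(n, r)) (J' : 'M[C]_(r, n)) : D *m J' *m D = D ->
    rdim (fun X : 'M[C]_r => D *m X = 0 /\ X *m (J' *m D) = 0)
      (2 * ((r - \rank D) * (r - \rank D))).
  by move=> DJD; have := rdim_hom D (J' *m D); rewrite (rank_ginv DJD).
have kill (f D : 'M[C]_r) (J' : 'M[C]_(r, n)) (X : 'M[C]_r) D' : f = 1%:M - J' *m D' ->
   X *m (J' *m D') = 0 -> X *m f = X.
  by move=> -> h; rewrite mulmxBr mulmx1 h subr0.
apply: (rdim_kernel_image cK1 (rll _ fU) _ (DDf _ _ DUJ)); last first.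
- move=> X [DX XJ]; have Xf := kill _ X _ _ _ fUE XJ.
  have [||N [bN NU NW]] := @correction_in_radical X 0.
  + by rewrite Xf; exact: beta_of_DU.
  + by rewrite mul0mx mulmx0.
  exists N; last by rewrite NU.
  by split; [split=> //|]; rewrite -mulmxA ?NW ?NU ?Xf ?mul0mx ?mulmx0.
- move=> nu [_ h]; split; first by rewrite mulmxA.
  by rewrite fUE mulmxBr mulmx1 mulmxBl !mulmxA -!(mulmxA nu) -!mulmxA -{1}DUJ -!mulmxA subrr.
pose K2 (nu : 'M[C]_r) := (beta *m nu = 0 /\ nu *m fU = 0) /\ DW *m nu *m fW = 0.
apply: (@eq_rdim _ _ _ _ K2).
  move=> nu; split=> [[[h1 h2] h3]|[[[h1 h2] h3] h4]]; split=> //; split=> //.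
  by rewrite -mulmxA h2 mulmx0.
have cK2 : rclosed K2.
  apply: rclosed_and; last exact: (rclosed_eq0 (rlinear_mul _ _)).
  by apply: rclosed_and; apply: rclosed_eq0; [exact: rlr|exact: rll].
apply: (rdim_kernel_image cK2 (rll _ fW) _ (DDf _ _ DWJ)); last first.
- move=> X [DX XJ]; have Xf := kill _ X _ _ _ fWE XJ.
  have [||N [bN NU NW]] := @correction_in_radical 0 X.
  + by rewrite mul0mx mulmx0.
  + by rewrite Xf; exact: beta_of_DW.
  exists N; last by rewrite NW.
  split; first by split=> //; rewrite NU mul0mx.
  by rewrite -mulmxA NW Xf.
- move=> nu [_ h]; split; first by rewrite mulmxA.
  by rewrite fWE mulmxBr mulmx1 mulmxBl !mulmxA -!(mulmxA nu) -!mulmxA -{1}DWJ -!mulmxA subrr.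
have := rdim_hom beta (row_mx fU fW); rewrite rank_row_fUfW rank_fU rank_fW.
apply: eq_rdim => nu; rewrite mul_mx_row; split.
  move=> [h1 h]; have [h2 h3] : nu *m fU = 0 /\ nu *m fW = 0.
    by apply: eq_row_mx; rewrite h row_mx0.
  by split=> //; split=> //; rewrite -mulmxA h3 mulmx0.
by move=> [[[h1 h2] h3] h4]; rewrite h2 h4 row_mx0.
Qed.

Definition lieHS (X : 'M[C]_n) := lieH G pU X /\ exists N : 'M[C]_r, X *m M = M *m N.

Lemma rclosed_lieHS : rclosed lieHS.
Proof.
split; first by split; [exact: rclosed_lieH.1|exists 0; rewrite mul0mx mulmx0].
move=> a X Y [hX [N1 h1]] [hY [N2 h2]]; split; first exact: rclosed_lieH.2.
exists (toC a *: N1 + N2).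
by rewrite mulmxDl mulmxDr -scalemxAl -scalemxAr h1 h2.
Qed.

(** Rank-nullity for the action on S, read off by a left inverse [Ml] of the frame. The image is all
    of [stab_coef] by [lieH_extension]. *)
Lemma rdim_lieHS : rdim lieHS
  ((n - (\rank pU + \rank DW)) * (n - (\rank pU + \rank DW)) +
   (n - (\rank pW + \rank DU)) * (n - (\rank pW + \rank DU)) +
  (2 * ((r - \rank beta) * (r - (r - \rank DU + (r - \rank DW)))) +
   2 * ((r - \rank DW) * (r - \rank DW)) + 2 * ((r - \rank DU) * (r - \rank DU)) +
   \rank beta * \rank beta)).
Proof.
have [Ml MlM] := mx_left_inverse Mfree.
apply: (rdim_kernel_image rclosed_lieHS (rlinear_mul Ml M) _ rdim_stab_coef).
- have := rdim_lieH_kernel M.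
  have -> : \rank (row_mx pW M) = (\rank pW + \rank DU)%N.
    have sp' : ortho_split G pW pU := ortho_split_sym sp.
    by rewrite DUE; exact: rank_split sp'.
  rewrite (rank_split _ sp) -DWE; apply: eq_rdim => X; split.
    move=> [hX XM]; split; last by rewrite -mulmxA XM mulmx0.
    by split=> //; exists 0; rewrite XM mulmx0.
  move=> [[hX [N XM]]]; rewrite -mulmxA XM mulmxA MlM mul1mx => N0.
  by split=> //; rewrite N0 mulmx0.
- move=> X [[Xp Xs] [N XM]]; rewrite -mulmxA XM mulmxA MlM mul1mx.
  have XW : X *m pW = pW *m X.
    by rewrite -[pW](addrK pU) [pW + pU]addrC pUW mulmxBl mulmxBr mul1mx mulmx1 Xp.
  split.
  + by rewrite DUE -(mulmxA pU) -XM mulmxA -Xp -!mulmxA [pU *m _]mulmxA -DUE DUf mulmx0.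
  + by rewrite DWE -(mulmxA pW) -XM mulmxA -XW -!mulmxA [pW *m _]mulmxA -DWE DWf mulmx0.
  + have bN : beta *m N = M^H *m (G *m X) *m pU *m M.
      by rewrite betaE -!mulmxA -XM [pU *m (X *m _)]mulmxA -Xp !mulmxA.
    have -> : N^H *m beta = (beta *m N)^H by rewrite ctrM bH.
    have e : (M^H *m (G *m X) *m pU *m M)^H = M^H *m (pU^H *m (G *m X)^H) *m M.
      by rewrite !ctrM ctrK !mulmxA.
    rewrite bN e Xs mulmxN mulmxN mulNmx; apply/eqP; rewrite subr_eq0; apply/eqP.
    by rewrite [pU^H *m _]mulmxA -(split_GU sp) -!mulmxA [pU *m (X *m _)]mulmxA -Xp !mulmxA.
- move=> nu [nU nW nb].
  have [||||X hX XM] := @lieH_extension _ _ _ _ _ sp _ M _ _ _ _ _ _ DUE DWE fUE fWE (M *m nu).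
  + by rewrite mulmxA -DUE.
  + by rewrite mulmxA -DWE.
  + by rewrite mulmxA -betaE ctrM -(mulmxA nu^H) -!(mulmxA nu^H) -betaE.
  + rewrite mulmxA (betaW sp betaE Miso) ctrM -!(mulmxA nu^H) (betaW sp betaE Miso).
    by rewrite mulmxN mulNmx -opprD nb oppr0.
  exists X; last by rewrite -mulmxA XM mulmxA MlM mul1mx.
  by split=> //; exists nu.
Qed.

End LieDimension.

(** * The Cayley transform and the charts *)

Section LinearFunctionals.
Set Implicit Arguments.
Unset Strict Implicit.
Variables (R : realType) (Cf : complexField R).
Notation C := (ccarrier Cf).
Notation cplx := (@cplx R Cf _ _).

Lemma linear_pack (U V : lmodType R) (f : U -> V) : linear f ->
  exists l : {linear U -> V}, forall x, l x = f x.
Proof.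
move=> lf; pose fM := GRing.isLinear.Build _ _ _ _ _ lf.
by pose l : {linear U -> V} := HB.pack f fM; exists l.
Qed.

Lemma rV_rational_linear d (l : {linear 'rV[R]_d -> R}) A : rational_on A l.
Proof.
have := @rational_sum R _ A _ (index_enum 'I_d) xpredT
  (fun k v => v 0 k * l (delta_mx 0 k)).
have -> : (fun v : 'rV[R]_d => \sum_(k <- index_enum 'I_d) v 0 k * l (delta_mx 0 k)) = l.
  apply/funext => v; rewrite [in RHS](row_sum_delta v) linear_sum.
  by apply: eq_bigr => k _; rewrite linearZ.
apply=> k _; apply: rational_mul; first exact: rational_coord.
exact: rational_cst.
Qed.

Lemma rV_linear_continuous d (l : {linear 'rV[R]_d -> R}) : continuous l.
Proof. by move=> x; exact: (@rational_continuous _ _ setT _ _ I (rV_rational_linear l setT)). Qed.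

Section Pairs.
Variables m n : nat.
Notation E := ('M[R]_(m, n) * 'M[R]_(m, n))%type.

Lemma linear_rcplxE (l : {linear E -> R}) (W : 'M[C]_(m, n)) :
  l (rcplx W) = \sum_(k : 'I_m * 'I_n) re (W k.1 k.2) * l (delta_mx k.1 k.2, 0) +
                \sum_(k : 'I_m * 'I_n) im (W k.1 k.2) * l (0, delta_mx k.1 k.2).
Proof.
have lin1 : linear (fun a : 'M[R]_(m, n) => l (a, 0)).
  move=> a u v; rewrite -linearP; congr (l _).
  by congr pair => /=; rewrite scaler0 addr0.
have lin2 : linear (fun a : 'M[R]_(m, n) => l (0, a)).
  move=> a u v; rewrite -linearP; congr (l _).
  by congr pair => /=; rewrite scaler0 addr0.
have [l1 l1E] := linear_pack lin1; have [l2 l2E] := linear_pack lin2.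
have -> : l (rcplx W) = l1 (map_mx (@re R Cf) W) + l2 (map_mx (@im R Cf) W).
  by rewrite l1E l2E -raddfD; congr (l _); congr pair; rewrite /= ?addr0 ?add0r.
rewrite [map_mx _ _ in X in X + _]matrix_sum_delta [map_mx _ _ in X in _ + X]matrix_sum_delta.
rewrite !pair_bigA !linear_sum; congr (_ + _); apply: eq_bigr => k _ /=.
  by rewrite linearZ /= l1E mxE.
by rewrite linearZ /= l2E mxE.
Qed.

Lemma rational_functional (F : normedModType R) (A : set F) (f : F -> 'M[C]_(m, n))
    (l : {linear E -> R}) : mxrational A f -> rational_on A (fun x => l (rcplx (f x))).
Proof.
move=> rf; have -> : (fun x => l (rcplx (f x))) = (fun x =>
   \sum_(k : 'I_m * 'I_n) re (f x k.1 k.2) * l (delta_mx k.1 k.2, 0) +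
   \sum_(k : 'I_m * 'I_n) im (f x k.1 k.2) * l (0, delta_mx k.1 k.2)).
  by apply/funext => x; exact: linear_rcplxE.
apply: rational_add; apply: rational_sum => -[i j] _; apply: rational_mul;
  [exact: (rf i j).1|exact: rational_cst|exact: (rf i j).2|exact: rational_cst].
Qed.

Lemma sdiff_sum (F : normedModType R) (I : Type) (s : seq I) (f l : I -> F -> R) x :
  (forall i, sdiff (f i) x (l i)) ->
  sdiff (fun x => \sum_(i <- s) f i x) x (fun v => \sum_(i <- s) l i v).
Proof.
move=> h; elim: s => [|i s IH].
  by apply: sdiff_ext (sdiff_cst x 0) => v; rewrite big_nil.
by apply: sdiff_ext (sdiff_add (h i) IH) => v; rewrite big_cons.
Qed.

Lemma sdiff_functional (F : normedModType R) (f L : F -> 'M[C]_(m, n)) x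
    (l : {linear E -> R}) : mxsdiff f x L ->
  sdiff (fun x => l (rcplx (f x))) x (fun v => l (rcplx (L v))).
Proof.
move=> hf.
have term (g k : F -> R) c : sdiff g x k -> sdiff (fun x => g x * c) x (fun v => k v * c).
  move=> gk; apply: sdiff_ext (sdiff_mul gk (sdiff_cst x c)) => v //.
  by rewrite mulr0 add0r mulrC.
apply: sdiff_ext (sdiff_add
    (@sdiff_sum F _ (index_enum ('I_m * 'I_n)%type)
      (fun k x => re (f x k.1 k.2) * l (delta_mx k.1 k.2, 0))
      (fun k x => re (L x k.1 k.2) * l (delta_mx k.1 k.2, 0)) x _)
    (@sdiff_sum F _ (index_enum ('I_m * 'I_n)%type)
      (fun k x => im (f x k.1 k.2) * l (0, delta_mx k.1 k.2))
      (fun k x => im (L x k.1 k.2) * l (0, delta_mx k.1 k.2)) x _)) => [v|v|k|k].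
- by rewrite linear_rcplxE.
- by rewrite linear_rcplxE.
- by apply: term; exact: (hf k.1 k.2).1.
- by apply: term; exact: (hf k.1 k.2).2.
Qed.

Lemma linear_to_rV_coord d (p : {linear E -> 'rV[R]_d}) j :
  exists l : {linear E -> R}, forall z, l z = p z 0 j.
Proof.
by apply: (@linear_pack E _ (fun z : E => p z 0 j : R)) => a u v; rewrite linearP !mxE.
Qed.

Lemma linear_to_rV_continuous d (p : {linear E -> 'rV[R]_d}) : continuous p.
Proof.
move=> z; apply: (@rational_map_continuous R E d setT) => // j.
have [l lE] := linear_to_rV_coord p j.
have := rational_functional l (@mxrational_cplx R Cf m n setT); congr rational_on.
by apply/funext => x; rewrite cplxK lE.
Qed.

Section Parametrization.
Variables (d : nat) (f : {linear 'rV[R]_d -> E}).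

Lemma linear_from_rV_coord i j :
  (exists l : {linear 'rV[R]_d -> R}, forall v, l v = (f v).1 i j) /\
  (exists l : {linear 'rV[R]_d -> R}, forall v, l v = (f v).2 i j).
Proof.
split; [apply: (@linear_pack _ _ (fun v => (f v).1 i j : R))|
        apply: (@linear_pack _ _ (fun v => (f v).2 i j : R))] => a u v;
  by rewrite linearP !mxE.
Qed.

Lemma mxrational_linear A : mxrational A (fun v => cplx (f v)).
Proof.
move=> i j; have [[l1 h1] [l2 h2]] := linear_from_rV_coord i j; split.
  by have := rV_rational_linear l1 A; congr rational_on; apply/funext => v; rewrite mxE re_mk h1.
by have := rV_rational_linear l2 A; congr rational_on; apply/funext => v; rewrite mxE im_mk h2.
Qed.

Lemma mxsdiff_linear x : mxsdiff (fun v => cplx (f v)) x (fun v => cplx (f v)).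
Proof.
move=> i j; have [[l1 h1] [l2 h2]] := linear_from_rV_coord i j; split.
  by apply: sdiff_ext (sdiff_lin x (rV_linear_continuous (l := l1))) => v; rewrite mxE re_mk h1.
by apply: sdiff_ext (sdiff_lin x (rV_linear_continuous (l := l2))) => v; rewrite mxE im_mk h2.
Qed.

End Parametrization.

Lemma vspace_coordinates (V : {vspace E}) :
  exists (f : {linear 'rV[R]_(\dim V) -> E}) (p : {linear E -> 'rV[R]_(\dim V)}),
  [/\ forall v, p (f v) = v, forall v, f v \in V & forall z, z \in V -> f (p z) = z].
Proof.
pose b := vbasis V; have fb : free b by exact: basis_free (vbasisP V).
have [f fE] : exists f : {linear 'rV[R]_(\dim V) -> E},
    forall v, f v = \sum_i v 0 i *: b`_i.
  apply: (@linear_pack ('rV[R]_(\dim V)) E (fun v => \sum_i v 0 i *: b`_i)) => a u v.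
  rewrite scaler_sumr -big_split; apply: eq_bigr => i _.
  by rewrite !mxE scalerDl scalerA.
have [p pE] : exists p : {linear E -> 'rV[R]_(\dim V)},
    forall z, p z = \row_i coord b i z.
  apply: (@linear_pack E ('rV[R]_(\dim V)) (fun z => \row_i coord b i z)) => a u v.
  by apply/rowP => i; rewrite !mxE linearP.
exists f, p; split.
- move=> v; rewrite fE pE; apply/rowP => i; rewrite mxE.
  by rewrite coord_sum_free.
- move=> v; rewrite fE memv_suml // => i _; rewrite memvZ // vbasis_mem //.
  by rewrite mem_nth // size_tuple.
- move=> z Vz; rewrite fE pE [RHS](coord_vbasis Vz).
  by apply: eq_bigr => i _; rewrite mxE.
Qed.

End Pairs.

Lemma open_neq0 (E : normedModType R) (A : set E) (f : E -> C) :
  open A -> crational A f -> open [set x | A x /\ f x != 0].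
Proof.
move=> oA [f1 f2].
pose N x := re (f x) * re (f x) + im (f x) * im (f x).
have rN : rational_on A N by apply: rational_add; apply: rational_mul.
have NE x : (f x != 0) = (N x != 0).
  rewrite /N -!expr2; congr (~~ _); apply/eqP/idP => [->|].
    by rewrite re0 im0 expr0n addr0.
  rewrite paddr_eq0 ?sqr_ge0 // !sqrf_eq0 => /andP[/eqP rz /eqP iz].
  by apply: eq_complexField; rewrite ?rz ?iz ?re0 ?im0.
rewrite openE => x [Ax]; rewrite NE => Nx.
apply: filterS2 (open_nbhs_nbhs (conj oA Ax)) (near_neq0 (rational_continuous Ax rN) Nx).
by move=> y Ay Ny; split=> //; rewrite NE.
Qed.

End LinearFunctionals.

Section Cayley.
Set Implicit Arguments.
Unset Strict Implicit.
Variables (C : numClosedFieldType) (n : nat).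
Implicit Types X h : 'M[C]_n.

Lemma mulmx1_detinv (A B : 'M[C]_n) : A *m B = 1%:M -> detinv A = B.
Proof.
move=> AB; have d0 : \det A != 0.
  by have [+ _] := mulmx1_unit AB; rewrite unitmxE unitfE.
by rewrite -[LHS]mulmx1 -AB mulmxA muldVmx // mul1mx.
Qed.

Lemma det_neq0_of_mulmx1 (A B : 'M[C]_n) : A *m B = 1%:M -> \det A != 0.
Proof. by move=> AB; have [+ _] := mulmx1_unit AB; rewrite unitmxE unitfE. Qed.

Definition cay X := (1%:M - X) *m detinv (1%:M + X).

Lemma cay0 : cay 0 = 1%:M.
Proof.
by rewrite /cay subr0 addr0 (mulmx1_detinv (B := 1%:M)) mulmx1.
Qed.

Lemma cay_sub1 X : \det (1%:M + X) != 0 -> 1%:M - cay X = 2 *: (X *m detinv (1%:M + X)).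
Proof.
move=> d0; rewrite -[X in X - _](mulmxdV d0) /cay -mulmxBl scalemxAl; congr (_ *m _).
by rewrite opprB addrC addrA subrK scaler_nat mulr2n.
Qed.

Lemma cay_add1 X : \det (1%:M + X) != 0 -> 1%:M + cay X = 2 *: detinv (1%:M + X).
Proof.
move=> d0; rewrite -[X in X + _](mulmxdV d0) /cay -mulmxDl.
have -> : 1%:M + X + (1%:M - X) = 2 *: 1%:M.
  by apply/matrixP => i j; rewrite !mxE; ring.
by rewrite -scalemxAl mul1mx.
Qed.

Lemma cay_inverse X : \det (1%:M + X) != 0 ->
  (1%:M + cay X) *m (2^-1 *: (1%:M + X)) = 1%:M.
Proof.
move=> d0; rewrite cay_add1 // -scalemxAl -scalemxAr scalerA muldVmx //.
by rewrite divff ?scale1r // pnatr_eq0.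
Qed.

Lemma cayK X : \det (1%:M + X) != 0 -> cay (cay X) = X.
Proof.
move=> d0; rewrite {1}/cay (mulmx1_detinv (cay_inverse d0)) cay_sub1 //.
rewrite -scalemxAl -scalemxAr scalerA divff ?pnatr_eq0 // scale1r.
by rewrite -mulmxA muldVmx // mulmx1.
Qed.

Lemma cay_det X : \det (1%:M + X) != 0 -> \det (1%:M + cay X) != 0.
Proof. by move=> /cay_inverse/det_neq0_of_mulmx1. Qed.

Lemma detinv_comm (P Q : 'M[C]_n) : \det P != 0 -> P *m Q = Q *m P ->
  detinv P *m Q = Q *m detinv P.
Proof.
move=> d0 PQ; rewrite -[LHS]mulmx1 -(mulmxdV d0) mulmxA -(mulmxA _ Q) -PQ.
by rewrite mulmxA muldVmx // mul1mx.
Qed.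

Lemma cay_comm X Q : \det (1%:M + X) != 0 -> X *m Q = Q *m X -> cay X *m Q = Q *m cay X.
Proof.
move=> d0 XQ; rewrite /cay -mulmxA detinv_comm //.
  by rewrite !mulmxA mulmxBl mul1mx XQ -[X in X - _]mulmx1 -mulmxBr.
by rewrite mulmxDl mulmxDr mul1mx mulmx1 XQ.
Qed.

(** [1%:M + X] is invertible and preserves the span of [M], so its restriction [Q] is invertible and
    the inverse preserves the span too. *)
Lemma cay_stable r (M : 'M[C]_(n, r)) X N :
  (forall k (Y : 'M[C]_(r, k)), M *m Y = 0 -> Y = 0) ->
  \det (1%:M + X) != 0 -> X *m M = M *m N -> exists g, cay X *m M = M *m g.
Proof.
move=> Mfree d0 XM; pose Q := 1%:M + N.
have PM : (1%:M + X) *m M = M *m Q.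
  by rewrite mulmxDl mul1mx XM mulmxDr mulmx1.
have [Ql QlQ] : exists Ql : 'M[C]_r, Ql *m Q = 1%:M.
  apply: mx_left_inverse => k Y QY; apply: Mfree.
  by rewrite -[M]mul1mx -(muldVmx d0) -!mulmxA [_ *m (M *m Y)]mulmxA PM -mulmxA QY !mulmx0.
have QQl := mulmx1C QlQ.
exists ((1%:M - N) *m Ql); rewrite /cay -mulmxA.
have -> : detinv (1%:M + X) *m M = M *m Ql.
  by rewrite -[LHS]mulmx1 -QQl -!mulmxA [M *m (Q *m _)]mulmxA -PM -mulmxA [detinv _ *m _]mulmxA muldVmx // mul1mx.
by rewrite !mulmxA mulmxBl mul1mx XM mulmxBr mulmx1.
Qed.

Variables (G pU : 'M[C]_n).
Hypotheses (GH : G^H = G) (Gu : G \in unitmx).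

Definition matH h := h *m pU = pU *m h /\ h^H *m G *m h = G.

Lemma matHM g h : matH g -> matH h -> matH (g *m h).
Proof.
move=> [g1 g2] [h1 h2]; split; first by rewrite -mulmxA h1 !mulmxA g1.
by rewrite ctrM -{2}h2 -{2}g2 !mulmxA.
Qed.

Lemma matH_inv h : matH h -> [/\ \det h != 0, matH (detinv h) & detinv h *m h = 1%:M].
Proof.
move=> [h1 h2]; have hl : (invmx G *m h^H *m G) *m h = 1%:M.
  by rewrite -!mulmxA [h^H *m _]mulmxA h2 mulVmx.
have d0 := det_neq0_of_mulmx1 (mulmx1C hl).
split=> //; last exact: muldVmx.
split; first by apply: detinv_comm.
rewrite -{1}h2 !mulmxA -ctrM mulmxdV // ctr1 mul1mx -mulmxA mulmxdV //.
by rewrite mulmx1.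
Qed.

(** Skewness of [G *m X] says that the adjoint of [1%:M - X] for the form is [1%:M + X]; the two
    commute, so the factors cancel. *)
Lemma lieH_cay X : lieH G pU X -> \det (1%:M + X) != 0 -> matH (cay X).
Proof.
move=> [Xp Xs] d0; split; first exact: cay_comm.
have XG : X^H *m G = - (G *m X) by rewrite -Xs ctrM GH.
have PN : (1%:M + X) *m (1%:M - X) = (1%:M - X) *m (1%:M + X).
  rewrite !(mulmxDl, mulmxDr, mulmxN, mulNmx, mul1mx, mulmx1).
  by move: (X *m X) => Y; apply/matrixP => i j; rewrite !mxE; ring.
rewrite /cay ctrM.
have -> : (1%:M - X)^H = G *m (1%:M + X) *m invmx G.
  rewrite ctrB ctr1; apply: (canRL (mulmxK Gu)).
  by rewrite mulmxBl mul1mx XG opprK mulmxDr mulmx1.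
have -> : (detinv (1%:M + X))^H *m (G *m (1%:M + X) *m invmx G) *m G *m
    ((1%:M - X) *m detinv (1%:M + X)) =
    (detinv (1%:M + X))^H *m (G *m ((1%:M + X) *m (1%:M - X)) *m detinv (1%:M + X)).
  by rewrite -!mulmxA mulKmx.
rewrite PN -!mulmxA mulmxdV // mulmx1.
have -> : G *m (1%:M - X) = (1%:M + X)^H *m G.
  by rewrite ctrD ctr1 mulmxDl mul1mx XG mulmxBr mulmx1.
by rewrite mulmxA -ctrM mulmxdV // ctr1 mul1mx.
Qed.

Lemma matH_cay h : matH h -> \det (1%:M + h) != 0 -> lieH G pU (cay h).
Proof.
move=> [hp hG] d0; split; first exact: cay_comm.
have key : (1%:M - h)^H *m G *m (1%:M + h) = - ((1%:M + h)^H *m G *m (1%:M - h)).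
  rewrite ctrB ctrD ctr1 !(mulmxDl, mulmxDr, mulmxN, mulNmx, mul1mx, mulmx1) hG.
  by apply/matrixP => i j; rewrite !mxE; ring.
have D : (detinv (1%:M + h))^H *m (1%:M + h)^H = 1%:M.
  by rewrite -ctrM mulmxdV // ctr1.
have Qu : 1%:M + h \in unitmx by rewrite unitmxE unitfE.
apply: (can_inj (mulmxK Qu)); rewrite ctrM GH /cay ctrM mulNmx -!mulmxA muldVmx // mulmx1.
by rewrite [(1%:M - h)^H *m _]mulmxA key mulmxN !mulmxA D mul1mx.
Qed.

End Cayley.

(** * Charts of the stabilizer *)

Section StabilizerChart.
Set Implicit Arguments.
Unset Strict Implicit.
Variables (R : realType) (Cf : complexField R) (n r : nat).
Notation C := (ccarrier Cf).
Notation cplx := (@cplx R Cf _ _).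
Variables (G pU : 'M[C]_n) (M : 'M[C]_(n, r)).
Hypotheses (GH : G^H = G) (Gu : G \in unitmx).
Hypothesis Mfree : forall k (Y : 'M[C]_(r, k)), M *m Y = 0 -> Y = 0.

Definition stabH (h : 'M[C]_n) := matH G pU h /\ exists g : 'M[C]_r, h *m M = M *m g.

Lemma stabH_mul h k : stabH h -> stabH k -> stabH (h *m k).
Proof.
move=> [hh [a ha]] [hk [b hb]]; split; first exact: matHM.
by exists (a *m b); rewrite -mulmxA hb mulmxA ha mulmxA.
Qed.

Lemma stabH_inv h : stabH h -> stabH (detinv h).
Proof.
move=> [hh [a ha]]; have [d0 hi hh1] := matH_inv Gu hh; split=> //.
have [al ala] : exists al : 'M[C]_r, al *m a = 1%:M.
  apply: mx_left_inverse => k Y aY; apply: Mfree.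
  by rewrite -[M]mul1mx -hh1 -!mulmxA [h *m _]mulmxA ha -mulmxA aY !mulmx0.
exists al; have aal := mulmx1C ala.
by rewrite -[LHS]mulmx1 -aal -!mulmxA [M *m (a *m _)]mulmxA -ha -mulmxA
  [detinv _ *m _]mulmxA hh1 mul1mx.
Qed.

Lemma stabH_cay X : lieHS G pU M X -> \det (1%:M + X) != 0 -> stabH (cay X).
Proof.
move=> [hX [N XM]] d0; split; first exact: lieH_cay.
exact: cay_stable XM.
Qed.

Lemma cay_stabH h : stabH h -> \det (1%:M + h) != 0 -> lieHS G pU M (cay h).
Proof.
move=> [hh [a ha]] d0; split; first exact: matH_cay.
exact: cay_stable ha.
Qed.

(** The Cayley chart at the identity is translated by [h0]. Both domains are given by invertibility
    of the denominator, a condition that [cay] preserves, so they correspond exactly. *)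
Lemma stabH_submanifold d :
  rdim (lieHS G pU M) d -> submanifold d [set z | stabH (cplx z)].
Proof.
move=> [V VE <-] z0 /= S0; set h0 := cplx z0 in S0.
have [f [p [pf fV fp]]] := vspace_coordinates V.
have [d0 _ h01] := matH_inv Gu S0.1; have S0' := stabH_inv S0.
have h10 := mulmx1C h01.
pose X (v : 'rV[R]_(\dim V)) := cplx (f v).
have XL v : lieHS G pU M (X v) by apply/VE.
pose D := [set v : 'rV[R]_(\dim V) | setT v /\ \det (1%:M + X v) != 0].
pose Om := [set z : 'M[R]_n * 'M[R]_n | setT z /\ \det (1%:M + detinv h0 *m cplx z) != 0].
have rX A : mxrational A (fun v => 1%:M + X v).
  by apply: mxrational_add; [exact: mxrational_cst|exact: mxrational_linear].
have oD : open D by apply: open_neq0; [exact: openT|exact: crational_det].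
have rh (A : set ('M[R]_n * 'M[R]_n)) :
    mxrational A (fun z => detinv h0 *m (cplx z : 'M[C]_n)).
  by apply: mxrational_mul; [exact: mxrational_cst|exact: mxrational_cplx].
have rh1 (A : set ('M[R]_n * 'M[R]_n)) :
    mxrational A (fun z => 1%:M + detinv h0 *m (cplx z : 'M[C]_n)).
  by apply: mxrational_add; [exact: mxrational_cst|exact: rh].
have oOm : open Om by apply: open_neq0; [exact: openT|exact: crational_det].
exists Om, D, (fun v => rcplx (h0 *m cay (X v))),
  (fun z => p (rcplx (cay (detinv h0 *m cplx z)))).
split; first split=> //.
  by split=> //; rewrite -/h0 h01 -raddfD det_scalar expf_neq0 //.
have rsub (E : normedModType R) (A : set E) (F : E -> 'M[C]_n) :
    mxrational A F -> mxrational A (fun x => 1%:M - F x).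
  by move=> rF; apply: mxrational_add; [exact: mxrational_cst|exact: mxrational_opp].
split.
- apply: mxrational_smooth => //; apply: mxrational_mul; first exact: mxrational_cst.
  apply: mxrational_mul; last by apply: mxrational_inv => // v [].
  exact/rsub/mxrational_linear.
- move=> k; apply: Ck_on_mx => // i j; rewrite ord1.
  have [l lE] := linear_to_rV_coord p j.
  have -> : (fun z => p (rcplx (cay (detinv h0 *m cplx z))) 0 j) =
     (fun z => l (rcplx (cay (detinv h0 *m cplx z)))) by apply/funext => z; rewrite lE.
  apply: rational_Ck => //; apply: rational_functional.
  apply: mxrational_mul; last by apply: mxrational_inv => // z [].
  exact/rsub/rh.
- rewrite eqEsubset; split=> [_ [v [_ dv] <-]|z [/= Sz [_ dz]]].
    split=> /=; first by rewrite rcplxK; apply/stabH_mul/stabH_cay.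
    by split=> //; rewrite rcplxK mulmxA h01 mul1mx; exact: cay_det.
  have Sh := stabH_mul S0' Sz.
  have := cay_stabH Sh dz; set Y := cay _ => LY.
  have YE : X (p (rcplx Y)) = Y.
    by rewrite /X fp ?rcplxK //; apply/VE; rewrite rcplxK.
  exists (p (rcplx Y)); first by split=> //; rewrite YE; exact: cay_det.
  by rewrite YE /Y cayK // mulmxA h10 mul1mx cplxK.
- move=> v [_ dv]; rewrite rcplxK mulmxA h01 mul1mx cayK //.
  by rewrite /X cplxK pf.
Qed.

End StabilizerChart.

(** * Frames and coordinates in a chart of the Grassmannian *)

Section FrameAlgebra.
Set Implicit Arguments.
Unset Strict Implicit.
Variables (C : numClosedFieldType) (n r s : nat).
Implicit Types (G p h : 'M[C]_n) (M Y : 'M[C]_(n, r)).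

Lemma form_addE G p M Y : (M + Y)^H *m G *m p *m (M + Y) =
  M^H *m G *m p *m M + (M^H *m G *m p *m Y + Y^H *m G *m p *m M + Y^H *m G *m p *m Y).
Proof.
rewrite ctrD !mulmxDl !mulmxDr.
move: (M^H *m G *m p *m M) (M^H *m G *m p *m Y) (Y^H *m G *m p *m M) (Y^H *m G *m p *m Y).
by move=> a b c d; rewrite !addrA.
Qed.

Lemma form_transport G p h M (g : 'M[C]_r) : h^H *m G *m h = G -> h *m p = p *m h ->
  (h *m M *m g)^H *m G *m p *m (h *m M *m g) = g^H *m (M^H *m G *m p *m M) *m g.
Proof.
move=> hG hp; rewrite !ctrM -!mulmxA [p *m (h *m _)]mulmxA -hp.
by rewrite -!mulmxA [G *m (h *m _)]mulmxA [h^H *m _]mulmxA [h^H *m (G *m h)]mulmxA hG !mulmxA.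
Qed.

Lemma rank_equiv k (D D' : 'M[C]_(k, r)) (h h' : 'M[C]_k) (g g' : 'M[C]_r) :
  D' = h *m D *m g -> h' *m h = 1%:M -> g *m g' = 1%:M -> \rank D' = \rank D.
Proof.
move=> -> hh gg; rewrite mxrankMfree; last by apply/row_freeP; exists g'.
apply/eqP; rewrite eqn_leq mxrankM_maxr /=.
by rewrite -[X in (\rank X <= _)%N]mul1mx -hh -mulmxA mxrankM_maxr.
Qed.

Section Frame.
Variables (A M : 'M[C]_(n, r)) (C0 : 'M[C]_(n, s)) (Z0 : 'M[C]_(s, r)).
Variables (A1 : 'M[C]_(r, n)) (C1 : 'M[C]_(s, n)).
Hypothesis ME : M = A + C0 *m Z0.
Hypotheses (A1M : A1 *m M = 1%:M) (A1C : A1 *m C0 = 0) (C1M : C1 *m M = 0)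
  (C1C : C1 *m C0 = 1%:M) (resolution : M *m A1 + C0 *m C1 = 1%:M).

Lemma frame_free k (Y : 'M[C]_(r, k)) : M *m Y = 0 -> Y = 0.
Proof. by move=> h; rewrite -[Y]mul1mx -A1M -mulmxA h mulmx0. Qed.

Lemma frameE Z : A + C0 *m Z = M + C0 *m (Z - Z0).
Proof. by rewrite ME mulmxBr -addrA [C0 *m Z0 + _]addrC subrK. Qed.

Lemma frame_coef_unit Z h (g : 'M[C]_r) : A + C0 *m Z = h *m M *m g ->
  exists g', g *m g' = 1%:M.
Proof.
move=> hg; have e : A1 *m h *m M *m g = 1%:M.
  by rewrite -!mulmxA [h *m _]mulmxA -hg frameE [A1 *m _]mulmxDr A1M mulmxA A1C mul0mx addr0.
by exists (A1 *m h *m M); apply: mulmx1C.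
Qed.

Lemma frame_coordinate (X : 'M[C]_n) z (N : 'M[C]_r) : X *m M = C0 *m z + M *m N ->
  C1 *m X *m M = z.
Proof. by move=> h; rewrite -mulmxA h mulmxDr !mulmxA C1C C1M mul1mx mul0mx addr0. Qed.

Lemma frame_stable (X : 'M[C]_n) : C1 *m X *m M = 0 -> X *m M = M *m (A1 *m X *m M).
Proof.
move=> h; rewrite -[LHS]mul1mx -resolution mulmxDl -!mulmxA.
by rewrite [C1 *m _]mulmxA h mulmx0 addr0.
Qed.

(** [w] renormalizes the moved frame so that its [A1]-component is the identity; its [C1]-component
    is then the displacement from [Z0] in the chart. *)
Lemma frame_moved h (w : 'M[C]_r) : A1 *m h *m M *m w = 1%:M ->
  A + C0 *m (Z0 + C1 *m h *m M *m w) = h *m M *m w.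
Proof.
move=> e; rewrite frameE addrAC subrr add0r -[RHS]mul1mx -resolution mulmxDl -!mulmxA.
by congr (_ + _); move: e; rewrite -!mulmxA => ->; rewrite mulmx1.
Qed.

(** Since [C1] kills [M], [cay X] may be replaced by [cay X - 1%:M], which has an explicit factor
    [X]. The derivative at 0 is then found without differentiating the inverse. *)
Lemma cay_coordinate (X : 'M[C]_n) : \det (1%:M + X) != 0 ->
  C1 *m X *m (detinv (1%:M + X) *m ((- 2) *: M)) = C1 *m cay X *m M.
Proof.
move=> d1; have : C1 *m (1%:M - cay X) *m M = - (C1 *m cay X *m M).
  by rewrite mulmxBr mulmxBl mulmx1 C1M sub0r.
rewrite cay_sub1 // => /(congr1 -%R); rewrite opprK => <-.
move: (detinv _) => D.
by rewrite -!scalemxAr -!scalemxAl !mulmxA scaleNr.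
Qed.

End Frame.
End FrameAlgebra.

(** * Charts of the orbit *)

Section OrbitChartAt.
Set Implicit Arguments.
Unset Strict Implicit.
Variables (R : realType) (Cf : complexField R) (n r s : nat).
Notation C := (ccarrier Cf).
Notation cplx := (@cplx R Cf _ _).
Notation E m n := ('M[R]_(m, n) * 'M[R]_(m, n))%type.
Variables (G pU pW : 'M[C]_n).
Hypothesis sp : ortho_split G pU pW.
(* (A1; C1) is the inverse of (M | C0), where M is the frame of the base point Z0
   in the chart Z |-> A + C0 *m Z of the Grassmannian. *)
Variables (A : 'M[C]_(n, r)) (C0 : 'M[C]_(n, s)) (Z0 : 'M[C]_(s, r)).
Variables (A1 : 'M[C]_(r, n)) (C1 : 'M[C]_(s, n)) (M : 'M[C]_(n, r)).
Hypothesis ME : M = A + C0 *m Z0.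
Hypotheses (A1M : A1 *m M = 1%:M) (A1C : A1 *m C0 = 0) (C1M : C1 *m M = 0)
  (C1C : C1 *m C0 = 1%:M) (resolution : M *m A1 + C0 *m C1 = 1%:M).
Hypothesis Miso : M^H *m G *m M = 0.

Definition orbitZ (Z : 'M[C]_(s, r)) :=
  exists h g, matH G pU h /\ A + C0 *m Z = h *m M *m g.

Let GH : G^H = G. Proof. by case: sp. Qed.
Let Gu : G \in unitmx. Proof. by case: sp. Qed.

Lemma orbitZ_unit Z : orbitZ Z -> exists h g g',
  [/\ matH G pU h, A + C0 *m Z = h *m M *m g & g *m g' = 1%:M].
Proof.
move=> [h [g [hh hg]]]; have [g' gg] := frame_coef_unit ME A1M A1C hg.
by exists h, g, g'.
Qed.

Section RankEquation.
Variables (k l : nat) (D : 'M[C]_(k, l)) (J : 'M[C]_(l, k)).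
Hypotheses (DJD : D *m J *m D = D) (JDJ : J *m D *m J = J).
Variables (F : normedModType R) (O : set F) (x : F) (Del L : F -> 'M[C]_(k, l)).
Hypotheses (rDel : mxrational setT Del) (sDel : mxsdiff Del x L) (Del0 : Del x = 0).
Hypothesis rkO : forall y, O y -> \rank (D + Del y)%R = \rank D.

(** [schur_complement_eq0] provides the equation. Multiplying by [1%:M - D *m J] removes [D] and
    leaves a product with factor [Del], zero at [x], so the derivative of the inverse drops out. *)
Lemma tangent_bound_rank :
  tangent_bound O x (fun z => (1%:M - D *m J) *m L z *m (1%:M - J *m D) = 0).
Proof.
pose B := [set y | setT y /\ \det (1%:M + J *m Del y) != 0].
have rP : mxrational setT (fun y => 1%:M + J *m Del y).
  apply: mxrational_add; first exact: mxrational_cst.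
  by apply: mxrational_mul; first exact: mxrational_cst.
have oB : open B by apply: open_neq0; [exact: openT|exact: crational_det].
have Bx : B x by split=> //; rewrite Del0 mulmx0 addr0 det1 oner_eq0.
pose Y y := detinv (1%:M + J *m Del y) *m (1%:M - J *m D).
have rY : mxrational B Y.
  apply: mxrational_mul; last exact: mxrational_cst.
  apply: mxrational_inv => [i j|y []] //.
  by have [h1 h2] := rP i j; split; [exact: rational_sub h1|exact: rational_sub h2].
have [K hK] := mxrational_sdiff Bx rY.
have hF := mxsdiff_mul (mxsdiff_mul (mxsdiff_cst (1%:M - D *m J) x) sDel) hK.
have e0 : (1%:M - D *m J) *m Del x = 0 by rewrite Del0 mulmx0.
have Yx : Y x = 1%:M - J *m D.
  by rewrite /Y Del0 mulmx0 addr0 (mulmx1_detinv (mulmx1 _)) mul1mx.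
apply: tangent_bound_sub (tangent_bound_mx hF _) => [z|].
  by rewrite e0 Yx mul0mx mul0mx add0r addr0.
apply: filterS (open_nbhs_nbhs (conj oB Bx)) => y [_ dy] Oy.
have key : (D + Del y) *m Y y = 0.
  have DE : Del y = D + Del y - D by rewrite addrAC subrr add0r.
  rewrite /Y [in detinv _]DE; apply: schur_complement_eq0 => //; last exact: rkO.
  by rewrite -DE.
have -> : (1%:M - D *m J) *m Del y = (1%:M - D *m J) *m (D + Del y).
  by rewrite mulmxDr [(_ - _) *m D]mulmxBl mul1mx DJD subrr add0r.
by rewrite -mulmxA key mulmx0.
Qed.

End RankEquation.

Variable z0 : E s r.
Hypothesis z0E : z0 = rcplx Z0.
Let O : set (E s r) := [set z | orbitZ (cplx z)].
Let Del (z : E s r) : 'M[C]_(n, r) := C0 *m (cplx z - Z0).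
Let L (z : E s r) : 'M[C]_(n, r) := C0 *m cplx z.

Lemma mxsdiff_Del : mxsdiff Del z0 L.
Proof.
have := mxsdiff_mul (mxsdiff_cst C0 z0) (mxsdiff_add (mxsdiff_cplx z0) (mxsdiff_cst (- Z0) z0)).
by apply: mxsdiff_ext => v //=; rewrite mul0mx !addr0.
Qed.

Lemma mxrational_Del B : mxrational B Del.
Proof.
apply: mxrational_mul; first exact: mxrational_cst.
by apply: mxrational_add; [exact: mxrational_cplx|exact: mxrational_cst].
Qed.

Lemma Del0 : Del z0 = 0.
Proof. by rewrite /Del z0E rcplxK subrr mulmx0. Qed.

Let beta := M^H *m G *m pU *m M.
Let gam (p : 'M[C]_n) (Y : 'M[C]_(n, r)) := M^H *m G *m p *m Y + Y^H *m G *m p *m M.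

Let Gform (p : 'M[C]_n) (z : E s r) := gam p (Del z) + (Del z)^H *m G *m p *m Del z.

Lemma GformE (p : 'M[C]_n) z : (A + C0 *m cplx z)^H *m G *m p *m (A + C0 *m cplx z) =
  M^H *m G *m p *m M + Gform p z.
Proof.
by rewrite (frameE ME) -/(Del z) form_addE.
Qed.

Lemma mxsdiff_Gform p : mxsdiff (Gform p) z0 (fun z => gam p (L z)).
Proof.
have hD := mxsdiff_Del; have hC := mxsdiff_ctr hD.
have c1 := mxsdiff_mul (mxsdiff_cst (M^H *m G *m p) z0) hD.
have c2 := mxsdiff_mul (mxsdiff_mul hC (mxsdiff_cst (G *m p) z0)) (mxsdiff_cst M z0).
have c3 := mxsdiff_mul (mxsdiff_mul hC (mxsdiff_cst (G *m p) z0)) hD.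
apply: mxsdiff_ext (mxsdiff_add (mxsdiff_add c1 c2) c3) => z.
  by rewrite /Gform /gam !mulmxA.
by rewrite Del0 ctr0 !mulmx0 !mul0mx !add0r !addr0 /gam !mulmxA.
Qed.

Lemma mxrational_Gform p B : mxrational B (Gform p).
Proof.
have rD := @mxrational_Del B; have rC := mxrational_ctr rD.
apply: mxrational_add; first apply: mxrational_add.
- by apply: mxrational_mul => //; exact: mxrational_cst.
- by do 3![apply: mxrational_mul => //; last exact: mxrational_cst].
- apply: mxrational_mul => //.
  by do 2![apply: mxrational_mul => //; last exact: mxrational_cst].
Qed.

Lemma Gform0 p : Gform p z0 = 0.
Proof. by rewrite /Gform /gam Del0 ctr0 !mulmx0 !mul0mx !addr0. Qed.

Variables (JU JW : 'M[C]_(r, n)) (J : 'M[C]_r).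
Hypotheses (DUJ : pU *m M *m JU *m (pU *m M) = pU *m M)
  (JUD : JU *m (pU *m M) *m JU = JU).
Hypotheses (DWJ : pW *m M *m JW *m (pW *m M) = pW *m M)
  (JWD : JW *m (pW *m M) *m JW = JW).
Hypotheses (bJb : beta *m J *m beta = beta) (JbJ : J *m beta *m J = J) (JH : J^H = J).

Lemma matH_commW h : matH G pU h -> h *m pW = pW *m h.
Proof.
move=> [hp _]; have [_ _ pUW _ _] := sp.
by rewrite -[pW](addrK pU) [pW + pU]addrC pUW mulmxBl mulmxBr mul1mx mulmx1 hp.
Qed.

Lemma tangent_bound_U :
  tangent_bound O z0 (fun z => (1%:M - pU *m M *m JU) *m (pU *m L z) *m (1%:M - JU *m (pU *m M)) = 0).
Proof.
apply: (tangent_bound_rank DUJ JUD (Del := fun z => pU *m Del z)).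
- by apply: mxrational_mul; [exact: mxrational_cst|exact: mxrational_Del].
- have := mxsdiff_mul (mxsdiff_cst pU z0) mxsdiff_Del.
  by apply: mxsdiff_ext => v //=; rewrite mul0mx addr0.
- by rewrite Del0 mulmx0.
- move=> z /orbitZ_unit[h [g [g' [hh hg gg]]]].
  have [_ _ hih] := matH_inv Gu hh.
  apply: rank_equiv hih gg; rewrite -mulmxDr -(frameE ME) hg !mulmxA.
  by have [-> _] := hh.
Qed.

Lemma tangent_bound_W :
  tangent_bound O z0 (fun z => (1%:M - pW *m M *m JW) *m (pW *m L z) *m (1%:M - JW *m (pW *m M)) = 0).
Proof.
apply: (tangent_bound_rank DWJ JWD (Del := fun z => pW *m Del z)).
- by apply: mxrational_mul; [exact: mxrational_cst|exact: mxrational_Del].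
- have := mxsdiff_mul (mxsdiff_cst pW z0) mxsdiff_Del.
  by apply: mxsdiff_ext => v //=; rewrite mul0mx addr0.
- by rewrite Del0 mulmx0.
- move=> z /orbitZ_unit[h [g [g' [hh hg gg]]]].
  have [_ _ hih] := matH_inv Gu hh.
  apply: rank_equiv hih gg; rewrite -mulmxDr -(frameE ME) hg !mulmxA.
  by rewrite matH_commW.
Qed.

Lemma tangent_bound_beta :
  tangent_bound O z0 (fun z => (1%:M - beta *m J) *m gam pU (L z) *m (1%:M - J *m beta) = 0).
Proof.
apply: (tangent_bound_rank bJb JbJ (Del := Gform pU)).
- exact: mxrational_Gform.
- exact: mxsdiff_Gform.
- exact: Gform0.
- move=> z /orbitZ_unit[h [g [g' [hh hg gg]]]].
  have [hp hG] := hh; rewrite /beta -GformE hg form_transport //.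
  have gg2 : g'^H *m g^H = 1%:M by rewrite -ctrM gg ctr1.
  exact: rank_equiv gg2 gg.
Qed.

Lemma tangent_bound_iso : tangent_bound O z0 (fun z => gam 1%:M (L z) = 0).
Proof.
have key z : O z -> Gform 1%:M z = 0; last first.
  by apply: tangent_bound_mx (mxsdiff_Gform 1%:M) _; near=> z; exact: key.
move=> /orbitZ_unit[h [g [g' [hh hg gg]]]].
have [_ hG] := hh; have := GformE 1%:M z.
by rewrite hg form_transport ?mulmx1 ?mul1mx // Miso mulmx0 mul0mx add0r.
Unshelve. all: by end_near. Qed.

Theorem orbit_chart_at dH dS dO :
  rdim (lieH G pU) dH -> rdim (lieHS G pU M) dS -> (dS + dO)%N = dH ->
  chart_at dO O z0.
Proof.
move=> [VH VHE dVH] [VS VSE dVS] dE.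
have sVS : (VS <= VH)%VS by apply/subvP => z /VSE[hz _]; apply/VHE.
(* The directions along the stabilizer do not move S; any complement of them parametrizes the
   orbit. *)
pose Vm := (VH :\: VS)%VS.
have dVm : \dim Vm = dO.
  have := dimv_cap_compl VH VS; rewrite (capv_idPr sVS) dVH dVS -dE.
  by move/eqP; rewrite eqn_add2l => /eqP.
have mS0 z : z \in Vm -> z \in VS -> z = 0.
  by move=> zm zs; apply/eqP; rewrite -memv0 -(capv_diff VH VS) memv_cap zm zs.
have mS z : z \in VH -> exists2 y, y \in Vm & z - y \in VS.
  rewrite -(addv_diff_cap VH VS) => /memv_addP[y ym [w + ->]].
  by rewrite memv_cap => /andP[_ ws]; exists y => //; rewrite addrAC subrr add0r.
rewrite -dVm.
have [f [q [qf fV fq]]] := vspace_coordinates Vm.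
pose X (v : 'rV[R]_(\dim Vm)) : 'M[C]_n := cplx (f v).
have XH v : lieH G pU (X v).
  by apply/VHE; have := fV v; rewrite -(addv_diff_cap VH VS); apply/subvP/addvSl.
have rX B : mxrational B X by exact: mxrational_linear.
have X0 : X 0 = 0 by rewrite /X linear0 cplx0.
pose B1 := [set v : 'rV[R]_(\dim Vm) | setT v /\ \det (1%:M + X v) != 0].
have r1X B : mxrational B (fun v => 1%:M + X v).
  by apply: mxrational_add; first exact: mxrational_cst.
have oB1 : open B1 by apply: open_neq0; [exact: openT|exact: crational_det].
have rinv B : B `<=` B1 -> mxrational B (fun v => detinv (1%:M + X v)).
  by move=> BB; apply: mxrational_inv => // v /BB [].
have rcay B : B `<=` B1 -> mxrational B (fun v => A1 *m cay (X v) *m M).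
  move=> BB; apply: mxrational_mul; last exact: mxrational_cst.
  apply: mxrational_mul; first exact: mxrational_cst.
  apply: mxrational_mul; last exact: rinv.
  by apply: mxrational_add; [exact: mxrational_cst|exact: mxrational_opp].
pose B2 := [set v | B1 v /\ \det (A1 *m cay (X v) *m M) != 0].
have oB2 : open B2 by apply: open_neq0 => //; apply/crational_det/rcay.
have B21 : B2 `<=` B1 by move=> v [].
have B20 : B2 0.
  split; first by split=> //; rewrite X0 addr0 det1 oner_eq0.
  by rewrite X0 cay0 mulmx1 A1M det1 oner_eq0.
(* The last factor brings the moved frame back to the chart. Keeping [X v] outside [Y] lets the
   derivative of [P] at 0 be computed with [Y] frozen at [Y 0]. *)
pose Y v := detinv (1%:M + X v) *m ((- 2) *: M) *m detinv (A1 *m cay (X v) *m M).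
have rY : mxrational B2 Y.
  apply: mxrational_mul; first by apply: mxrational_mul; [exact: rinv|exact: mxrational_cst].
  by apply: mxrational_inv => [|v []] //; exact: rcay.
pose P v := C1 *m X v *m Y v.
have rP : mxrational B2 P.
  by apply: mxrational_mul => //; apply: mxrational_mul; first exact: mxrational_cst.
have PE v : B2 v -> P v = C1 *m cay (X v) *m M *m detinv (A1 *m cay (X v) *m M).
  by move=> [[_ d1] _]; rewrite /P /Y mulmxA (cay_coordinate C1M d1).
have sP : mxsdiff P 0 (fun v => (- 2) *: (C1 *m X v *m M)).
  have [K hK] := mxrational_sdiff B20 rY.
  have hX : mxsdiff X 0 X by exact: mxsdiff_linear.
  have := mxsdiff_mul (mxsdiff_mul (mxsdiff_cst C1 0) hX) hK.
  apply: mxsdiff_ext => v //=; rewrite X0 mulmx0 !mul0mx add0r addr0.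
  rewrite /Y X0 addr0 cay0 mulmx1 A1M !(mulmx1_detinv (mulmx1 _)) mul1mx mulmx1.
  by rewrite -scalemxAr.
have [L1 L1E] : exists L1 : {linear 'rV[R]_(\dim Vm) -> E s r},
    forall v, L1 v = rcplx ((- 2) *: (C1 *m X v *m M)).
  apply: (@linear_pack R 'rV[R]_(\dim Vm) (E s r) _) => a u v.
  rewrite -rcplxP; congr rcplx; rewrite /X linearP cplxP.
  rewrite mulmxDr mulmxDl scalerDr -!scalemxAr -!scalemxAl.
  by rewrite scalerA mulrC -scalerA.
(* Immersion: a direction that does not move S lies in the Lie algebra of the stabilizer, which
   meets the complement in 0. *)
have XS v : C1 *m X v *m M = 0 -> v = 0.
  move=> h; have : lieHS G pU M (X v).
    by split=> //; exists (A1 *m X v *m M); exact: (frame_stable resolution).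
  move=> /VSE fS; have fv0 := mS0 _ (fV v) fS.
  by rewrite -[v]qf fv0 linear0.
have k0 : lker (linfun L1) == 0%VS.
  apply/lker0P => u v; rewrite !lfunE /= => uv; apply/subr0_eq/XS.
  have : L1 (u - v) = 0 by rewrite linearB /= uv subrr.
  rewrite L1E => /(congr1 cplx); rewrite rcplxK cplx0 => /eqP.
  by rewrite scaler_eq0 oppr_eq0 pnatr_eq0 /= => /eqP.
have [p pE] : exists p : {linear E s r -> 'rV[R]_(\dim Vm)}, forall v, p (L1 v) = v.
  have [p pE] := @linear_pack R (E s r) 'rV[R]_(\dim Vm) _ (linearP ((linfun L1)^-1)%VF).
  by exists p => v; rewrite pE; have := lker0_lfunK k0 v; rewrite lfunE.
pose Q z := gam 1%:M (L z) = 0 /\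
  ((1%:M - pU *m M *m JU) *m (pU *m L z) *m (1%:M - JU *m (pU *m M)) = 0 /\
   ((1%:M - pW *m M *m JW) *m (pW *m L z) *m (1%:M - JW *m (pW *m M)) = 0 /\
    (1%:M - beta *m J) *m gam pU (L z) *m (1%:M - J *m beta) = 0)).
have tQ : tangent_bound O z0 Q.
  apply: tangent_bound_and tangent_bound_iso _.
  apply: tangent_bound_and tangent_bound_U _.
  exact: tangent_bound_and tangent_bound_W tangent_bound_beta.
(* [z] comes from some [X'] in the Lie algebra. Its component [y] in the complement induces the same
   displacement, so [z] lies in the image of [L1], where [p] is injective; [- 2^-1] cancels the -2
   of the differential of [cay]. *)
have Qp z : Q z -> p z = 0 -> z = 0.
  move=> [h1 [h2 [h3 h4]]] pz.
  have [X' hX' [N XN]] : exists2 X, lieH G pU X & exists N, X *m M = L z + M *m N.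
    apply: (lieH_tangent sp (erefl _) (erefl _) DUJ DWJ (erefl _) (erefl _) (erefl _)
      (frame_free A1M) Miso JH bJb) => //.
    by move: h1; rewrite /gam !mulmx1.
  have zX := frame_coordinate C1M C1C XN.
  have [|y ym yS] := mS (rcplx X'); first by apply/VHE; rewrite rcplxK.
  have /VSE[_ [N' hN']] := yS.
  have cy : cplx (rcplx X' - y) = X' - cplx y.
    by rewrite cplxB rcplxK.
  have zy : cplx z = C1 *m cplx y *m M.
    apply/eqP; rewrite -zX -subr_eq0 -mulmxBl -mulmxBr -cy -mulmxA hN' mulmxA C1M.
    by rewrite mul0mx.
  have zL : z = L1 (- 2^-1 *: q y).
    rewrite L1E -[LHS](@cplxK R Cf) zy; congr rcplx.
    have -> : X (- 2^-1 *: q y) = toC (- 2^-1) *: cplx y.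
      by rewrite /X linearZ /= fq // -[_ *: y]addr0 cplxP cplx0 addr0.
    rewrite -scalemxAr -scalemxAl scalerA.
    by rewrite -toC_N2 toCM mulrNN divff ?pnatr_eq0 // toC1 scale1r.
  by move: pz; rewrite {1}zL pE => e; rewrite zL e linear0.
apply: (@orbit_chart R s r _ O z0 B2 (fun v => rcplx (Z0 + P v)) p Q) => //.
- by rewrite z0E /P X0 mulmx0 mul0mx addr0.
- by apply: mxrational_smooth => //; apply: mxrational_add => //; exact: mxrational_cst.
- exact: linear_to_rV_continuous.
- move=> v Bv; have [[_ d1] d2] := Bv; rewrite /O /= rcplxK.
  exists (cay (X v)), (detinv (A1 *m cay (X v) *m M)); split; first exact: lieH_cay.
  by rewrite PE //; apply: (frame_moved ME resolution); exact: mulmxdV.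
- move=> j; have [l lE] := linear_to_rV_coord p j.
  have -> : (fun v => p (rcplx (Z0 + P v)) 0 j) = (fun v => l (rcplx (Z0 + P v))).
    by apply/funext => v; rewrite lE.
  by apply: rational_functional; apply: mxrational_add => //; exact: mxrational_cst.
- move=> j; have [l lE] := linear_to_rV_coord p j.
  have := sdiff_functional l (mxsdiff_add (mxsdiff_cst Z0 0) sP).
  by apply: sdiff_ext => v; rewrite lE // add0r -L1E pE.
Qed.

End OrbitChartAt.

(** * Hermitian spaces *)

(* Over R[i], cspan, mact, radical, posidx and negidx are convertible to colspan,
   act, Rad, pos_index and neg_index. *)
Section ColumnSpaces.
Set Implicit Arguments.
Unset Strict Implicit.
Variables (F : fieldType) (n : nat).
Implicit Types (h : 'M[F]_n) (X : {vspace 'cV[F]_n}).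

Definition cspan r (A : 'M[F]_(n, r)) : {vspace 'cV[F]_n} :=
  limg (linfun (mulmx A : 'cV[F]_r -> 'cV[F]_n)).

Definition mact h X : {vspace 'cV[F]_n} :=
  (linfun (mulmx h : 'cV[F]_n -> 'cV[F]_n) @: X)%VS.

Lemma memv_cspan r (A : 'M[F]_(n, r)) v : v \in cspan A <-> exists c, v = A *m c.
Proof.
split=> [/memv_imgP[c _ ->]|[c ->]]; first by exists c; rewrite lfunE.
by apply/memv_imgP; exists c; rewrite ?memvf ?lfunE.
Qed.

Lemma memv_mact h X v : v \in mact h X <-> exists2 x, x \in X & v = h *m x.
Proof.
split=> [/memv_imgP[x Xx ->]|[x Xx ->]]; first by exists x; rewrite ?lfunE.
by apply/memv_imgP; exists x; rewrite ?lfunE.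
Qed.

Lemma eq_mulcV m (A B : 'M[F]_(m, n)) : (forall x : 'cV[F]_n, A *m x = B *m x) -> A = B.
Proof.
move=> AB; apply/matrixP => i j.
by have /matrixP/(_ i 0) := AB (delta_mx j 0); rewrite -!colE !mxE.
Qed.

Lemma linear_mulmx (f : 'cV[F]_n -> 'cV[F]_n) : linear f ->
  exists P : 'M[F]_n, forall x, f x = P *m x.
Proof.
move=> lf; pose fM := GRing.isLinear.Build _ _ _ _ _ lf.
pose l : {linear 'cV[F]_n -> 'cV[F]_n} := HB.pack f fM.
have [l' lE] : exists l : {linear 'cV[F]_n -> 'cV[F]_n}, forall x, l x = f x by exists l.
exists (\matrix_(i, j) l' (delta_mx j 0) i 0) => x; rewrite -lE.
have xE : x = \sum_j x j 0 *: delta_mx j 0.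
  by rewrite [LHS]matrix_sum_delta; apply: eq_bigr => j _; rewrite big_ord1.
apply/colP => i; rewrite [in LHS]xE linear_sum summxE mxE.
by apply: eq_bigr => j _; rewrite linearZ !mxE mulrC.
Qed.

Lemma cspan_mulr r k (A : 'M[F]_(n, r)) (B : 'M[F]_(r, k)) : (cspan (A *m B) <= cspan A)%VS.
Proof.
apply/subvP => v /memv_cspan[c ->]; apply/memv_cspan.
by exists (B *m c); rewrite mulmxA.
Qed.

Lemma cspan_eq_mulr r (A : 'M[F]_(n, r)) (g g' : 'M[F]_r) : g *m g' = 1%:M ->
  cspan (A *m g) = cspan A.
Proof.
move=> gg; apply/eqP; rewrite eqEsubv cspan_mulr /=.
by rewrite -{1}[A]mulmx1 -gg mulmxA cspan_mulr.
Qed.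

Lemma cspan_subP r k (A : 'M[F]_(n, r)) (B : 'M[F]_(n, k)) :
  (cspan A <= cspan B)%VS -> exists g, A = B *m g.
Proof.
move=> /subvP AB; have colA j : exists c : 'cV[F]_k, col j A = B *m c.
  by apply/memv_cspan/AB/memv_cspan; exists (delta_mx j 0); rewrite colE.
exists (\matrix_(i, j) sval (cid (colA j)) i 0); apply/matrixP => i j.
have /colP/(_ i) := svalP (cid (colA j)); rewrite !mxE => ->.
by apply: eq_bigr => l _; rewrite mxE.
Qed.

Lemma mact_cspan r h (A : 'M[F]_(n, r)) : mact h (cspan A) = cspan (h *m A).
Proof.
apply/vspaceP => v; apply/idP/idP.
  move=> /memv_mact[x /memv_cspan[c ->] ->]; apply/memv_cspan.
  by exists c; rewrite mulmxA.
move=> /memv_cspan[c ->]; apply/memv_mact; exists (A *m c); rewrite ?mulmxA //.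
by apply/memv_cspan; exists c.
Qed.

Lemma dim_cspan_free r (A : 'M[F]_(n, r)) : (forall x : 'cV[F]_r, A *m x = 0 -> x = 0) ->
  \dim (cspan A) = r.
Proof.
move=> Af; rewrite limg_dim_eq ?dimvf /dim /= ?dim_matrix ?muln1 //.
apply/eqP; rewrite -subv0; apply/subvP => x; rewrite memv_cap memv_ker lfunE /=.
by move=> /andP[_ /eqP/Af ->]; exact: mem0v.
Qed.

Lemma dim_cspan r (A : 'M[F]_(n, r)) : \dim (cspan A) = \rank A.
Proof.
have [A' hA] := row_freeP (row_base_free A).
have AE := mulmx_base A.
have CE : col_base A = A *m A'.
  by have := congr1 (mulmx^~ A') AE; rewrite -mulmxA hA mulmx1.
have <- : cspan (col_base A) = cspan A.
  apply/eqP; rewrite eqEsubv; apply/andP; split; first by have := cspan_mulr A A'; rewrite -CE.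
  by have := cspan_mulr (col_base A) (row_base A); rewrite AE.
apply: dim_cspan_free => x h.
have /row_fullP[L LA] := col_base_full A.
by rewrite -[x]mul1mx -LA -mulmxA h mulmx0.
Qed.

Lemma exists_frame r X : \dim X = r -> exists A : 'M[F]_(n, r), cspan A = X.
Proof.
move=> <-; exists (\matrix_(i, j) (vbasis X)`_j i 0).
apply/vspaceP => v; apply/idP/idP.
  move=> /memv_cspan[c ->].
  have -> : (\matrix_(i, j) (vbasis X)`_j i 0) *m c =
      \sum_(j < \dim X) c j 0 *: (vbasis X)`_j.
    apply/colP => i; rewrite mxE summxE; apply: eq_bigr => j _.
    by rewrite !mxE mulrC.
  apply: memv_suml => j _; apply: memvZ; apply: vbasis_mem.
  by rewrite mem_nth // size_tuple.
move=> Xv; apply/memv_cspan; exists (\col_j coord (vbasis X) j v).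
rewrite [LHS](coord_vbasis Xv); apply/colP => i; rewrite mxE summxE.
by apply: eq_bigr => j _; rewrite !mxE mulrC.
Qed.

Lemma frame_freeP r (A : 'M[F]_(n, r)) : \rank A = r ->
  forall k (Y : 'M[F]_(r, k)), A *m Y = 0 -> Y = 0.
Proof.
move=> /eqP/row_fullP[L LA] k Y h.
by rewrite -[Y]mul1mx -LA -mulmxA h mulmx0.
Qed.

Lemma direct_projection (U W : {vspace 'cV[F]_n}) : (U + W = fullv)%VS -> (U :&: W = 0)%VS ->
  exists pU pW : 'M[F]_n, [/\ pU + pW = 1%:M, forall x, pU *m x \in U, forall x, pW *m x \in W,
   forall x, x \in U -> pU *m x = x & forall x, x \in W -> pW *m x = x].
Proof.
move=> UW UIW.
have WIU : (W :&: U)%VS = 0%VS by rewrite capvC.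
have [pU pUE] := linear_mulmx (linearP (daddv_pi U W)).
have [pW pWE] := linear_mulmx (linearP (daddv_pi W U)).
exists pU, pW; split.
- apply: eq_mulcV => x; rewrite mul1mx mulmxDl -pUE -pWE.
  by rewrite daddv_pi_add // UW memvf.
- by move=> x; rewrite -pUE; exact: memv_pi.
- by move=> x; rewrite -pWE; exact: memv_pi.
- by move=> x Ux; rewrite -pUE; exact: daddv_pi_id.
- by move=> x Wx; rewrite -pWE; exact: daddv_pi_id.
Qed.

End ColumnSpaces.

(** * Gram matrices, radicals and Sylvester's law of inertia *)

Section HermitianForms.
Set Implicit Arguments.
Unset Strict Implicit.
Variables (C : numClosedFieldType) (n : nat).
Variable B : {hermitian_sym 'cV[C]_n for Num.conj}.
Implicit Types (X Y : {vspace 'cV[C]_n}).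

Lemma hermitian_swap x y : B x y = Num.conj (B y x).
Proof. by rewrite hermC expr0 mul1r. Qed.

Lemma form_real x : B x x \is Num.real.
Proof. by rewrite CrealE -hermitian_swap. Qed.

Lemma gram_matrix : exists2 G : 'M[C]_n, G^H = G &
  forall r s (K : 'M[C]_(n, r)) (L : 'M[C]_(n, s)) x y,
    B (L *m x) (K *m y) = (y^H *m (K^H *m G *m L) *m x) 0 0.
Proof.
(* The indices are exchanged because [B] is linear in its first argument and conjugate-linear in its
   second. *)
pose G := \matrix_(i, j) B (delta_mx j 0) (delta_mx i 0) : 'M[C]_n.
exists G; first by apply/matrixP => i j; rewrite !mxE -hermitian_swap.
have BE x y : B x y = (y^H *m G *m x) 0 0.
  have vE (v : 'cV[C]_n) : v = \sum_j v j 0 *: delta_mx j 0.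
    by rewrite [LHS]matrix_sum_delta; apply: eq_bigr => j _; rewrite big_ord1.
  rewrite [in LHS](vE x) linear_sumlz mxE; apply: eq_bigr => j _.
  rewrite linearZl_LR /= mulrC; congr (_ * _).
  rewrite [in LHS](vE y) linear_sumr mxE; apply: eq_bigr => i _.
  by rewrite linearZr_LR /= !mxE.
by move=> r s K L x y; rewrite BE ctrM !mulmxA.
Qed.

Definition radical X := (X :&: orthov B X)%VS.
Definition posdef X := forall x, x \in X -> x != 0 -> 0 < B x x.
Definition negdef X := forall x, x \in X -> x != 0 -> B x x < 0.
Definition posidx X : nat :=
  \max_(k < (\dim X).+1 |
      `[< exists Y, [/\ (Y <= X)%VS, \dim Y = k & posdef Y] >]) k.
Definition negidx X : nat :=
  \max_(k < (\dim X).+1 |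
      `[< exists Y, [/\ (Y <= X)%VS, \dim Y = k & negdef Y] >]) k.

Lemma idx_bound (P : {vspace 'cV[C]_n} -> Prop) X d :
  P 0%VS -> (forall Y, (Y <= X)%VS -> P Y -> (\dim Y <= d)%N) ->
  (exists Y, [/\ (Y <= X)%VS, \dim Y = d & P Y]) ->
  (\max_(k < (\dim X).+1 |
      `[< exists Y, [/\ (Y <= X)%VS, \dim Y = k & P Y] >]) k = d)%N.
Proof.
move=> P0 ub [Y [YX dY PY]]; apply/eqP; rewrite eqn_leq; apply/andP; split.
  by apply/bigmax_leqP => k /asboolP[Z [ZX <- PZ]]; exact: ub.
have dX : (d < (\dim X).+1)%N by rewrite ltnS -dY dimvS.
apply: (@leq_bigmax_cond _ _ (fun k : 'I_(\dim X).+1 => (k : nat)) (Ordinal dX)).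
by apply/asboolP; exists Y.
Qed.

Lemma radicalP X x : x \in radical X <-> x \in X /\ forall y, y \in X -> B x y = 0.
Proof.
rewrite /radical memv_cap; split.
  by move=> /andP[Xx /mem_orthovP h].
by move=> [Xx h]; rewrite Xx; apply/mem_orthovP.
Qed.

(** The vectors [x + y] and ['i *: x + y] show that both the sum and the difference of [B x y] and
    [B y x] vanish. *)
Lemma polarization X : (forall x, x \in X -> B x x = 0) -> radical X = X.
Proof.
move=> X0; apply/eqP; rewrite eqEsubv capvSl; apply/subvP => x Xx; apply/radicalP.
split=> // y Xy.
have h1 : B x y + B y x = 0.
  have := X0 _ (memvD Xx Xy).
  by rewrite linearDl /= !linearDr /= !X0 // add0r addr0.
have h2 : B x y - B y x = 0.
  have := X0 _ (memvD (memvZ 'i Xx) Xy).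
  rewrite linearDl /= !linearDr /= !linearZl_LR /= !linearZr_LR /= !X0 // ?mulr0 ?scaler0 ?add0r ?addr0.
  rewrite conjCi mulNr -mulrBr => /eqP; rewrite mulf_eq0 (negbTE (neq0Ci C)) /=.
  by move/eqP.
have : B x y *+ 2 = 0 by rewrite mulr2n -[RHS]addr0 -{1}h1 -h2 addrACA subrr addr0.
by move/eqP; rewrite mulrn_eq0 /= => /eqP.
Qed.

(** Induction on the dimension, splitting off a vector with [B x x != 0] and keeping its orthogonal,
    which has the same radical. Without such a vector the space is its own radical. *)
Lemma exists_signature X : exists Yp Yn,
  [/\ (Yp <= X)%VS, (Yn <= X)%VS, posdef Yp, negdef Yn &
      (\dim Yp + \dim Yn + \dim (radical X) = \dim X)%N].
Proof.
have [m] := ubnP (\dim X); elim: m X => // m IH X dX.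
case: (pselect (forall x, x \in X -> B x x = 0)) => [/polarization rX|].
  exists 0%VS, 0%VS; split; rewrite ?sub0v ?rX ?dimv0 //;
    by move=> x; rewrite memv0 => /eqP ->; rewrite eqxx.
move=> /existsNP[x /not_implyP[Xx /eqP Bx]].
have x0 : x != 0 by apply: contraNneq Bx => ->; rewrite linear0l.
pose X' := (X :&: orthov B <[x]>)%VS.
have X'P y : y \in X' <-> y \in X /\ B y x = 0.
  rewrite memv_cap mem_orthov1; split; first by move=> /andP[Xy /eqP].
  by move=> [-> /eqP].
have xX' : x \notin X' by apply/negP => /X'P[_ /eqP]; rewrite (negbTE Bx).
have XE : (<[x]> + X')%VS = X.
  apply/eqP; rewrite eqEsubv; apply/andP; split.
    by rewrite subv_add capvSl andbT -memvE.
  apply/subvP => y Xy; apply/memv_addP; exists ((B y x / B x x) *: x).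
    by apply: memvZ; exact: memv_line.
  exists (y - (B y x / B x x) *: x); last by rewrite addrC subrK.
  apply/X'P; split; first by rewrite memvB // memvZ.
  by rewrite linearBl /= linearZl_LR /= divfK // subrr.
have lineX' Y : (Y <= X')%VS -> \dim (<[x]> + Y) = (\dim Y).+1.
  move=> YX'; rewrite dimv_disjoint_sum ?dim_vline ?x0 //.
  apply/eqP; rewrite -subv0; apply/subvP => y; rewrite memv_cap memv0.
  move=> /andP[/vlineP[a ->] ax]; apply/eqP.
  have [->|a0] := eqVneq a 0; first by rewrite scale0r.
  case/negP: xX'; rewrite -[x]scale1r -(mulVf a0) -scalerA memvZ //.
  exact: subvP YX' _ ax.
have dXE : \dim X = (\dim X').+1 by rewrite -[in LHS]XE lineX'.
have radE : radical X' = radical X.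
  apply/vspaceP => y; apply/idP/idP.
    move=> /radicalP[/X'P[Xy yx] h]; apply/radicalP; split=> // z.
    rewrite -XE => /memv_addP[_ /vlineP[a ->] [w X'w ->]].
    by rewrite linearDr /= linearZr_LR /= yx mulr0 add0r; exact: h.
  move=> /radicalP[Xy h]; apply/radicalP; split.
    by apply/X'P; split=> //; exact: h.
  by move=> z /X'P[Xz _]; exact: h.
have [|Yp [Yn [YpX YnX Pp Pn dE]]] := IH X'.
  by rewrite -ltnS -dXE.
have sX' Y : (Y <= X')%VS -> (Y <= X)%VS by move=> YX'; apply: subv_trans YX' (capvSl _ _).
have form_line Y a z : (Y <= X')%VS -> z \in Y ->
    B (a *: x + z) (a *: x + z) = `|a| ^+ 2 * B x x + B z z.
  move=> YX' Yz; have [_ zx] := (X'P z).1 (subvP YX' _ Yz).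
  have xz : B x z = 0 by rewrite hermitian_swap zx conjC0.
  rewrite linearDl /= !linearDr /= !linearZl_LR /= !linearZr_LR /= xz zx !mulr0.
  rewrite addr0 add0r; congr (_ + _).
  change (a^* * (a * B x x) = `|a| * (`|a| * B x x)).
  by rewrite !mulrA -expr2 normCK [a * _]mulrC.
have lineX Y : (Y <= X')%VS -> (<[x]> + Y <= X)%VS.
  by move=> YX'; rewrite subv_add -memvE Xx sX'.
have [Bpos|Bneg] : 0 < B x x \/ B x x < 0.
  by apply/orP; rewrite -real_neqr_lt ?form_real ?real0 // eq_sym.
- exists (<[x]> + Yp)%VS, Yn; split; [exact: lineX|exact: sX'| |exact: Pn|].
    move=> y /memv_addP[_ /vlineP[a ->] [z Yz ->]] y0; rewrite (form_line _ _ _ YpX) //.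
    have [z0|z0] := eqVneq z 0.
      have a0 : a != 0 by apply: contraNneq y0 => ->; rewrite scale0r z0 addr0.
      by rewrite z0 linear0l addr0 mulr_gt0 // exprn_gt0 // normr_gt0.
    by apply: ltr_wpDl; [rewrite mulr_ge0 ?exprn_ge0 // ltW|exact: Pp].
  by rewrite lineX' // addSn dXE -dE radE addSn.
- exists Yp, (<[x]> + Yn)%VS; split; [exact: sX'|exact: lineX|exact: Pp| |].
    move=> y /memv_addP[_ /vlineP[a ->] [z Yz ->]] y0; rewrite (form_line _ _ _ YnX) //.
    have [z0|z0] := eqVneq z 0.
      have a0 : a != 0 by apply: contraNneq y0 => ->; rewrite scale0r z0 addr0.
      by rewrite z0 linear0l addr0 pmulr_rlt0 // exprn_gt0 // normr_gt0.
    rewrite -oppr_gt0 opprD; apply: ltr_wpDl; last by rewrite oppr_gt0; exact: Pn.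
    by rewrite -mulrN mulr_ge0 ?exprn_ge0 // oppr_ge0 ltW.
  by rewrite lineX' // addnS dXE -dE radE addSn.
Qed.

Lemma definite_trivial Y (Z : {vspace 'cV[C]_n}) : posdef Y -> (forall z, z \in Z -> B z z <= 0) ->
  (Y :&: Z = 0)%VS.
Proof.
move=> PY Zn; apply/eqP; rewrite -subv0; apply/subvP => y; rewrite memv_cap memv0.
move=> /andP[Yy /Zn h]; apply: contraT => y0.
by have := PY _ Yy y0; rewrite (le_gtF h).
Qed.

Lemma rad_add X Y : (Y <= X)%VS -> forall z, z \in (Y + radical X)%VS ->
  exists2 y, y \in Y & B z z = B y y.
Proof.
move=> YX z /memv_addP[y Yy [w /radicalP[Xw h] ->]]; exists y => //.
have yX : y \in X by exact: subvP YX _ Yy.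
by rewrite linearDl /= !linearDr /= [B y w]hermitian_swap !h // conjC0 !addr0.
Qed.

(** The definite subspaces of [exists_signature] are maximal: a positive definite one meets
    [Yn + radical X] only in 0, which bounds its dimension by that of [Yp], and symmetrically for
    negative ones. *)
Theorem sylvester_inertia X : (posidx X + negidx X + \dim (radical X) = \dim X)%N.
Proof.
have [Yp [Yn [YpX YnX Pp Pn dE]]] := exists_signature X.
have B0 (z : 'cV[C]_n) : B 0 0 = 0 by rewrite linear0l.
have dim_add Y : (Y <= X)%VS -> (Y :&: radical X = 0)%VS ->
    \dim (Y + radical X) = (\dim Y + \dim (radical X))%N.
  by move=> YX h; rewrite dimv_disjoint_sum.
have dimle Y Z : (Y <= X)%VS -> (Z <= X)%VS -> (Y :&: Z = 0)%VS ->
    (\dim Y + \dim Z <= \dim X)%N.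
  move=> YX ZX h; rewrite -dimv_disjoint_sum //; apply: dimvS.
  by rewrite subv_add YX.
have radX Z : (Z <= X)%VS -> (Z + radical X <= X)%VS by move=> ZX; rewrite subv_add ZX capvSl.
have nle Y : negdef Y -> forall y, y \in Y -> B y y <= 0.
  move=> PY y Yy; have [->|y0] := eqVneq y 0; first by rewrite linear0l.
  by rewrite ltW // PY.
have pge Y : posdef Y -> forall y, y \in Y -> 0 <= B y y.
  move=> PY y Yy; have [->|y0] := eqVneq y 0; first by rewrite linear0l.
  by rewrite ltW // PY.
have rad_triv Y : (forall y, y \in Y -> y != 0 -> B y y != 0) -> (Y :&: radical X = 0)%VS.
  move=> PY; apply/eqP; rewrite -subv0; apply/subvP => y; rewrite memv_cap memv0.
  move=> /andP[Yy /radicalP[Xy h]]; apply: contraT => y0.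
  by have := PY _ Yy y0; rewrite h ?eqxx.
have -> : posidx X = \dim Yp.
  apply: idx_bound; first by move=> x; rewrite memv0 => /eqP ->; rewrite eqxx.
  - move=> Y YX PY; have := dimle Y (Yn + radical X)%VS YX (radX _ YnX).
    rewrite dim_add //; last by apply: rad_triv => y Yy y0; rewrite lt_eqF // Pn.
    rewrite -dE -addnA leq_add2r; apply; apply: definite_trivial PY _ => z.
    by move=> /(rad_add YnX)[y Yy ->]; exact: nle Yy.
  - by exists Yp.
have -> : negidx X = \dim Yn.
  apply: idx_bound; first by move=> x; rewrite memv0 => /eqP ->; rewrite eqxx.
  - move=> Y YX PY; have := dimle (Yp + radical X)%VS Y (radX _ YpX) YX.
    rewrite dim_add //; last by apply: rad_triv => y Yy y0; rewrite gt_eqF // Pp.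
    rewrite -dE addnAC leq_add2r leq_add2l; apply.
    apply/eqP; rewrite -subv0; apply/subvP => y; rewrite memv_cap memv0.
    move=> /andP[/(rad_add YpX)[z Zz yE] Yy]; apply: contraT => y0.
    have h := PY _ Yy y0; have := pge _ Pp _ Zz; rewrite -yE => h2; by rewrite (le_gtF h2) in h.
  - by exists Yn.
exact: dE.
Qed.

(** The radical is the image under [K] of the kernel of the Gram matrix. [K] need not be injective,
    but its kernel lies in that of the Gram matrix and cancels in the count. *)
Lemma rank_gram (G : 'M[C]_n) r (K : 'M[C]_(n, r)) :
  (forall r s (K : 'M[C]_(n, r)) (L : 'M[C]_(n, s)) x y,
    B (L *m x) (K *m y) = (y^H *m (K^H *m G *m L) *m x) 0 0) ->
  (\rank (K^H *m G *m K) + \dim (radical (cspan K)) = \dim (cspan K))%N.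
Proof.
move=> BE; set b := K^H *m G *m K.
pose N := (kermx b^T)^T.
have bN : b *m N = 0 by apply: trmx_inj; rewrite trmx_mul trmxK trmx0 mulmx_ker.
have NP (x : 'cV[C]_r) : b *m x = 0 -> exists c, x = N *m c.
  move=> h; have /submxP[D DE] : (x^T <= kermx b^T)%MS.
    by apply/sub_kermxP; rewrite -trmx_mul h trmx0.
  by exists D^T; apply: trmx_inj; rewrite trmx_mul trmxK [N^T]trmxK.
have radE : radical (cspan K) = cspan (K *m N).
  apply/vspaceP => v; apply/idP/idP.
    move=> /radicalP[/memv_cspan[x ->] h]; apply/memv_cspan.
    have : b *m x = 0.
      apply/colP => i.
      have : K *m (delta_mx i 0 : 'cV_r) \in cspan K.
        by apply/memv_cspan; exists (delta_mx i 0).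
      move=> /h; rewrite BE -/b -mulmxA mxE => e; rewrite [RHS]mxE -[RHS]e.
      rewrite (bigD1 i) //= big1 ?addr0; last first.
        by move=> j ji; rewrite !mxE (negbTE ji) /= conjC0 mul0r.
      by rewrite !mxE !eqxx conjC1 mul1r.
    by move=> /NP[c ->]; exists c; rewrite mulmxA.
  move=> /memv_cspan[c ->]; apply/radicalP; split.
    by apply/memv_cspan; exists (N *m c); rewrite mulmxA.
  move=> y /memv_cspan[d ->].
  rewrite -mulmxA BE -/b; have -> : d^H *m b *m (N *m c) = d^H *m (b *m N *m c).
    by rewrite -[in RHS]mulmxA [RHS]mulmxA.
  by rewrite bN mul0mx mulmx0 mxE.
rewrite radE !dim_cspan.
have := mxrank_mul_ker N^T K^T; rewrite -trmx_mul mxrank_tr mxrank_tr.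
have -> : \rank (N^T :&: kermx K^T)%MS = (r - \rank K)%N.
  rewrite -(mxrank_tr K) -mxrank_ker; apply/eqmx_rank/andP; split; first exact: capmxSr.
  rewrite sub_capmx submx_refl andbT [N^T]trmxK; apply/sub_kermxP.
  by rewrite trmx_mul mulmxA mulmx_ker mul0mx.
have -> : \rank N = (r - \rank b)%N by rewrite mxrank_tr mxrank_ker mxrank_tr.
have := rank_leq_col K; have : (\rank b <= \rank K)%N by exact: mxrankM_maxr.
move: (\rank b) (\rank K) (\rank (K *m N)) => ??? ???; lia.
Qed.

End HermitianForms.

(** * From subspaces and isometries to matrices *)

Section OrthogonalDecomposition.
Set Implicit Arguments.
Unset Strict Implicit.
Variables (C : numClosedFieldType) (n : nat).
Variable B : {hermitian_sym 'cV[C]_n for Num.conj}.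
Variables (U W : {vspace 'cV[C]_n}) (G : 'M[C]_n).
Implicit Types (X S : {vspace 'cV[C]_n}) (h : 'M[C]_n).
Hypothesis GH : G^H = G.
Hypothesis BE : forall r s (K : 'M[C]_(n, r)) (L : 'M[C]_(n, s)) x y,
    B (L *m x) (K *m y) = (y^H *m (K^H *m G *m L) *m x) 0 0.

(* Convertible to isometry_of over R[i]. *)
Definition isom X h := mact h X = X /\
  forall x y, x \in X -> y \in X -> B (h *m x) (h *m y) = B x y.

Lemma mx_form_eq0 k l (A : 'M[C]_(k, l)) :
  (forall (x : 'cV[C]_l) (y : 'cV[C]_k), (y^H *m A *m x) 0 0 = 0) -> A = 0.
Proof.
move=> h; apply/matrixP => i j; rewrite mxE -[RHS](h (delta_mx j 0) (delta_mx i 0)).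
rewrite -mulmxA mxE (bigD1 i) //= big1 ?addr0; last first.
  by move=> k' ki; rewrite !mxE (negbTE ki) /= conjC0 mul0r.
rewrite !mxE !eqxx conjC1 mul1r (bigD1 j) //= big1 ?addr0 ?mxE ?eqxx ?mulr1 //.
by move=> l' lj; rewrite mxE (negbTE lj) mulr0.
Qed.

Lemma form_gram x y : B x y = (y^H *m G *m x) 0 0.
Proof. by rewrite -[in LHS](mul1mx x) -[in LHS](mul1mx y) BE ctr1 mul1mx mulmx1. Qed.

Lemma gram_unit : radical B fullv = 0%VS -> G \in unitmx.
Proof.
move=> r0; have [|L LG] := mx_left_inverse (M := G); last by have [] := mulmx1_unit LG.
move=> k X GX; apply/matrixP => i j; rewrite mxE.
have : col j X \in radical B fullv.
  apply/radicalP; split=> [|y _]; first exact: memvf.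
  by rewrite form_gram colE -!mulmxA [G *m _]mulmxA GX mul0mx mulmx0 mxE.
by rewrite r0 memv0 => /eqP/colP/(_ i); rewrite !mxE.
Qed.

Variables (pU pW : 'M[C]_n).
Hypotheses (radV : radical B fullv = 0%VS) (UW : forall x y, x \in U -> y \in W -> B x y = 0).
Hypothesis pUW : pU + pW = 1%:M.
Hypotheses (pUin : forall x : 'cV[C]_n, pU *m x \in U) (pWin : forall x : 'cV[C]_n, pW *m x \in W).
Hypotheses (pUid : forall x, x \in U -> pU *m x = x) (pWid : forall x, x \in W -> pW *m x = x).

Lemma splitE (x : 'cV[C]_n) : x = pU *m x + pW *m x.
Proof. by rewrite -mulmxDl pUW mul1mx. Qed.

Lemma pU_W x : x \in W -> pU *m x = 0.
Proof.
move=> Wx; have := splitE x.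
by rewrite (pWid Wx) => /eqP; rewrite -subr_eq subrr eq_sym => /eqP.
Qed.

Lemma pW_U x : x \in U -> pW *m x = 0.
Proof.
move=> Ux; have := splitE x.
by rewrite (pUid Ux) => /eqP; rewrite addrC -subr_eq subrr eq_sym => /eqP.
Qed.

Lemma form_ortho_split : ortho_split G pU pW.
Proof.
split=> //; first exact: gram_unit.
  by apply: eq_mulcV => x; rewrite -mulmxA pUid.
apply: mx_form_eq0 => x y; rewrite -BE hermitian_swap.
by rewrite UW // conjC0.
Qed.
Let sp := form_ortho_split.
Let Gu : G \in unitmx. Proof. by case: sp. Qed.

Lemma matH_stable h X p : (forall x, x \in X -> p *m x = x) -> (forall x, p *m x \in X) ->
  h *m p = p *m h -> forall x, x \in X -> h *m x \in X.
Proof. by move=> pid pin hp x Xx; rewrite -(pid x Xx) mulmxA hp -mulmxA. Qed.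

(** Preserving both summands amounts to commuting with [pU]; the form is then preserved on all of V
    because the cross terms vanish before and after applying [h]. *)
Lemma matH_isom h : matH G pU h <-> isom U h /\ isom W h.
Proof.
split=> [hh|[[hU fU] [hW fW]]].
  have comm k : matH G pU k -> k *m pW = pW *m k.
    move=> [kU _]; have := pUW; move=> /(canRL (addKr _)) ->.
    by rewrite mulmxDr mulmxDl mulmxN mulNmx mulmx1 mul1mx kU.
  have stU k : matH G pU k -> forall x, x \in U -> k *m x \in U.
    by move=> [kU _]; exact: matH_stable pUid pUin kU.
  have stW k : matH G pU k -> forall x, x \in W -> k *m x \in W.
    by move=> /comm kW; exact: matH_stable pWid pWin kW.
  have [_ hi ih] := matH_inv Gu hh; have hih := mulmx1C ih.
  have isX X : (forall k, matH G pU k -> forall x, x \in X -> k *m x \in X) -> isom X h.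
    move=> st; split; last first.
      move=> x y _ _; rewrite BE; case: hh => _ ->.
      by rewrite -form_gram.
    apply/vspaceP => x; apply/idP/idP; first by move=> /memv_mact[y Xy ->]; exact: st.
    move=> Xx; apply/memv_mact; exists (detinv h *m x); first exact: st.
    by rewrite mulmxA hih mul1mx.
  by split; apply: isX.
have hUin x : x \in U -> h *m x \in U by move=> Ux; rewrite -hU; apply/memv_mact; exists x.
have hWin x : x \in W -> h *m x \in W by move=> Wx; rewrite -hW; apply/memv_mact; exists x.
split.
  apply: eq_mulcV => x; rewrite -!mulmxA [in RHS](splitE x) mulmxDr mulmxDr.
  by rewrite (pUid (hUin _ (pUin x))) (pU_W (hWin _ (pWin x))) addr0.
apply/eqP; rewrite -subr_eq0; apply/eqP; apply: mx_form_eq0 => x y.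
rewrite mulmxBr mulmxBl mxE [X in _ + X]mxE -BE -form_gram.
rewrite (splitE x) (splitE y) !mulmxDr !linearDl /= !linearDr /=.
have WU u v : u \in W -> v \in U -> B u v = 0 by move=> Wu Uv; rewrite hermitian_swap UW ?conjC0.
rewrite (fU _ _ (pUin x) (pUin y)) (fW _ _ (pWin x) (pWin y)).
rewrite (UW (hUin _ (pUin x)) (hWin _ (pWin y))) (WU _ _ (hWin _ (pWin x)) (hUin _ (pUin y))).
by rewrite (UW (pUin x) (pWin y)) (WU _ _ (pWin x) (pUin y)) subrr.
Qed.

Section Frames.
Variables (r : nat) (S : {vspace 'cV[C]_n}) (M : 'M[C]_(n, r)).
Hypotheses (MS : cspan M = S) (dS : \dim S = r).

Lemma frame_rank : \rank M = r. Proof. by rewrite -dim_cspan MS. Qed.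

Lemma isotropic_frame : (S <= orthov B S)%VS -> M^H *m G *m M = 0.
Proof.
move=> /subvP Siso; apply: mx_form_eq0 => x y; rewrite -BE.
have inS (z : 'cV_r) : M *m z \in S by rewrite -MS; apply/memv_cspan; exists z.
by move/mem_orthovP: (Siso _ (inS x)); apply; exact: inS.
Qed.

Lemma dim_cap_kernel X (p : 'M[C]_n) : (forall x, x \in S -> (x \in X) = (p *m x == 0)) ->
  (\dim (S :&: X) + \rank (p *m M) = r)%N.
Proof.
move=> pX; have := limg_ker_dim (linfun (mulmx p : 'cV[C]_n -> 'cV[C]_n)) S.
rewrite dS -dim_cspan -mact_cspan MS -/(mact p S) => <-.
congr (\dim _ + _)%N; apply/vspaceP => x; rewrite !memv_cap memv_ker lfunE /=.
by case Sx : (x \in S) => //=; rewrite pX.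
Qed.

Lemma rank_pU_frame : (\dim (S :&: W) + \rank (pU *m M) = r)%N.
Proof.
apply: dim_cap_kernel => x _; apply/idP/eqP => [/pU_W //|h].
by rewrite (splitE x) h add0r pWin.
Qed.

Lemma rank_pW_frame : (\dim (S :&: U) + \rank (pW *m M) = r)%N.
Proof.
apply: dim_cap_kernel => x _; apply/idP/eqP => [/pW_U //|h].
by rewrite (splitE x) h addr0 pUin.
Qed.

Lemma projection_frame : ((S + W) :&: U)%VS = cspan (pU *m M).
Proof.
rewrite -mact_cspan MS; apply/vspaceP => x; rewrite memv_cap; apply/idP/idP.
  move=> /andP[/memv_addP[s Ss [w Ww xE]] Ux]; apply/memv_mact; exists s => //.
  by rewrite -(pUid Ux) xE mulmxDr (pU_W Ww) addr0.
move=> /memv_mact[s Ss ->]; rewrite pUin andbT; apply/memv_addP.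
exists s => //; exists (- (pW *m s)); first by rewrite memvN.
by rewrite {2}(splitE s) addrK.
Qed.

(** Ensures that the truncated subtraction in [a_inv] is a true one. *)
Lemma cap_sub_rad : (S <= orthov B S)%VS -> (S :&: U <= radical B ((S + W) :&: U))%VS.
Proof.
move=> /subvP Siso; apply/subvP => x; rewrite memv_cap => /andP[Sx Ux]; apply/radicalP.
rewrite memv_cap Ux andbT; split.
  by apply/memv_addP; exists x => //; exists 0; rewrite ?mem0v ?addr0.
move=> y; rewrite memv_cap => /andP[/memv_addP[s Ss [w Ww ->]] _].
rewrite linearDr /= (UW Ux Ww) addr0.
by move/mem_orthovP: (Siso _ Sx); apply.
Qed.

Lemma rank_projected_form : \rank (M^H *m G *m pU *m M) =
  (posidx B ((S + W) :&: U) + negidx B ((S + W) :&: U))%N.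
Proof.
have -> : M^H *m G *m pU *m M = (pU *m M)^H *m G *m (pU *m M).
  rewrite ctrM !mulmxA -[_ *m pU^H *m G]mulmxA -(split_GU sp) !mulmxA.
  by have [_ _ _ pUU _] := sp; rewrite -[_ *m pU *m pU]mulmxA pUU.
have := rank_gram (pU *m M) BE; rewrite -projection_frame.
rewrite -[X in _ = X -> _](sylvester_inertia B) => /eqP; rewrite eqn_add2r.
by move/eqP.
Qed.

End Frames.

Lemma dim_projection_range : \rank pU = \dim U /\ \rank pW = \dim W.
Proof.
rewrite -!dim_cspan; split; congr (\dim _); apply/vspaceP => x; apply/idP/idP.
- by move=> /memv_cspan[y ->].
- by move=> Ux; apply/memv_cspan; exists x; rewrite pUid.
- by move=> /memv_cspan[y ->].
- by move=> Wx; apply/memv_cspan; exists x; rewrite pWid.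
Qed.

End OrthogonalDecomposition.

Section FrameResolution.
Set Implicit Arguments.
Unset Strict Implicit.

(** The inverse of [row_mx A C0] is adapted to the base point by subtracting [Z *m A1] from its
    lower block. *)
Lemma frame_resolution (C : numClosedFieldType) n r s (A : 'M[C]_(n, r)) (C0 : 'M[C]_(n, s))
    (Z : 'M[C]_(s, r)) : (r + s)%N = n -> \rank (row_mx A C0) = n ->
  exists A1 C1, [/\ A1 *m (A + C0 *m Z) = 1%:M, A1 *m C0 = 0, C1 *m (A + C0 *m Z) = 0,
    C1 *m C0 = 1%:M & (A + C0 *m Z) *m A1 + C0 *m C1 = 1%:M].
Proof.
move=> rs rk; set P := row_mx A C0.
have [Q PQ] : exists Q, P *m Q = 1%:M by apply/row_freeP/eqP; exact: rk.
have [Q' QP'] : exists Q, Q *m P = 1%:M.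
  by apply/row_fullP/eqP; rewrite rk.
have QQ : Q' = Q by rewrite -[Q']mulmx1 -PQ mulmxA QP' mul1mx.
rewrite {}QQ in QP'.
move: PQ QP'; rewrite /P -[Q]vsubmxK; move: (usubmx Q) (dsubmx Q) => A1 C1.
rewrite mul_row_col mul_col_row scalar_mx_block => E /eq_block_mx[e1 e2 e3 e4].
exists A1, (C1 - Z *m A1); split.
- by rewrite mulmxDr e1 mulmxA e2 mul0mx addr0.
- exact: e2.
- rewrite mulmxBl !mulmxDr e3 !mulmxA e4 mul1mx add0r -!mulmxA e1.
  by rewrite [A1 *m _]mulmxA e2 mul0mx mulmx0 mulmx1 addr0 subrr.
- by rewrite mulmxBl e4 -mulmxA e2 mulmx0 subr0.
- by rewrite mulmxDl mulmxBr mulmxA [C0 *m C1 - _]addrC addrA addrK.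
Qed.

End FrameResolution.

(** * Orbits and stabilizers *)

Section HermitianInverse.
Set Implicit Arguments.
Unset Strict Implicit.

(** Averaging a generalized inverse with its adjoint makes it Hermitian; sandwiching [b] between two
    copies makes it reflexive. *)
Lemma hermitian_ginv (C : numClosedFieldType) r (b : 'M[C]_r) : b^H = b ->
  exists J, [/\ b *m J *m b = b, J *m b *m J = J & J^H = J].
Proof.
move=> bH; move: (mulmx_ginvK b); move: (ginv b) => K bKb.
have bKHb : b *m K^H *m b = b.
  by have := congr1 (fun A : 'M[C]_r => A^H) bKb; rewrite !ctrM bH !mulmxA.
have [J0 [J0H bJ0b]] : exists J0 : 'M[C]_r, J0^H = J0 /\ b *m J0 *m b = b.
  have h2 : (2 : C) != 0 by rewrite pnatr_eq0.
  exists (2^-1 *: (K + K^H)); split.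
    by rewrite ctrZ ctrD ctrK fmorphV rmorphMn rmorph1 [K^H + K]addrC.
  rewrite -scalemxAr -scalemxAl mulmxDr mulmxDl bKb bKHb -mulr2n -[b *+ 2]scaler_nat scalerA.
  by rewrite mulVf // scale1r.
exists (J0 *m b *m J0); split; last by rewrite !ctrM bH J0H mulmxA.
  by rewrite !mulmxA bJ0b bJ0b.
have h k (X : 'M[C]_(k, r)) : X *m b *m J0 *m b = X *m b.
  by rewrite -!mulmxA [b *m _]mulmxA bJ0b.
by rewrite !mulmxA !h.
Qed.

End HermitianInverse.

Section OrbitsOfIsotropicSubspaces.
Set Implicit Arguments.
Unset Strict Implicit.
Variables (R : realType) (Cf : complexField R) (n r s : nat).
Notation C := (ccarrier Cf).
Notation cplx := (@cplx R Cf _ _).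
Variable B : {hermitian_sym 'cV[C]_n for Num.conj}.
Variables (U W S : {vspace 'cV[C]_n}).
Hypotheses (radV : radical B fullv = 0%VS) (UWV : (U + W = fullv)%VS)
  (UIW : (U :&: W = 0)%VS) (UW : (U <= orthov B W)%VS).
Hypotheses (dS : \dim S = r) (Siso : (S <= orthov B S)%VS) (rs : (r + s)%N = n).

Let P := ((S + W) :&: U)%VS.
Let isomH h := isom B U h /\ isom B W h.

(** [u] and [w] are the dimensions of pU S and pW S, [b] the rank of the projected form. The orbit
    dimension enters through a sum, which avoids truncated subtraction. *)
Theorem orbit_and_stabilizer : exists dO dHS u w b,
  [/\ forall (A : 'M[C]_(n, r)) (C0 : 'M[C]_(n, s)), \rank (row_mx A C0) = n ->
        submanifold dO [set z | exists2 h, isomH h & mact h S = cspan (A + C0 *m cplx z)],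
      submanifold dHS [set z | isomH (cplx z) /\ mact (cplx z) S = S],
      (dHS + dO = \dim U * \dim U + \dim W * \dim W)%N,
      (dHS = (n - (\dim U + w)) * (n - (\dim U + w)) +
        (n - (\dim W + u)) * (n - (\dim W + u)) +
        (2 * ((r - b) * (r - (r - u + (r - w)))) +
         2 * ((r - w) * (r - w)) + 2 * ((r - u) * (r - u)) + b * b))%N &
      [/\ [/\ (\dim U + \dim W = n)%N, (u <= \dim U)%N & (w <= \dim W)%N],
        (\dim (S :&: W) + u = r)%N, (\dim (S :&: U) + w = r)%N,
        (b = posidx B P + negidx B P)%N &
        (b + \dim (radical B P) = u)%N /\ (\dim (S :&: U) <= \dim (radical B P))%N]].
Proof.
have UWo x y : x \in U -> y \in W -> B x y = 0.
  by move=> Ux Wy; move/subvP: UW => /(_ _ Ux) /mem_orthovP; apply.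
have [G GH BE] := gram_matrix B.
have [pU [pW [pUW pUin pWin pUid pWid]]] := direct_projection UWV UIW.
have sp := form_ortho_split GH BE radV UWo pUW pUin pWin pUid.
have Gu : G \in unitmx by case: sp.
have isoP h := matH_isom GH BE radV UWo pUW pUin pWin pUid pWid h.
have [rkU rkW] := dim_projection_range pUin pWin pUid pWid.
have [M MS] := exists_frame dS.
have Mfree := frame_freeP (frame_rank MS dS).
have Miso := isotropic_frame BE MS Siso.
have rU := rank_pU_frame pUW pWin pWid MS dS.
have rW := rank_pW_frame pUW pUin pUid MS dS.
have rb := rank_projected_form GH BE radV UWo pUW pUin pWin pUid pWid MS.
have PE := projection_frame pUW pUin pWin pUid pWid MS.
have dP : \dim P = \rank (pU *m M) by rewrite /P PE dim_cspan.
pose dim_of u w b := ((n - (\dim U + w)) * (n - (\dim U + w)) +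
        (n - (\dim W + u)) * (n - (\dim W + u)) +
        (2 * ((r - b) * (r - (r - u + (r - w)))) +
         2 * ((r - w) * (r - w)) + 2 * ((r - u) * (r - u)) + b * b))%N.
(* Stated for any isotropic frame, since the charts at other points of the orbit use the frames of
   those points. *)
have dimHS (M' : 'M[C]_(n, r)) : (forall k (Y : 'M[C]_(r, k)), M' *m Y = 0 -> Y = 0) ->
    M'^H *m G *m M' = 0 -> rdim (lieHS G pU M')
     (dim_of (\rank (pU *m M')) (\rank (pW *m M')) (\rank (M'^H *m G *m pU *m M'))).
  move=> M'free M'iso.
  have bH := betaH sp (erefl (M'^H *m G *m pU *m M')).
  have [J [bJb _ JH]] := hermitian_ginv bH.
  have := rdim_lieHS sp erefl erefl (mulmx_ginvK (pU *m M')) (mulmx_ginvK (pW *m M'))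
    erefl erefl erefl M'free M'iso JH bJb.
  by rewrite rkU rkW.
have UWn : (\dim U + \dim W = n)%N.
  by rewrite -dimv_disjoint_sum // UWV dimvf /dim /= muln1.
have dimH : rdim (lieH G pU) (\dim U * \dim U + \dim W * \dim W).
  have rk (p : 'M[C]_n) : \rank (row_mx p (0 : 'M[C]_(n, 0))) = \rank p.
    by rewrite -mxrank_tr tr_row_mx trmx0 -addsmxE addsmx0_id ?mxrank_tr.
  have := rdim_lieH_kernel sp (0 : 'M[C]_(n, 0)); rewrite !rk rkU rkW.
  have -> : (n - \dim U = \dim W)%N by move: (\dim U) (\dim W) UWn => ? ?; lia.
  have -> : (n - \dim W = \dim U)%N by move: (\dim U) (\dim W) UWn => ? ?; lia.
  rewrite addnC; apply: eq_rdim => X; split=> [[]//|hX]; split=> //.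
  by rewrite mulmx0.
have stabE h : stabH G pU M h <-> isomH h /\ mact h S = S.
  split=> [[hh [g hg]]|[/isoP hh hS]].
    split; first exact/isoP.
    have [d0 _ hi] := matH_inv Gu hh.
    apply/eqP; rewrite eqEdim -{1}MS mact_cspan hg -{1}MS cspan_mulr /=.
    rewrite dS -{1}MS mact_cspan dim_cspan.
    have : (\rank M <= \rank (h *m M))%N.
      by rewrite -[X in (\rank X <= _)%N]mul1mx -hi -mulmxA mxrankM_maxr.
    by rewrite (frame_rank MS dS).
  split=> //; apply: cspan_subP.
  by rewrite -mact_cspan MS hS.
pose u := \rank (pU *m M); pose w := \rank (pW *m M); pose b := \rank (M^H *m G *m pU *m M).
have [dHS' [dO dE]] : exists d dO, (d = dim_of u w b /\
    d + dO = \dim U * \dim U + \dim W * \dim W)%N.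
  have [V VE dV] := dimHS M Mfree Miso; have [V' VE' dV'] := dimH.
  exists (dim_of u w b), (\dim V' - \dim V)%N; split=> //.
  rewrite -dV -dV' subnKC //; apply: dimvS; apply/subvP => z /VE[hz _]; exact/VE'.
case: dE => dHE dE.
exists dO, dHS', u, w, b; split=> //; last first.
  split; [split|exact: rU|exact: rW|exact: rb|split].
  - exact: UWn.
  - by rewrite -rkU mxrankM_maxl.
  - by rewrite -rkW mxrankM_maxl.
  - by rewrite /b rb sylvester_inertia dP.
  - have h := cap_sub_rad UWo Siso; exact: dimvS h.
- have := stabH_submanifold GH Gu Mfree (dimHS M Mfree Miso).
  rewrite -/u -/w -/b -dHE; congr submanifold; apply/seteqP.
  by split=> z /= /stabE.
move=> A C0 rkAC z0 [h hh hS].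
set Z0 := cplx z0 in hS; have /isoP hG := hh.
have [d0 hI hi] := matH_inv Gu hG; have ih := mulmx1C hi.
have [A1 [C1 [A1M A1C C1M C1C res]]] := frame_resolution Z0 rs rkAC.
have [M' ME] : exists M', M' = A + C0 *m Z0 by exists (A + C0 *m Z0).
rewrite -ME in A1M C1M res hS.
(* The frame at an arbitrary orbit point differs from [h *m M] by an invertible [g0], so the three
   ranks, and with them the dimension of the stabilizer, are the same as at S. *)
have [g0 gE] : exists g0, M' = h *m M *m g0.
  by apply: cspan_subP; rewrite -mact_cspan MS hS.
pose g1 := A1 *m h *m M.
have g01 : g0 *m g1 = 1%:M by apply: mulmx1C; rewrite -A1M gE !mulmxA.
have M'free := frame_free A1M.
have MG (p : 'M[C]_n) := @form_transport C n r G p h M g0 hG.2.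
have Miso' : M'^H *m G *m M' = 0.
  have := MG 1%:M; rewrite mulmx1 mul1mx -gE !mulmx1 => /(_ erefl) ->.
  by rewrite Miso mulmx0 mul0mx.
have hpU := hG.1; have hpW := matH_commW sp hG.
have rkp (p : 'M[C]_n) : h *m p = p *m h -> \rank (p *m M') = \rank (p *m M).
  move=> hp; apply: (rank_equiv (h := h) (h' := detinv h) (g := g0) (g' := g1)) => //.
  by rewrite gE !mulmxA hp.
have rkb : \rank (M'^H *m G *m pU *m M') = b.
  apply: (rank_equiv (h := g0^H) (h' := g1^H) (g := g0) (g' := g1)) => //.
    by rewrite gE MG.
  by rewrite -ctrM g01 ctr1.
have := dimHS M' M'free Miso'; rewrite (rkp _ hpU) (rkp _ hpW) rkb -/u -/w -dHE => dimHS'.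
have bH := betaH sp (erefl (M'^H *m G *m pU *m M')).
have [J [bJb JbJ JH]] := hermitian_ginv bH.
have z0E : z0 = rcplx Z0 by rewrite /Z0 cplxK.
have := orbit_chart_at sp ME A1M A1C C1M C1C res Miso' z0E
  (mulmx_ginvK (pU *m M')) (ginv_mulmxK (pU *m M'))
  (mulmx_ginvK (pW *m M')) (ginv_mulmxK (pW *m M')) bJb JbJ JH dimH dimHS' dE.
suff -> : [set z | orbitZ G pU A C0 M' (cplx z)] =
    [set z | exists2 k, isomH k & mact k S = cspan (A + C0 *m cplx z)] by [].
apply/seteqP; split=> z /=.
  move=> /(orbitZ_unit ME A1M A1C)[k [g [g' [kG kE gg]]]].
  exists (k *m h); first by apply/isoP; exact: matHM.
  rewrite kE -MS mact_cspan gE.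
  have -> : k *m (h *m M *m g0) *m g = k *m h *m M *m (g0 *m g) by rewrite !mulmxA.
  symmetry; apply: (@cspan_eq_mulr _ _ _ _ _ (g' *m g1)).
  by rewrite -mulmxA [g *m _]mulmxA gg mul1mx.
move=> [k /isoP kG]; rewrite -MS mact_cspan => kE.
have [g gE2] : exists g, A + C0 *m cplx z = k *m M *m g.
  by apply: cspan_subP; rewrite kE.
exists (k *m detinv h), (g1 *m g); split; first exact: matHM.
rewrite gE2 gE.
have -> : k *m detinv h *m (h *m M *m g0) *m (g1 *m g) =
    k *m (detinv h *m h) *m M *m (g0 *m g1) *m g by rewrite !mulmxA.
by rewrite hi g01 !mulmx1.
Qed.

End OrbitsOfIsotropicSubspaces.

Section ComplexNumbers.
Set Implicit Arguments.
Unset Strict Implicit.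
Variable R : realType.
Implicit Types z w : R[i].

Lemma ReV z : complex.Re z^-1 = complex.Re z / (complex.Re z ^+ 2 + complex.Im z ^+ 2).
Proof. by case: z. Qed.

Lemma ImV z : complex.Im z^-1 = - (complex.Im z / (complex.Re z ^+ 2 + complex.Im z ^+ 2)).
Proof. by case: z. Qed.

Lemma ReC z : complex.Re (Num.conj z) = complex.Re z. Proof. by case: z. Qed.
Lemma ImC z : complex.Im (Num.conj z) = - complex.Im z. Proof. by case: z. Qed.

(** Transparent, because the results over the abstract interface are transferred to [R[i]] by
    conversion. *)
Definition complexR : complexField R.
refine (@ComplexField R (R[i] : numClosedFieldType) (@complex.Re R) (@complex.Im R)
  (fun a b => a +i* b)%C _ _ _ _ _ _ _ _ _ ReV ImV ReC ImC); by do ?case=> ? ?.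
Defined.

End ComplexNumbers.

Section Realify.
Set Implicit Arguments.
Unset Strict Implicit.
Variable R : realType.

Lemma realifyE m n (A : set 'M[R[i]]_(m, n)) :
  realify A = [set z | A (@cplx R (complexR R) m n z)].
Proof.
apply/seteqP; split=> z /=.
  by move=> [Z AZ <-]; rewrite -/(@rcplx R (complexR R) m n Z) rcplxK.
by move=> Az; exists (@cplx R (complexR R) m n z) => //; exact: (@cplxK R (complexR R)).
Qed.

End Realify.

(** * Arithmetic of the dimension formula *)

Section Formula.
Set Implicit Arguments.
Unset Strict Implicit.

Lemma stabilizer_dimension_formula (NU NW n r rU rW a b u w : nat) :
  (NU + NW = n)%N -> (u <= NU)%N -> (w <= NW)%N -> (rW + u = r)%N -> (rU + w = r)%N ->
  (b + (rU + a) = u)%N ->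
  ((n - (NU + w)) * (n - (NU + w)) + (n - (NW + u)) * (n - (NW + u)) +
    (2 * ((r - b) * (r - (r - u + (r - w)))) +
     2 * ((r - w) * (r - w)) + 2 * ((r - u) * (r - u)) + b * b))%N%:Z =
  (NU%:Z + rW%:Z) ^+ 2 + (NW%:Z + rU%:Z) ^+ 2 - 2 * n%:Z * r%:Z + 2 * r%:Z ^+ 2
  - 4 * rU%:Z * rW%:Z + 2 * a%:Z ^+ 2 + b%:Z * (2 * a%:Z + b%:Z).
Proof.
(* Writing [NU = u + y] and [NW = w + x] resolves the truncated subtractions; [x] and [y] are the
   codimensions of pW S in W and of pU S in U. *)
move=> <- /subnKC; move: (NU - u)%N => y <- /subnKC; move: (NW - w)%N => x <-.
move=> hu hw hb.
have -> : (u + y + (w + x) - (u + y + w) = x)%N by lia.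
have -> : (u + y + (w + x) - (w + x + u) = y)%N by lia.
have -> : (r - w = rU)%N by lia.
have -> : (r - u = rW)%N by lia.
have -> : (r - b = rW + rU + a)%N by lia.
have -> : (r - (rW + rU) = b + a)%N by lia.
have uE : u = (b + (rU + a))%N by lia.
have wE : w = (b + (rW + a))%N by lia.
have rE : r = (rW + (b + (rU + a)))%N by lia.
rewrite uE wE rE !(PoszD, PoszM); ring.
Qed.

End Formula.

Theorem theorem6p6 (R : realType) (p q p1 q1 r : nat)
    (B : {hermitian_sym 'cV[R[i]]_(p + q) for Num.conj})
    (U W S : {vspace 'cV[R[i]]_(p + q)}) (rU rW a bU bW : nat)
    (hp1 : (0 < p1 < p)%N) (hq1 : (0 < q1 < q)%N) (hr : (r <= minn p q)%N)
    (hV : nondegenerate_of_signature B fullv p q)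
    (hUW : (U + W = fullv)%VS) (hUIW : (U :&: W = 0)%VS)
    (hperp : (U <= orthov B W)%VS)
    (hU : nondegenerate_of_signature B U p1 q1)
    (hW : nondegenerate_of_signature B W (p - p1) (q - q1))
    (hS : Gr_G B r S)
    (hrU : r_U U S = rU) (hrW : r_W W S = rW) (ha : a_inv B U W S = a)
    (hbU : b_U B U W S = bU) (hbW : b_W B U W S = bW) :
  exists dimO dimHS : nat,
    [/\ Gr_submanifold r dimO (H_orbit B U W S),
        submanifold dimHS (realify (H_stab B U W S)),
        dimO%:Z = (p1%:Z + q1%:Z) ^+ 2
                  + (p%:Z - p1%:Z + q%:Z - q1%:Z) ^+ 2 - dimHS%:Z,
        dimHS%:Z = (p1%:Z + q1%:Z + rW%:Z) ^+ 2
                  + (p%:Z - p1%:Z + q%:Z - q1%:Z + rU%:Z) ^+ 2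
                  - 2 * (p%:Z + q%:Z) * r%:Z + 2 * r%:Z ^+ 2
                  - 4 * rU%:Z * rW%:Z + 2 * a%:Z ^+ 2
                  + (bU%:Z + bW%:Z) * (2 * a%:Z + bU%:Z + bW%:Z)
      & r = (rU + rW + a + bU + bW)%N].
Proof.
have dimE X s t : nondegenerate_of_signature B X s t -> \dim X = (s + t)%N.
  (* With zero radical, Sylvester's law makes the dimension the sum of the two indices. *)
  move=> [X0 Xs Xt]; rewrite -(@sylvester_inertia R[i] _ B X).
  rewrite -[posidx B X]/(pos_index B X) -[negidx B X]/(neg_index B X).
  by rewrite -[radical B X]/(Rad B X) X0 Xs Xt dimv0 addn0.
have dU := dimE _ _ _ hU; have dW := dimE _ _ _ hW.
have [dS Siso] := hS; have [radV _ _] := hV.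
have rs : (r + (p + q - r) = p + q)%N.
  by rewrite subnKC // (leq_trans hr) // (leq_trans (geq_minl _ _)) // leq_addr.
have [dO [dHS [u [w [b [orb stab dHO dHE [[UWn uU wW] hu hw bE [bradE radle]]]]]]]] :
  exists dO dHS u w b,
  [/\ forall (A : 'M[R[i]]_(p + q, r)) (C0 : 'M[R[i]]_(p + q, p + q - r)),
        \rank (row_mx A C0) = (p + q)%N ->
        submanifold dO [set z | exists2 h, H_group B U W h &
          act h S = colspan (A + C0 *m @cplx R (complexR R) _ _ z)],
      submanifold dHS [set z | H_stab B U W S (@cplx R (complexR R) _ _ z)],
      (dHS + dO = \dim U * \dim U + \dim W * \dim W)%N,
      (dHS = (p + q - (\dim U + w)) * (p + q - (\dim U + w)) +
        (p + q - (\dim W + u)) * (p + q - (\dim W + u)) +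
        (2 * ((r - b) * (r - (r - u + (r - w)))) +
         2 * ((r - w) * (r - w)) + 2 * ((r - u) * (r - u)) + b * b))%N &
      [/\ [/\ (\dim U + \dim W = p + q)%N, (u <= \dim U)%N & (w <= \dim W)%N],
        (r_W W S + u = r)%N, (r_U U S + w = r)%N,
        (b = b_U B U W S + b_W B U W S)%N &
        (b + \dim (Rad B (P_U U W S)) = u)%N /\ (r_U U S <= \dim (Rad B (P_U U W S)))%N]].
  exact: (@orbit_and_stabilizer R (complexR R) (p + q) r (p + q - r) B U W S
    radV hUW hUIW hperp dS Siso rs).
have hb : (b + (rU + a) = u)%N.
  by rewrite -bradE -ha -hrU /a_inv -/(r_U U S) subnKC.
rewrite hrU hrW hbU hbW in hu hw bE.
have dHZ := stabilizer_dimension_formula UWn uU wW hu hw hb.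
have WZ : p%:Z - p1%:Z + q%:Z - q1%:Z = ((p - p1) + (q - q1))%N%:Z.
  by move: hp1 hq1 => /andP[_ h1] /andP[_ h2]; rewrite PoszD -!subzn 1?ltnW // addrA.
rewrite dU dW in dHO dHE dHZ; exists dO, dHS; split.
- split=> [X [h [[hU1 _] [hW1 _]] <-]|A C0 rk].
    (* An element of H maps U and W onto themselves, so it is surjective on V, hence injective, and
       preserves the dimension of S. *)
    have hV1 : act h fullv = fullv by rewrite -hUW /act limgD; congr (_ + _)%VS.
    have := limg_ker_dim (linfun (mulmx h : 'cV[R[i]]_(p + q) -> 'cV[R[i]]_(p + q))) fullv.
    rewrite -/(act h fullv) hV1 capfv -[RHS]add0n => /eqP; rewrite eqn_add2r dimv_eq0 => /eqP k0.
    by rewrite -dS; apply: limg_dim_eq; rewrite k0 capv0.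
  rewrite realifyE; move: (orb A C0 rk).
  by congr submanifold; apply/seteqP; split=> z /= [h].
- by rewrite realifyE; exact: stab.
- have := congr1 Posz dHO; rewrite WZ !(PoszD, PoszM) => e; rewrite -[LHS](addKr dHS%:Z) e; ring.
- by rewrite dHE dHZ WZ bE !PoszD; ring.
- by move: hb hu bE; clear; lia.
Qed.
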